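(* Let $n>d\ge 1$ and $m>d+1$ be integers. Let $S\in\mathbb{R}^{m\times n}$ be a random matrix with i.i.d. Gaussian entries of mean $0$ and variance $1/m$. For $A\in\mathbb{R}^{n\times d}$ of rank $d$ and $y\in\mathbb{R}^n$ write $x_{LS}=\arg\min_{x\in\mathbb{R}^d}\|Ax-y\|_2^2$ and $y^\perp=y-Ax_{LS}$. Let $g:\mathbb{R}^{m\times d}\times\mathbb{R}^m\to\mathbb{R}^d$ be a measurable function such that $\widetilde{x}=g(SA,Sy)$ is an unbiased estimator of $x_{LS}$, i.e. $\mathbb{E}[g(SA,Sy)]=x_{LS}$ for every $A\in\mathbb{R}^{n\times d}$ of rank $d$ and every $y\in\mathbb{R}^n$. Then, for every $A\in\mathbb{R}^{n\times d}$ of rank $d$ and every $y\in\mathbb{R}^n$, $$\mathbb{E}\left[\|A(\widetilde{x}-x_{LS})\|_2^2\right]\ \ge\ \frac{d}{m-d-1}\,\|y^\perp\|_2^2 .$$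
   Context: The matrix $A$ and vector $y$ are deterministic; the only randomness is in the sketching matrix $S$. An estimator obtained from the Gaussian sketched data is a measurable function of $(SA,Sy)$ only. Expectations are over $S$; the left-hand side of the inequality may be $+\infty$. *)

(* Defs.v *)
From HB Require Import structures.
From mathcomp Require Import all_boot all_order all_algebra.
From mathcomp Require Import all_classical all_reals all_analysis.

Set Implicit Arguments.
Unset Strict Implicit.
Unset Printing Implicit Defensive.

Import Order.TTheory GRing.Theory Num.Theory.
Import numFieldNormedType.Exports.

Local Open Scope classical_set_scope.
Local Open Scope ring_scope.

(* Matrices carry the product sigma-algebra, i.e. the smallest one making all
   the entries measurable, as the library does for n.-tuple T. For T = R this
   is the Borel sigma-algebra of R^(m x n). *)
Definition measure_matrix_display : measure_display -> measure_display.
Proof. exact. Qed.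

Definition matrix_measurable d (T : measurableType d) (m n : nat) :
    set (set 'M[T]_(m, n)) :=
  <<s \bigcup_(ij in [set: 'I_m * 'I_n])
        preimage_set_system setT (fun M : 'M[T]_(m, n) => M ij.1 ij.2)
          measurable >>.

Section matrix_measurable_type.
Context d (T : measurableType d) (m n : nat).

Let mx_set0 : @matrix_measurable d T m n set0.
Proof. exact: sigma_algebra0. Qed.

Let mx_setC A : @matrix_measurable d T m n A -> matrix_measurable (~` A).
Proof. exact: sigma_algebraC. Qed.

Let mx_bigcup (F : (set 'M[T]_(m, n))^nat) :
  (forall i, matrix_measurable (F i)) -> matrix_measurable (\bigcup_i F i).
Proof. exact: sigma_algebra_bigcup. Qed.

HB.instance Definition _ := @isMeasurable.Build (measure_matrix_display d)
  'M[T]_(m, n) (@matrix_measurable d T m n) mx_set0 mx_setC mx_bigcup.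

End matrix_measurable_type.

Lemma measurable_matrix_entry d (T : measurableType d) (m n : nat)
    (i : 'I_m) (j : 'I_n) :
  measurable_fun [set: 'M[T]_(m, n)] (fun M : 'M[T]_(m, n) => M i j).
Proof.
move=> _ B mB; apply: sub_sigma_algebra.
by exists (i, j) => //; exists B.
Qed.

Lemma measurable_fun_matrixP d1 d2 (T1 : measurableType d1)
    (T2 : measurableType d2) (m n : nat) (f : T1 -> 'M[T2]_(m, n)) :
  measurable_fun [set: T1] f <->
  forall i j, measurable_fun [set: T1] (fun x => f x i j).
Proof.
split=> [mf i j|mf].
  exact: measurableT_comp (measurable_matrix_entry i j) mf.
apply: (@measurability _ _ _ _ setT f
  (\bigcup_(ij in [set: 'I_m * 'I_n])
     preimage_set_system setT (fun M : 'M[T2]_(m, n) => M ij.1 ij.2)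
       measurable)) => //.
move=> _ [_ [[i j] _ [B mB <-]] <-].
rewrite !setTI; have := mf i j measurableT _ mB; by rewrite setTI.
Qed.

(* The library norm on matrices is the sup norm, hence this explicit
   squared Euclidean norm. *)
Definition sqnorm2 (R : realType) (n : nat) (v : 'cV[R]_n) : R :=
  \sum_(i < n) v i ord0 ^+ 2.

Definition least_squares_argmin (R : realType) (n d : nat)
    (A : 'M[R]_(n, d)) (y : 'cV[R]_n) : set 'cV[R]_d :=
  [set x | forall z, sqnorm2 (A *m x - y) <= sqnorm2 (A *m z - y)].

(* The default value 0 is never used: the set of minimizers is nonempty, and
   it is a singleton when A has rank d. *)
Definition x_LS (R : realType) (n d : nat) (A : 'M[R]_(n, d)) (y : 'cV[R]_n) :
    'cV[R]_d :=
  xget 0 (least_squares_argmin A y).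

Definition y_perp (R : realType) (n d : nat) (A : 'M[R]_(n, d))
    (y : 'cV[R]_n) : 'cV[R]_n :=
  y - A *m x_LS A y.

Definition mutually_independent (disp : measure_display)
    (Omega : measurableType disp) (R : realType) (P : probability Omega R)
    (I : finType) (X : I -> Omega -> R) : Prop :=
  forall (J : {set I}) (B : I -> set R), (forall i, measurable (B i)) ->
    P (\bigcap_(i in [set` J]) (X i @^-1` B i)) =
    (\prod_(i in J) P (X i @^-1` B i))%E.

(* normal_prob takes the standard deviation. Its values are compared with those
   of the law of X only on measurable sets. *)
Definition gaussian_rv (disp : measure_display)
    (Omega : measurableType disp) (R : realType) (P : probability Omega R)
    (X : Omega -> R) (mean variance : R) : Prop :=
  forall B : set R, measurable B ->
    P (X @^-1` B) = normal_prob mean (Num.sqrt variance) B.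

Definition iid_gaussian_entries (disp : measure_display)
    (Omega : measurableType disp) (R : realType) (P : probability Omega R)
    (m n : nat) (S : {RV P >-> 'M[R]_(m, n)}) (mean variance : R) : Prop :=
  mutually_independent P
    (fun (ij : 'I_m * 'I_n) (w : Omega) => S w ij.1 ij.2) /\
  forall i j, gaussian_rv P (fun w => S w i j) mean variance.

Definition has_mean (disp : measure_display)
    (Omega : measurableType disp) (R : realType) (P : probability Omega R)
    (d : nat) (X : Omega -> 'cV[R]_d) (mu : 'cV[R]_d) : Prop :=
  forall k : 'I_d,
    P.-integrable setT (fun w => (X w k ord0)%:E) /\
    ('E_P[fun w => X w k ord0] = (mu k ord0)%:E)%E.

Definition unbiased_estimator (disp : measure_display)
    (Omega : measurableType disp) (R : realType) (P : probability Omega R)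
    (m n d : nat) (S : {RV P >-> 'M[R]_(m, n)})
    (g : 'M[R]_(m, d) * 'cV[R]_m -> 'cV[R]_d) : Prop :=
  forall (A : 'M[R]_(n, d)) (y : 'cV[R]_n), \rank A = d ->
    has_mean P (fun w => g (S w *m A, S w *m y)) (x_LS A y).

(* Main.v *)
Require Import Defs.
From HB Require Import structures.
From mathcomp Require Import all_boot all_order all_algebra.
From mathcomp Require Import all_classical all_reals all_analysis.
From mathcomp Require Import measurable_realfun.
From mathcomp Require Import ring lra zify.

Set Implicit Arguments.
Unset Strict Implicit.
Unset Printing Implicit Defensive.

Import Order.TTheory GRing.Theory Num.Theory.
Import numFieldNormedType.Exports.

Local Open Scope classical_set_scope.
Local Open Scope ring_scope.

(* After a QR decomposition [A = V E B], with [V] orthogonal, [E] the inclusion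
   of the first [d] coordinates and [B] invertible, and after replacing [S] by
   [S V], which has the same law, the error of [g] becomes a function [f] of [S],
   and the error of the least-squares solution of the sketched problem becomes
   [h = (S E)^+ S r] with [E^T r = 0] and [|r| = |y_perp|]. The bound is the value
   of [E |h|^2], so it is enough that [f_j - h_j] is orthogonal to [h_j].

   Since [g] is unbiased for all data matrices and all vectors, [f (S C)] has
   mean [h C] for every invertible [C]; so has [h (S C)], because a reflection
   [Q] that fixes the columns of [C E] and negates the residual leaves the law of
   [S] invariant. Changing variables turns the law of [S C] into a tilt of the
   law of [S], and the tilt is a monomial in the [exp (- |S (e_i + e_j)|^2)] for
   suitable [C]. Hence all mixed moments of these variables against [f_j - h_j]
   vanish. As they take values in [0, 1], [f_j - h_j] is then orthogonal to every
   function of them, that is, of [S^T S], and [h_j] is one. *)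

(** * Gaussian matrices *)

(** The argument is of Lehmann-Scheffe type. The data [C A], [C y] sketched by [S] are the data [A],
    [y] sketched by [S C], so unbiasedness at all data is a statement about one function [f] under a
    whole family of Gaussian laws, and [S^T S] is a complete statistic for this family. A priori [f]
    is only integrable. Hence the tilts are kept bounded by 1, so that weighted errors remain
    integrable, and completeness is established for integrable functions, from bounded statistics
    whose moments determine a measure. The vectors [e_i + e_j] are chosen because polarisation
    recovers [S^T S] from them.

    The constant arises as follows. Since [r] vanishes on the first [d] coordinates, [S r] is
    independent of [S E], and given [S E] the second moment of [h_j] is [v |r|^2] times the [j]-th
    diagonal entry of the inverse Gram matrix of [S E]. This entry is the inverse squared norm of
    the residual of one column on the [d - 1] others, which has [m - d + 1] degrees of freedom, and
    its mean is [1 / (v (m - d - 1))]. The variance [v] cancels, and the [d] coordinates contribute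
    equally. *)

Section matrix_measures.
Context {R : realType}.

Lemma measurable_matrix_forall p q (B : 'I_p -> 'I_q -> set R) :
  (forall i j, measurable (B i j)) ->
  measurable [set X : 'M[R]_(p, q) | forall i j, B i j (X i j)].
Proof.
move=> mB.
rewrite (_ : [set X | _] = \bigcap_(ij in [set: 'I_p * 'I_q])
    ((fun X : 'M[R]_(p, q) => X ij.1 ij.2) @^-1` B ij.1 ij.2)).
  apply: fin_bigcap_measurable => // -[i j] _.
  by rewrite -[X in measurable X]setTI; apply: measurable_matrix_entry.
apply/seteqP; split => [X XB [i j] _|X XB i j]; first exact: XB.
exact: (XB (i, j) I).
Qed.

Let lower_orthants p q : set (set 'M[R]_(p, q)) :=
  [set A | exists c : 'M[R]_(p, q),
    A = [set X : 'M[R]_(p, q) | forall i j, X i j < c i j]].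

Lemma measurable_lower_orthant p q (c : 'M[R]_(p, q)) :
  measurable [set X : 'M[R]_(p, q) | forall i j, X i j < c i j].
Proof.
have -> : [set X : 'M[R]_(p, q) | forall i j, X i j < c i j] =
    [set X | forall i j, `]-oo, c i j[%classic (X i j)].
  by apply/seteqP; split => X XB i j; move: (XB i j); rewrite /= in_itv.
apply: (@measurable_matrix_forall _ _ (fun i j => `]-oo, c i j[%classic)) => i j.
exact: measurable_itv.
Qed.

Let measurable_lower_orthants p q :
  measurable = <<s (@lower_orthants p q) >>.
Proof.
apply/seteqP; split; last first.
  apply: smallest_sub; first exact: sigma_algebra_measurable.
  move=> _ [c ->].
  exact: measurable_lower_orthant.
apply: smallest_sub; first exact: smallest_sigma_algebra.
move=> _ [[i j] _ /=] [B mB <-]; rewrite setTI.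
rewrite -[X in <<s _ >> X]setTI.
suff : @measurable_fun _ _ (g_sigma_algebraType (@lower_orthants p q)) R setT
    (fun X : 'M[R]_(p, q) => X i j).
  by apply.
apply: (@measurability _ _ _ _ _ _ (@RGenInftyO.G R)).
  exact: RGenInftyO.measurableE.
move=> _ [_ [b ->] <-]; rewrite setTI.
(* A half-space bounding one entry is the union of the orthants whose other bounds are all [k]. *)
rewrite (_ : _ @^-1` _ = \bigcup_k [set X : 'M[R]_(p, q) | forall i' j',
   X i' j' < (\matrix_(i0, j0) (if (i0, j0) == (i, j) then b else k%:R))i' j']).
  apply: bigcupT_measurable => k; apply: sub_sigma_algebra.
  by eexists; reflexivity.
apply/seteqP; split => [X /=|X [k _ /(_ i j)]]; last first.
  by rewrite mxE eqxx /= in_itv.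
rewrite in_itv/= => Xb.
(* The sum of strict bounds of all the entries is a bound of each of them. *)
exists (\sum_i0 \sum_j0 (Num.truncn `|X i0 j0|).+1)%N => // i' j'; rewrite mxE.
case: eqP => [[-> ->]//|_].
apply: (le_lt_trans (ler_norm _)).
apply: (lt_le_trans (truncnS_gt _)); rewrite ler_nat.
by rewrite (bigD1 i')//= (bigD1 j')//= -addnA leq_addr.
Qed.

(** A finite measure is determined by its distribution function: open lower orthants are stable
    under intersection, generate the sigma-algebra, and exhaust the space when all bounds equal
    [k]. *)
Lemma matrix_measure_unique p q
    (m1 m2 : {measure set 'M[R]_(p, q) -> \bar R}) :
  (m1 setT < +oo)%E ->
  (forall c : 'M[R]_(p, q), m1 [set X : 'M[R]_(p, q) | forall i j, X i j < c i j] =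
     m2 [set X : 'M[R]_(p, q) | forall i j, X i j < c i j]) ->
  forall A, measurable A -> m1 A = m2 A.
Proof.
move=> m1oo m12.
pose g k := [set X : 'M[R]_(p, q) | forall i j,
  X i j < (const_mx k%:R : 'M[R]_(p, q)) i j].
apply: (measure_unique (@lower_orthants p q) g) => //.
- exact: measurable_lower_orthants.
- move=> _ _ [c ->] [c' ->].
  exists (\matrix_(i, j) Num.min (c i j) (c' i j)).
  apply/seteqP; split => [X [cX c'X] i j|X cX].
    by rewrite mxE lt_min cX c'X.
  by split => i j; have := cX i j; rewrite mxE lt_min => /andP[].
- by move=> k; eexists.
- apply/seteqP; split => // X _.
  exists (\sum_i0 \sum_j0 (Num.truncn `|X i0 j0|).+1)%N => // i j; rewrite mxE.
  apply: (le_lt_trans (ler_norm _)).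
  apply: (lt_le_trans (truncnS_gt _)); rewrite ler_nat.
  by rewrite (bigD1 i)//= (bigD1 j)//= -addnA leq_addr.
- by move=> _ [c ->].
- move=> k; apply: le_lt_trans m1oo; apply: le_measure; rewrite ?inE//.
  exact: measurable_lower_orthant.
Qed.

End matrix_measures.

(** Independence and the normal law of the entries are encoded together by the probabilities of full
    rectangles; a factor [setT] leaves an entry free. The mean is 0 and [v] is the variance. *)
Definition gaussian_mx (d : measure_display) (T : measurableType d)
    (R : realType) (P : probability T R) (v : R) (p q : nat)
    (X : T -> 'M[R]_(p, q)) : Prop :=
  measurable_fun setT X /\
  forall B : 'I_p * 'I_q -> set R, (forall ij, measurable (B ij)) ->
    (P [set w | forall ij, B ij (X w ij.1 ij.2)] =
     \prod_ij normal_prob 0 (Num.sqrt v) (B ij))%E.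

Section gaussian_mx_theory.
Context {R : realType} (v : R).
Implicit Types (p q : nat).

Lemma gaussian_mx_measurable d (T : measurableType d) (P : probability T R)
    p q (X : T -> 'M[R]_(p, q)) : gaussian_mx P v X -> measurable_fun setT X.
Proof. by case. Qed.

(** Lower orthants are rectangles, so the definition fixes the law. The two matrices may live on
    different probability spaces, which allows comparison with matrices built on a product space. *)
Lemma gaussian_mx_integral d (T : measurableType d) (P : probability T R)
    d' (T' : measurableType d') (P' : probability T' R)
    p q (X : T -> 'M[R]_(p, q)) (Y : T' -> 'M[R]_(p, q))
    (G : 'M[R]_(p, q) -> \bar R) :
  gaussian_mx P v X -> gaussian_mx P' v Y ->
  measurable_fun [set: 'M[R]_(p, q)] G -> (forall Z, 0 <= G Z)%E ->
  (\int[P]_w G (X w) = \int[P']_w G (Y w))%E.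
Proof.
move=> [mX gX] [mY gY] mG G0.
have := @ge0_integral_pushforward _ _ _ _ R X mX P setT G measurableT mG
  (fun y _ => G0 y).
rewrite preimage_setT => <-.
have := @ge0_integral_pushforward _ _ _ _ R Y mY P' setT G measurableT mG
  (fun y _ => G0 y).
rewrite preimage_setT => <-.
apply: eq_measure_integral => A mA _.
apply: matrix_measure_unique => //=.
  by rewrite /pushforward preimage_setT probability_setT ltry.
move=> c; rewrite /pushforward.
pose B (ij : 'I_p * 'I_q) := `]-oo, c ij.1 ij.2[%classic.
have mB ij : measurable (B ij) by exact: measurable_itv.
transitivity (P [set w | forall ij, B ij (X w ij.1 ij.2)]).
  congr (P _); apply/seteqP; split => w h.
    by move=> [i j]; rewrite /B/= in_itv; exact: h.
  by move=> i j; move: (h (i, j)); rewrite /B/= in_itv.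
rewrite gX// -gY//; congr (P' _); apply/seteqP; split => w h.
  by move=> i j; move: (h (i, j)); rewrite /B/= in_itv.
by move=> [i j]; rewrite /B/= in_itv; exact: h.
Qed.

Lemma gaussian_mx_integrable d (T : measurableType d) (P : probability T R)
    d' (T' : measurableType d') (P' : probability T' R)
    p q (X : T -> 'M[R]_(p, q)) (Y : T' -> 'M[R]_(p, q))
    (G : 'M[R]_(p, q) -> \bar R) :
  gaussian_mx P v X -> gaussian_mx P' v Y -> measurable_fun [set: 'M[R]_(p, q)] G ->
  P.-integrable setT (fun w => G (X w)) ->
  P'.-integrable setT (fun w => G (Y w)) /\
  (\int[P]_w G (X w) = \int[P']_w G (Y w))%E.
Proof.
move=> gX gY mG /integrableP[_ iX].
have mX := gaussian_mx_measurable gX; have mY := gaussian_mx_measurable gY.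
split.
  apply/integrableP; split; first exact: measurableT_comp.
  apply: le_lt_trans iX.
  by rewrite (gaussian_mx_integral (G := fun Z => `|G Z|%E) gX gY)//;
    exact: measurableT_comp.
rewrite [LHS](integralE _ _ (G \o X)) [RHS](integralE _ _ (G \o Y)).
congr (_ - _)%E.
  under eq_integral do rewrite funepos_comp/=.
  under [RHS]eq_integral do rewrite funepos_comp/=.
  by apply: gaussian_mx_integral => //; exact: measurable_funepos.
under eq_integral do rewrite funeneg_comp/=.
under [RHS]eq_integral do rewrite funeneg_comp/=.
by apply: gaussian_mx_integral => //; exact: measurable_funeneg.
Qed.

(** The single source for columns, transposes and vectorisations of Gaussian matrices: all of them
    select distinct entries. *)
Lemma gaussian_mx_reindex d (T : measurableType d) (P : probability T R)
    p q p' q' (h : 'I_p' * 'I_q' -> 'I_p * 'I_q)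
    (X : T -> 'M[R]_(p, q)) :
  injective h -> gaussian_mx P v X ->
  gaussian_mx P v (fun w =>
    \matrix_(i < p', j < q') X w (h (i, j)).1 (h (i, j)).2).
Proof.
move=> hI [mX gX]; split.
  apply/measurable_fun_matrixP => i j.
  rewrite [X in measurable_fun _ X](_ : _ =
    (fun w => X w (h (i, j)).1 (h (i, j)).2)).
    by move/measurable_fun_matrixP : mX; apply.
  by apply/funext => w; rewrite mxE.
move=> B mB.
(* The constraint is carried back along [h], and entries outside its image are left free, so that
   they contribute factors 1. *)
pose B' ij := if [pick kl | h kl == ij] is Some kl then B kl else setT.
have B'h kl : B' (h kl) = B kl.
  by rewrite /B'; case: pickP => [kl' /eqP/hI->//|/(_ kl)]; rewrite eqxx.
have B'T ij : ij \notin codom h -> B' ij = setT.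
  rewrite /B'; case: pickP => // kl /eqP <-.
  by rewrite codom_f.
have := gX B'; rewrite [X in P X](_ : _ = [set w | forall ij : 'I_p' * 'I_q',
     B ij ((\matrix_(i < p', j < q') X w (h (i, j)).1 (h (i, j)).2)
       ij.1 ij.2)]); last first.
  apply/seteqP; split => w hw.
    by move=> [i j]; rewrite /= mxE -B'h; exact: hw.
  move=> ij; case: (boolP (ij \in codom h)) => [/codomP[kl ->]|/B'T->//].
  by rewrite B'h; have := hw kl; rewrite mxE; case: kl.
move=> ->; last first.
  by move=> ij; rewrite /B'; case: pickP.
rewrite (bigID (mem (codom h)))/= [X in (_ * X)%E]big1 ?mule1; last first.
  by move=> ij /B'T ->; rewrite probability_setT.
rewrite -big_filter.
have -> : (\prod_(i <- [seq i <- index_enum ('I_p * 'I_q)%type | i \in codom h])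
   normal_prob 0 (Num.sqrt v) (B' i) =
   \prod_(i <- [seq h kl | kl <- index_enum ('I_p' * 'I_q')%type])
     normal_prob 0 (Num.sqrt v) (B' i))%E.
  apply: perm_big; apply: uniq_perm.
  - by rewrite filter_uniq// index_enum_uniq.
  - by rewrite map_inj_uniq// index_enum_uniq.
  - move=> ij; rewrite mem_filter mem_index_enum andbT.
    apply/codomP/mapP => [[kl ->]|[kl _ ->]]; exists kl => //.
    by rewrite mem_index_enum.
by rewrite big_map; apply: eq_bigr => kl _; rewrite B'h.
Qed.

End gaussian_mx_theory.

(** * Integration against a density, and affine changes of variable for the normal law *)

Section integral_density.
Local Open Scope ereal_scope.
Context d (T : measurableType d) (R : realType).
Variables (mu nu : {measure set T -> \bar R}) (f : T -> R).
Hypotheses (mf : measurable_fun [set: T] f) (f0 : forall x, (0 <= f x)%R).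
Hypothesis nuE : forall A, measurable A -> nu A = \int[mu]_(x in A) (f x)%:E.

Import HBNNSimple.

Let integral_density_indic A : measurable A ->
  \int[nu]_x (\1_A x)%:E = \int[mu]_x ((\1_A x)%:E * (f x)%:E).
Proof.
move=> mA; rewrite integral_indic// setIT nuE// [LHS]integral_mkcond.
apply: eq_integral => x _; rewrite patchE indicE.
by case: ifPn => xA; rewrite ?mul1e ?mul0e.
Qed.

Let integral_density_nnsfun (h : {nnsfun T >-> R}) :
  \int[nu]_x (h x)%:E = \int[mu]_x ((h x)%:E * (f x)%:E).
Proof.
under [LHS]eq_integral do rewrite fimfunE -fsumEFin//.
rewrite [LHS]ge0_integral_fsum//; last 2 first.
  - by move=> r; exact/measurable_EFinP/measurableT_comp.
  - by move=> n x _; rewrite EFinM nnfun_muleindic_ge0.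
under [RHS]eq_integral.
  move=> x xD; rewrite fimfunE -fsumEFin// ge0_mule_fsuml; last first.
    by move=> r; rewrite EFinM nnfun_muleindic_ge0.
  over.
rewrite [RHS]ge0_integral_fsum//; last 2 first.
  - move=> r; apply: emeasurable_funM; last exact/measurable_EFinP.
    exact/measurable_EFinP/measurableT_comp.
  - move=> n x _; apply: mule_ge0; last by rewrite lee_fin.
    by rewrite EFinM nnfun_muleindic_ge0.
apply: eq_fsbigr => r; rewrite inE => -[x0 _ <-].
rewrite integralZl_indic_nnsfun//.
rewrite integral_density_indic// -ge0_integralZl//.
- by apply: eq_integral => x _; rewrite EFinM muleA.
- apply: emeasurable_funM; last exact/measurable_EFinP.
  exact/measurable_EFinP/measurable_indic.
- by move=> x _; rewrite mule_ge0 ?lee_fin.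
- by rewrite lee_fin.
Qed.

(** The usual passage from indicators to simple functions, then to monotone limits. *)
Lemma integral_density (h : T -> \bar R) :
  measurable_fun [set: T] h -> (forall x, 0 <= h x) ->
  \int[nu]_x h x = \int[mu]_x (h x * (f x)%:E).
Proof.
move=> mh h0; pose h_ := nnsfun_approx measurableT mh.
transitivity (limn (fun n => \int[nu]_x (h_ n x)%:E)).
  rewrite -monotone_convergence//=.
  - by apply: eq_integral => x _; apply/esym/cvg_lim => //;
      exact: cvg_nnsfun_approx.
  - by move=> n; exact/measurable_EFinP.
  - by move=> n x _; rewrite lee_fin.
  - by move=> x _ a b ab; rewrite lee_fin; exact/lefP/nd_nnsfun_approx.
under eq_fun do rewrite integral_density_nnsfun.
rewrite -monotone_convergence//=.
- apply: eq_integral => x _; apply/cvg_lim => //.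
  by apply: cvgeZr => //; exact: cvg_nnsfun_approx.
- by move=> n; apply: emeasurable_funM; exact/measurable_EFinP.
- by move=> n x _; rewrite mule_ge0 ?lee_fin.
- move=> x _ a b ab; rewrite lee_wpmul2r ?lee_fin//.
  exact/lefP/nd_nnsfun_approx.
Qed.

End integral_density.

(* [pushforward m f] with its measure structure already applied to [mf], which
   canonical structure inference would otherwise leave as a metavariable *)
Definition image_measure d1 d2 (T1 : measurableType d1) (T2 : measurableType d2)
    (R : realType) (m : {measure set T1 -> \bar R}) (f : T1 -> T2)
    (mf : measurable_fun [set: T1] f) : {measure set T2 -> \bar R} :=
  measure_function_pushforward__canonical__measure_function_Measure m mf.

Section affine_change.
Context {R : realType}.
Notation mu := (@lebesgue_measure R).

(** By uniqueness of Lebesgue measure it suffices to measure half-open intervals. A negative slope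
    exchanges the endpoints, and with them the closed side of the interval. *)
Let lebesgue_measure_affine (a b : R) (a0 : a != 0) (A : set R) :
  measurable A -> mu A = (`|a|%:E * mu ((fun t => (a * t + b)%R) @^-1` A))%E.
Proof.
have mphi : measurable_fun [set: measurableTypeR R]
    ((fun x : R => a * x + b) : _ -> measurableTypeR R).
  by apply: measurable_funD => //; apply: measurable_funM.
move=> mA.
have := @lebesgue_measure_unique R
   (mscale (NngNum (normr_ge0 a)) (image_measure mu mphi)).
apply => // _ [[x y] _ <-].
rewrite -[RHS]/(`|a|%:E * mu ((fun t => (a * t + b)%R) @^-1` `]x, y]))%E.
have [a_lt0|a_gt0|/eqP] := ltgtP a 0; last by rewrite (negbTE a0).
  rewrite (_ : _ @^-1` _ = `[(y - b) / a, (x - b) / a[%classic); last first.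
    apply/seteqP; split => t /=; rewrite !in_itv/=;
    by rewrite ltr_ndivlMr// ler_ndivrMr// ltrBlDr lerBrDr (mulrC t) andbC.
  rewrite !lebesgue_measure_itv/= !lte_fin ltr_nM2r ?invr_lt0// ltrD2r.
  case: ifPn => [xy|]; last by rewrite mule0.
  by rewrite ltr0_norm// -!EFinD -EFinM; congr EFin; field.
rewrite (_ : _ @^-1` _ = `](x - b) / a, (y - b) / a]%classic); last first.
  apply/seteqP; split => t /=; rewrite !in_itv/=;
  by rewrite ltr_pdivrMr// ler_pdivlMr// ltrBlDr lerBrDr (mulrC t).
rewrite !lebesgue_measure_itv/= !lte_fin ltr_pM2r ?invr_gt0// ltrD2r.
case: ifPn => [xy|]; last by rewrite mule0.
by rewrite gtr0_norm// -!EFinD -EFinM; congr EFin; field.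
Qed.

Lemma lebesgue_affine (a b : R) : a != 0 ->
  forall h : R -> \bar R, measurable_fun [set: R] h -> (forall x, 0 <= h x)%E ->
  (\int[mu]_x h x = `|a|%:E * \int[mu]_x h (a * x + b)%R)%E.
Proof.
move=> a0 h mh h0.
have mphi : measurable_fun [set: measurableTypeR R]
    ((fun x : R => a * x + b) : _ -> measurableTypeR R).
  by apply: measurable_funD => //; apply: measurable_funM.
have := @ge0_integral_pushforward _ _ (measurableTypeR R)
  (measurableTypeR R) R (fun x : R => a * x + b) mphi mu
  setT h measurableT mh (fun y _ => h0 y).
rewrite preimage_setT => <-.
have := @ge0_integral_mscale _ (measurableTypeR R) R (image_measure mu mphi)
  setT measurableT (NngNum (normr_ge0 a)) h mh (fun x _ => h0 x).
move=> /= <-; apply: eq_measure_integral => A mA _.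
exact: lebesgue_measure_affine.
Qed.

End affine_change.

Section normal_prob.
Context {R : realType}.
Notation mu := (@lebesgue_measure R).

Lemma integral_normal_prob (m s : R) (h : R -> \bar R) :
  measurable_fun [set: R] h -> (forall x, 0 <= h x)%E ->
  (\int[normal_prob m s]_x h x = \int[mu]_x (h x * (normal_pdf m s x)%:E))%E.
Proof.
move=> mh h0; apply: integral_density => //.
- exact: measurable_normal_pdf.
- by move=> x; exact: normal_pdf_ge0.
Qed.

(** Substitution in the Lebesgue integral produces the density at [(t - b) / a]; dividing by the
    density at [t] cancels the normalising constants and leaves the exponential. This is the
    one-dimensional case of the Gaussian tilts used below. *)
Lemma normal_prob_affine (v a b : R) (G : R -> \bar R) : 0 < v -> a != 0 ->
  measurable_fun [set: R] G -> (forall x, 0 <= G x)%E ->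
  (\int[normal_prob 0 (Num.sqrt v)]_t G (a * t + b)%R =
   `|a|^-1%:E * \int[normal_prob 0 (Num.sqrt v)]_t
     (G t * (expR (- (((t - b) / a) ^+ 2 - t ^+ 2) / (v *+ 2)))%:E))%E.
Proof.
move=> v0 a0 mG G0.
have mphi : measurable_fun [set: R] (fun x : R => a * x + b).
  by apply: measurable_funD => //; apply: measurable_funM.
have mw : measurable_fun [set: R]
    (fun t => expR (- (((t - b) / a) ^+ 2 - t ^+ 2) / (v *+ 2))).
  apply: measurableT_comp => //; apply: measurable_funM => //.
  apply: measurable_funN; apply: measurable_funB; apply: measurable_funX => //.
  by apply: measurable_funM => //; apply: measurable_funB.
rewrite integral_normal_prob//; last exact: measurableT_comp.
rewrite integral_normal_prob; last 2 first.
- by apply: emeasurable_funM => //; exact/measurable_EFinP.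
- by move=> t; rewrite mule_ge0// lee_fin expR_ge0.
pose H t := (G t * (normal_pdf 0 (Num.sqrt v) ((t - b) / a))%:E)%E.
have mH : measurable_fun [set: R] H.
  apply: emeasurable_funM => //; apply/measurable_EFinP.
  apply: (measurableT_comp (measurable_normal_pdf _ _)).
  by apply: measurable_funM => //; apply: measurable_funB.
have H0 t : (0 <= H t)%E by rewrite mule_ge0// lee_fin normal_pdf_ge0.
transitivity (\int[mu]_x H (a * x + b)%R)%E.
  apply: eq_integral => x _; rewrite /H; congr (_ * (normal_pdf _ _ _)%:E)%E.
  by field.
transitivity (`|a|^-1%:E * \int[mu]_x H x)%E.
  rewrite (lebesgue_affine b a0 mH H0) muleA -EFinM mulVf ?mul1e//.
  by rewrite normr_eq0.
congr (_ * _)%E; apply: eq_integral => t _.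
rewrite /H -muleA -EFinM; congr (_ * _%:E)%E.
have s0 : Num.sqrt v != 0 by rewrite gt_eqF// sqrtr_gt0.
rewrite !normal_pdfE// /normal_fun !subr0 sqr_sqrtr ?ltW//.
rewrite mulrCA -expRD; congr (_ * expR _).
by field; rewrite gt_eqF//= a0.
Qed.

End normal_prob.

(** * Changes of variables *)

Section linear_algebra.
Context {R : realType}.

(** Sylvester's identity: the block matrix with rows [1, B] and [- A, 1] is factored into triangular
    blocks in two ways. *)
Lemma det_1_addmulmx p q (A : 'M[R]_(p, q)) (B : 'M[R]_(q, p)) :
  \det (1%:M + A *m B) = \det (1%:M + B *m A).
Proof.
have e1 : block_mx 1%:M B (- A) 1%:M =
    block_mx 1%:M B 0 1%:M *m block_mx (1%:M + B *m A) 0 (- A) 1%:M.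
  rewrite mulmx_block !mul1mx !mul0mx !mulmx1 !add0r !mulmxN.
  by rewrite addrK.
have e2 : block_mx 1%:M B (- A) 1%:M =
    block_mx 1%:M 0 (- A) 1%:M *m block_mx 1%:M B 0 (1%:M + A *m B).
  rewrite mulmx_block !mul1mx !mul0mx !mulmx1 !addr0 !mulNmx.
  by rewrite [1%:M + _]addrC addKr.
have := congr1 determinant e1; rewrite {}e2 !det_mulmx det_ublock !det_lblock.
by rewrite det_ublock !det1 !mul1r !mulr1.
Qed.

(** The identity matrix with its [k]-th column replaced by [b], written as a rank-one update so that
    Sylvester's identity gives its determinant. *)
Definition set_col n (k : 'I_n) (b : 'cV[R]_n) : 'M[R]_n :=
  1%:M + (b - delta_mx k 0) *m (delta_mx 0 k : 'rV_n).

Lemma mul_set_col p n (M : 'M[R]_(p, n)) k b i j :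
  (M *m set_col k b) i j = if j == k then (M *m b) i 0 else M i j.
Proof.
rewrite /set_col mulmxDr mulmx1 mulmxA mulmxBr -colE [LHS]mxE.
rewrite [X in _ + X]mxE big_ord1; set u := M *m b.
rewrite !mxE (_ : ord0 = 0 :> 'I_1)// eqxx/=.
by case: eqP => [->|]; rewrite ?mulr1 ?mulr0 ?addr0// addrC subrK.
Qed.

Lemma det_set_col n (k : 'I_n) b : \det (set_col k b) = b k 0.
Proof.
rewrite /set_col det_1_addmulmx mulmxBr mul_delta_mx -rowE.
rewrite [X in \det X](_ : _ = (b k 0)%:M) ?det_scalar1//.
apply/matrixP => i j; rewrite !ord1 !mxE !eqxx/=.
by rewrite mulr1n addrC subrK.
Qed.

(* Gaussian elimination: [M] is brought to the identity by replacing its columns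
   one after the other, from left to right. *)
Lemma unitmx_ind_set_col n (Q : 'M[R]_n -> Prop) :
  Q 1%:M -> (forall k (b : 'cV_n), b k 0 != 0 -> Q (set_col k b)) ->
  (forall A B, A \in unitmx -> B \in unitmx -> Q A -> Q B -> Q (A *m B)) ->
  forall A, A \in unitmx -> Q A.
Proof.
(* Column operations bringing [invmx A] to the identity multiply up to [A] itself, so the
   elimination runs on the inverse. *)
move=> Q1 Qset QM A uA; rewrite -(invmxK A).
have uset k (b : 'cV[R]_n) : b k 0 != 0 -> set_col k b \in unitmx.
  by move=> bk; rewrite unitmxE det_set_col unitfE.
have Qstep M k (b : 'cV[R]_n) : M \in unitmx -> b k 0 != 0 ->
    Q (invmx (M *m set_col k b)) -> Q (invmx M).
  move=> uM bk QMb.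
  have -> : invmx M = set_col k b *m invmx (M *m set_col k b).
    have uMb : M *m set_col k b \in unitmx by rewrite unitmx_mul uM uset.
    apply: (can_inj (mulKmx uM)).
    by rewrite mulmxA mulmxV// mulmxV.
  apply: QM => //; [exact: uset| |exact: Qset].
  by rewrite unitmx_inv unitmx_mul uM uset.
suff key r k M : M \in unitmx -> (k + r = n)%N ->
    (forall j : 'I_n, (j < k)%N -> col j M = col j 1%:M) -> Q (invmx M).
  by apply: (key n 0%N); rewrite ?unitmx_inv.
elim: r k M => [|r IH] k M uM kr colM.
  have -> : M = 1%:M.
    apply/matrixP => i j; have := colM j; rewrite -[X in (_ < X)%N -> _](addn0 k).
    by rewrite kr ltn_ord => /(_ isT) /colP/(_ i); rewrite !mxE.
  by rewrite invmx1.
have kn : (k < n)%N by lia.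
pose kk := Ordinal kn.
(* With [b] the [k]-th column of [invmx M'], the new column [M' b] is the [k]-th unit vector;
   [set_col] is invertible exactly when the diagonal entry of [invmx M'] is nonzero. *)
have pivot M' : M' \in unitmx ->
    (forall j : 'I_n, (j < k)%N -> col j M' = col j 1%:M) ->
    invmx M' kk kk != 0 -> Q (invmx M').
  move=> uM' colM' piv; apply: (Qstep _ kk (col kk (invmx M'))) => //.
    by rewrite mxE.
  apply: (IH k.+1).
  - by rewrite unitmx_mul uM' uset// mxE.
  - by lia.
  - move=> j jk; apply/colP => i; rewrite mxE mul_set_col.
    case: eqP => [->|/eqP jkk].
      by rewrite colE mulmxA mulmxV// -colE !mxE.
    have /colM'/colP/(_ i) : (j < k)%N.
      by move: jkk; rewrite -val_eqE/=; lia.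
    by rewrite !mxE.
case: (eqVneq (invmx M kk kk) 0) => [piv0|]; last exact: pivot.
(* Otherwise the [k]-th column of the inverse would be supported on the first [k] indices, where [M]
   has the columns of the identity, and [M] could not send it to the [k]-th unit vector. *)
have [j jk Hj] : exists2 j : 'I_n, (k < j)%N & invmx M j kk != 0.
  apply: contrapT => noj.
  have Mh : M *m col kk (invmx M) = col kk 1%:M.
    by rewrite colE mulmxA mulmxV// -colE.
  have := congr1 (fun u : 'cV[R]_n => u kk 0) Mh; rewrite !mxE eqxx.
  rewrite big1 => [/eqP|i _]; first by rewrite eq_sym oner_eq0.
  rewrite [col _ _ _ _]mxE; case: (ltngtP i k) => ik.
  - have := colM _ ik => /colP/(_ kk); rewrite !mxE => ->.
    case: eqP => [ki|_]; last by rewrite mul0r.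
    by move: ik; rewrite -ki ltnn.
  - case: (eqVneq (invmx M i kk) 0) => [->|Hi]; first by rewrite mulr0.
    by exfalso; apply: noj; exists i.
  - have -> : i = kk by apply: val_inj.
    by rewrite piv0 mulr0.
(* Adding column [k] of [M] to column [j] subtracts row [j] of the inverse from its row [k]. This
   makes the pivot nonzero and, as [j > k], leaves the first [k] columns alone. *)
pose b : 'cV[R]_n := delta_mx j 0 + delta_mx kk 0.
have jkk : j != kk by rewrite -val_eqE/= gtn_eqF.
have bj : b j 0 = 1 by rewrite !mxE !eqxx (negbTE jkk) addr0.
apply: (Qstep M j b uM); first by rewrite bj oner_eq0.
have uMb : M *m set_col j b \in unitmx by rewrite unitmx_mul uM uset// bj oner_eq0.
apply: pivot => //.
- move=> i ik; rewrite -(colM i ik); apply/colP => l.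
  rewrite mxE mul_set_col; case: eqP => [ij|_]; last by rewrite mxE.
  by move: ik; rewrite ij; lia.
- have e : set_col j b *m invmx (M *m set_col j b) = invmx M.
    by apply: (can_inj (mulKmx uM)); rewrite mulmxA !mulmxV.
  set H := invmx (M *m set_col j b) in e *.
  have {}e : invmx M = H + delta_mx kk (0 : 'I_1) *m row j H.
    rewrite -e /set_col mulmxDl mul1mx -mulmxA -rowE.
    by congr (_ + _ *m _); rewrite /b addrAC subrr add0r.
  have ekk := congr1 (fun M0 : 'M[R]_n => M0 kk kk) e.
  have ej := congr1 (fun M0 : 'M[R]_n => M0 j kk) e.
  move: ekk ej; rewrite /= !mxE !big_ord1 !mxE !eqxx (negbTE jkk) mul1r mul0r.
  rewrite addr0 piv0 => Hkk Hjj; rewrite Hjj in Hj.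
  by apply: contra_neq Hj => Hkk0; move: Hkk; rewrite Hkk0 add0r.
Qed.

Definition mxnorm2 p q (X : 'M[R]_(p, q)) : R := \tr (X *m X^T).

Lemma mxnorm2E p q (X : 'M[R]_(p, q)) :
  mxnorm2 X = \sum_i \sum_j X i j ^+ 2.
Proof.
apply: eq_bigr => i _; rewrite mxE; apply: eq_bigr => j _.
by rewrite mxE expr2.
Qed.

End linear_algebra.

Section measurable_matrix_operations.
Context {R : realType} d (T : measurableType d).

Lemma measurable_entry p q (F : T -> 'M[R]_(p, q)) i j :
  measurable_fun [set: T] F -> measurable_fun [set: T] (fun w => F w i j).
Proof. by move=> /measurable_fun_matrixP; apply. Qed.

Lemma measurable_mx p q (F : 'I_p -> 'I_q -> T -> R) :
  (forall i j, measurable_fun [set: T] (F i j)) ->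
  measurable_fun [set: T] (fun w => \matrix_(i, j) F i j w).
Proof.
move=> mF; apply/measurable_fun_matrixP => i j.
by under eq_fun do rewrite mxE; exact: mF.
Qed.

Lemma measurable_mulmx p q r (F : T -> 'M[R]_(p, q)) (G : T -> 'M[R]_(q, r)) :
  measurable_fun [set: T] F -> measurable_fun [set: T] G ->
  measurable_fun [set: T] (fun w => F w *m G w).
Proof.
move=> mF mG; apply/measurable_fun_matrixP => i j.
under eq_fun do rewrite mxE.
by apply: measurable_sum => k; apply: measurable_funM; exact: measurable_entry.
Qed.

Lemma measurable_trmx p q (F : T -> 'M[R]_(p, q)) :
  measurable_fun [set: T] F -> measurable_fun [set: T] (fun w => (F w)^T).
Proof.
move=> mF; apply/measurable_fun_matrixP => i j.
by under eq_fun do rewrite mxE; exact: measurable_entry.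
Qed.

Lemma measurable_mxD p q (F G : T -> 'M[R]_(p, q)) :
  measurable_fun [set: T] F -> measurable_fun [set: T] G ->
  measurable_fun [set: T] (fun w => F w + G w).
Proof.
move=> mF mG; apply/measurable_fun_matrixP => i j.
under eq_fun do rewrite mxE.
by apply: measurable_funD; exact: measurable_entry.
Qed.

Lemma measurable_det n (F : T -> 'M[R]_n) :
  measurable_fun [set: T] F -> measurable_fun [set: T] (fun w => \det (F w)).
Proof.
move=> mF; apply: measurable_sum => s; apply: measurable_funM => //.
by apply: measurable_prod => i _; exact: measurable_entry.
Qed.

Lemma measurable_adj n (F : T -> 'M[R]_n) :
  measurable_fun [set: T] F -> measurable_fun [set: T] (fun w => \adj (F w)).
Proof.
move=> mF; apply/measurable_fun_matrixP => i j.
under eq_fun do rewrite mxE; apply: measurable_funM => //.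
apply: measurable_det; apply/measurable_fun_matrixP => k l.
by under eq_fun do rewrite !mxE; exact: measurable_entry.
Qed.

Lemma measurable_mxnorm2 p q (F : T -> 'M[R]_(p, q)) :
  measurable_fun [set: T] F -> measurable_fun [set: T] (fun w => mxnorm2 (F w)).
Proof.
move=> mF; apply: measurable_sum => i; apply: measurable_entry.
by apply: measurable_mulmx => //; exact: measurable_trmx.
Qed.

Lemma measurable_vec_mx p q (F : T -> 'rV[R]_(p * q)) :
  measurable_fun [set: T] F -> measurable_fun [set: T] (fun w => vec_mx (F w)).
Proof.
move=> mF; apply/measurable_fun_matrixP => i j.
by under eq_fun do rewrite mxE; exact: measurable_entry.
Qed.

End measurable_matrix_operations.

Definition mix_mx (R : realType) p q (J : pred ('I_p * 'I_q))
    (X Y : 'M[R]_(p, q)) : 'M[R]_(p, q) :=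
  \matrix_(i, j) if J (i, j) then X i j else Y i j.

(** * Replacing some entries by an independent copy *)

Section resampling.
Context {R : realType} (v : R).
Context d (T : measurableType d) (P : probability T R).
Context d' (T' : measurableType d') (P' : probability T' R).

Lemma gaussian_mx_mix p q (J : pred ('I_p * 'I_q))
    (X : T -> 'M[R]_(p, q)) (Y : T' -> 'M[R]_(p, q)) :
  gaussian_mx P v X -> gaussian_mx P' v Y ->
  gaussian_mx (P \x P')%E v (fun w => mix_mx J (X w.1) (Y w.2)).
Proof.
move=> [mX gX] [mY gY]; split.
  apply: measurable_mx => i j; case: (J (i, j)).
    exact: (measurableT_comp (measurable_entry _ _ mX)).
  exact: (measurableT_comp (measurable_entry _ _ mY)).
move=> B mB.
pose B1 ij := if J ij then B ij else setT.
pose B2 ij := if J ij then setT else B ij.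
have mB1 ij : measurable (B1 ij) by rewrite /B1; case: ifP.
have mB2 ij : measurable (B2 ij) by rewrite /B2; case: ifP.
rewrite (_ : [set w | _] = [set w | forall ij, B1 ij (X w ij.1 ij.2)] `*`
   [set w | forall ij, B2 ij (Y w ij.1 ij.2)]); last first.
  apply/seteqP; split => [[w w'] /= h|[w w'] /= [h1 h2] [i j]].
    by split => -[i j]; rewrite /B1 /B2; have := h (i, j); rewrite mxE/=;
      case: ifP.
  have := h1 (i, j); have := h2 (i, j); rewrite /B1 /B2 mxE/=.
  by case: ifP.
have mset (S : measurableType _) (Z : S -> 'M[R]_(p, q)) C :
    measurable_fun [set: S] Z -> (forall ij, measurable (C ij)) ->
    measurable [set w | forall ij : 'I_p * 'I_q, C ij (Z w ij.1 ij.2)].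
  move=> mZ mC.
  have := mZ measurableT _ (measurable_matrix_forall (fun i j => mC (i, j))).
  rewrite setTI; congr (measurable _); apply/seteqP; split => w /= h.
    by move=> [i j]; exact: h.
  by move=> i j; exact: (h (i, j)).
transitivity (P [set w | forall ij, B1 ij (X w ij.1 ij.2)] *
   P' [set w | forall ij, B2 ij (Y w ij.1 ij.2)])%E.
  by apply: product_measure1E; exact: mset.
rewrite gX// gY// -big_split/=; apply: eq_bigr => ij _.
by rewrite /B1 /B2; case: ifP => _; rewrite probability_setT ?mule1 ?mul1e.
Qed.

(** Plays the role of conditioning on the entries in [J]: mixing two independent copies does not
    change the law, and Tonelli's theorem integrates the fresh entries with the kept ones fixed. *)
Lemma gaussian_mx_resample p q (J : pred ('I_p * 'I_q))
    (X : T -> 'M[R]_(p, q)) (Y : T' -> 'M[R]_(p, q))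
    (G : 'M[R]_(p, q) -> \bar R) :
  gaussian_mx P v X -> gaussian_mx P' v Y ->
  measurable_fun [set: 'M[R]_(p, q)] G -> (forall Z, 0 <= G Z)%E ->
  (\int[P]_w G (X w) = \int[P]_w \int[P']_w' G (mix_mx J (X w) (Y w')))%E.
Proof.
move=> gX gY mG G0.
have gXY := gaussian_mx_mix J gX gY.
rewrite (gaussian_mx_integral gX gXY)// fubini_tonelli1//.
by apply: measurableT_comp => //; exact: gaussian_mx_measurable gXY.
Qed.

End resampling.

Section coordinate.
Context {R : realType} (v : R).
Context d (T : measurableType d) (P : probability T R).

Lemma gaussian_mx_entry p q (X : T -> 'M[R]_(p, q)) i j (h : R -> \bar R) :
  gaussian_mx P v X ->
  measurable_fun [set: R] h -> (forall t, 0 <= h t)%E ->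
  (\int[P]_w h (X w i j) = \int[normal_prob 0 (Num.sqrt v)]_t h t)%E.
Proof.
move=> [mX gX] mh h0.
have mXij := measurable_entry i j mX.
have := @ge0_integral_pushforward _ _ T (measurableTypeR R) R
  (fun w => X w i j) mXij P
  setT h measurableT mh (fun y _ => h0 y).
rewrite preimage_setT => <-.
apply: eq_measure_integral => A mA _.
pose B kl := if kl == (i, j) then A else setT.
transitivity (P [set w | forall kl, B kl (X w kl.1 kl.2)]).
  rewrite /= /pushforward; congr (P _); apply/seteqP; split => w /=.
    by move=> Aw kl; rewrite /B; case: eqP => // ->.
  by move/(_ (i, j)); rewrite /B eqxx.
rewrite gX; last by move=> kl; rewrite /B; case: ifP.
rewrite (bigD1 (i, j))//= big1 ?mule1 /B ?eqxx// => kl /negbTE ->.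
by rewrite probability_setT.
Qed.

Definition set_entry p q (X : 'M[R]_(p, q)) i0 j0 (t : R) : 'M[R]_(p, q) :=
  \matrix_(i, j) if (i, j) == (i0, j0) then t else X i j.

Lemma gaussian_mx_resample_entry p q (X : T -> 'M[R]_(p, q)) i j
    (G : 'M[R]_(p, q) -> \bar R) :
  gaussian_mx P v X ->
  measurable_fun [set: 'M[R]_(p, q)] G -> (forall Z, 0 <= G Z)%E ->
  (\int[P]_w G (X w) = \int[P]_w
    \int[normal_prob 0 (Num.sqrt v)]_t G (set_entry (X w) i j t))%E.
Proof.
move=> gX mG G0.
rewrite (gaussian_mx_resample (predC1 (i, j)) gX gX)//.
apply: eq_integral => w _.
rewrite -(gaussian_mx_entry i j gX)//.
  apply: eq_integral => w' _; congr G; apply/matrixP => k l; rewrite !mxE/=.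
  by case: eqP => [[-> ->]|].
apply: measurableT_comp => //; apply: measurable_mx => k l.
by case: eqP.
Qed.

End coordinate.

(** * Gaussian matrices under invertible linear maps *)

Section linear_change.
Context {R : realType} (v : R) (v_gt0 : 0 < v).
Context d (T : measurableType d) (P : probability T R).

(** Up to a constant factor, the density of the law of [X *m L] with respect to the law of [X]. *)
Definition gaussian_weight p q (L : 'M[R]_q) (Z : 'M[R]_(p, q)) : R :=
  expR (- (mxnorm2 (Z *m invmx L) - mxnorm2 Z) / (v *+ 2)).

Lemma gaussian_weight_ge0 p q (L : 'M[R]_q) (Z : 'M[R]_(p, q)) :
  0 <= gaussian_weight L Z.
Proof. exact: expR_ge0. Qed.

Lemma measurable_gaussian_weight d' (T' : measurableType d') p q (L : 'M[R]_q)
    (F : T' -> 'M[R]_(p, q)) : measurable_fun [set: T'] F ->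
  measurable_fun [set: T'] (fun w => gaussian_weight L (F w)).
Proof.
move=> mF; rewrite /gaussian_weight.
apply: measurableT_comp => //; apply: measurable_funM => //.
apply: measurable_funN; apply: measurable_funB; apply: measurable_mxnorm2 => //.
exact: measurable_mulmx.
Qed.

Let measurable_weighted p q (L : 'M[R]_q) (G : 'M[R]_(p, q) -> \bar R)
    (B : 'M[R]_q) : measurable_fun [set: 'M[R]_(p, q)] G ->
  measurable_fun [set: 'M[R]_(p, q)]
    (fun Z => G Z * (gaussian_weight L (Z *m B))%:E)%E.
Proof.
move=> mG; apply: emeasurable_funM => //; apply/measurable_EFinP.
by apply: measurable_gaussian_weight; apply: measurable_mulmx => //;
  exact: measurable_id.
Qed.

(** The formula is stable under products of matrices, so it is enough to prove it for the
    replacement of one column. There a single entry changes, by an affine map whose coefficients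
    depend on the other entries, and the one-dimensional substitution applies after resampling that
    entry. *)
Lemma gaussian_rV_change N (X : T -> 'rV[R]_N) (L : 'M[R]_N)
    (G : 'rV[R]_N -> \bar R) :
  gaussian_mx P v X -> L \in unitmx ->
  measurable_fun [set: 'rV[R]_N] G -> (forall Z, 0 <= G Z)%E ->
  (\int[P]_w G (X w *m L) =
   `|\det L|^-1%:E * \int[P]_w (G (X w) * (gaussian_weight L (X w))%:E))%E.
Proof.
move=> gX uL; move: L uL G; have mX := gaussian_mx_measurable gX.
apply: unitmx_ind_set_col.
- move=> G mG G0; rewrite det1 normr1 invr1 mul1e.
  apply: eq_integral => w _; rewrite /gaussian_weight invmx1 !mulmx1 subrr.
  by rewrite oppr0 mul0r expR0 mule1.
- move=> k b bk G mG G0.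
  have mGL : measurable_fun [set: 'rV[R]_N] (fun Z => G (Z *m set_col k b)).
    apply: measurableT_comp => //.
    by apply: measurable_mulmx => //; exact: measurable_id.
  have mGw : measurable_fun [set: 'rV[R]_N]
      (fun Z => G Z * (gaussian_weight (set_col k b) Z)%:E)%E.
    have := measurable_weighted (set_col k b) 1%:M mG.
    by under eq_fun do rewrite mulmx1.
  have Gw0 Z : (0 <= G Z * (gaussian_weight (set_col k b) Z)%:E)%E.
    by rewrite mule_ge0// lee_fin gaussian_weight_ge0.
  rewrite (gaussian_mx_resample_entry 0 k gX mGL)//.
  rewrite (gaussian_mx_resample_entry 0 k gX mGw)//.
  have mse : measurable_fun [set: T * R]
      (fun wt : T * R => set_entry (X wt.1) 0%R k wt.2).
    apply: measurable_mx => i j; case: eqP => _; first exact: measurable_snd.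
    exact: (measurableT_comp (measurable_entry _ _ mX) measurable_fst).
  have mF := measurable_fun_fubini_tonelli_F
    (m2 := normal_prob 0 (Num.sqrt v)) (fun wt : T * R =>
      (G (set_entry (X wt.1) 0%R k wt.2) *
       (gaussian_weight (set_col k b) (set_entry (X wt.1) 0%R k wt.2))%:E)%E)
    (measurableT_comp mGw mse) (fun wt => Gw0 _).
  rewrite det_set_col -(ge0_integralZl _ measurableT mF)//; last first.
  + by move=> w _; apply: integral_ge0.
  apply: eq_integral => w _.
  (* The contribution of the other entries, obtained by putting 0 at place [k]. *)
  pose c := (set_entry (X w) 0 k 0 *m b) 0 0.
  have setL t : set_entry (X w) 0 k t *m set_col k b =
      set_entry (X w) 0 k (b k 0 * t + c).
    apply/matrixP => i j; rewrite ord1 mul_set_col [RHS]mxE xpair_eqE eqxx/=.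
    case: ifP => [_|jk]; last by rewrite mxE xpair_eqE jk andbF.
    rewrite /c !mxE !(bigD1 k (P := xpredT))//= !mxE !eqxx mul0r add0r mulrC.
    congr (_ + _); apply: eq_bigr => l /negbTE lk.
    by rewrite !mxE xpair_eqE lk andbF.
  under eq_integral do rewrite setL.
  have mGs : measurable_fun [set: R] (fun t => G (set_entry (X w) 0 k t)).
    by apply: measurableT_comp => //; apply: measurable_mx => i j; case: eqP.
  apply: (etrans (normal_prob_affine c v_gt0 bk mGs (fun t => G0 _))).
  rewrite /fubini_F; apply: (congr1 (mule _)); apply: eq_integral => t _.
  rewrite [fst _]/= [snd _]/=; congr (_ * _%:E)%E; rewrite /gaussian_weight.
  have uL : set_col k b \in unitmx by rewrite unitmxE det_set_col unitfE.
  have -> : set_entry (X w) 0 k t *m invmx (set_col k b) =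
      set_entry (X w) 0 k ((t - c) / b k 0).
    apply: (can_inj (mulmxK uL)); rewrite mulmxKV// setL; congr set_entry.
    by rewrite mulrC divfK// subrK.
  apply: (congr1 (fun z => expR (- z / (v *+ 2)))).
  rewrite !mxnorm2E !big_ord1.
  rewrite !(bigD1 k (P := xpredT))//= [X in _ = _ + X - _](_ : _ =
    \sum_(j < N | j != k) set_entry (X w) 0 k t 0 j ^+ 2); last first.
    by apply: eq_bigr => j /negbTE jk; rewrite !mxE xpair_eqE jk andbF.
  by rewrite !mxE !eqxx opprD addrACA subrr addr0.
- move=> A B uA uB QA QB G mG G0.
  have mGB : measurable_fun [set: 'rV[R]_N] (fun Z => G (Z *m B)).
    apply: measurableT_comp => //.
    by apply: measurable_mulmx => //; exact: measurable_id.
  transitivity (\int[P]_w G (X w *m A *m B))%E.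
    by apply: eq_integral => w _; rewrite mulmxA.
  apply: (etrans (QA _ mGB (fun Z => G0 _))).
  (* The weight of [A] at [X w *m A] becomes, after substitution, a weight at [X w]; it is read as a
     function of [X w *m B] so that the formula for [B] applies. The exponents of the two weights
     then telescope. *)
  pose G' Z := (G Z * (gaussian_weight A (Z *m invmx B))%:E)%E.
  transitivity (`|\det A|^-1%:E * \int[P]_w G' (X w *m B))%E.
    apply: (congr1 (mule _)); apply: eq_integral => w _.
    by rewrite /G' mulmxK.
  rewrite QB; first last.
  + by move=> Z; rewrite mule_ge0// lee_fin gaussian_weight_ge0.
  + exact: measurable_weighted.
  rewrite muleA -EFinM det_mulmx normrM invfM; apply: (congr1 (mule _)).
  apply: eq_integral => w _; rewrite /G' -muleA -EFinM; congr (_ * _%:E)%E.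
  rewrite /gaussian_weight -expRD; congr expR.
  have -> : invmx (A *m B) = invmx B *m invmx A.
    have uAB : A *m B \in unitmx by rewrite unitmx_mul uA.
    apply: (can_inj (mulKmx uAB)); rewrite mulmxV// !mulmxA mulmxK//.
    by rewrite mulmxV.
  by rewrite mulmxA -mulrDl -opprD addrA subrK.
Qed.

Lemma mxnorm2_mxvec p q (Z : 'M[R]_(p, q)) : mxnorm2 (mxvec Z) = mxnorm2 Z.
Proof.
rewrite !mxnorm2E big_ord1 pair_bigA/= (reindex _ (curry_mxvec_bij p q))/=.
by apply: eq_bigr => -[i j] _; rewrite mxvecE.
Qed.

Lemma gaussian_mx_mxvec p q (X : T -> 'M[R]_(p, q)) :
  gaussian_mx P v X -> gaussian_mx P v (fun w => mxvec (X w)).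
Proof.
move=> gX.
pose h (ij : 'I_1 * 'I_(p * q)) : 'I_p * 'I_q :=
  enum_val (cast_ord (esym (mxvec_cast p q)) ij.2).
have hI : injective h.
  by move=> [i k] [i' k'] /enum_val_inj/cast_ord_inj/= ->; rewrite !ord1.
have := gaussian_mx_reindex hI gX; congr (gaussian_mx P v).
apply/funext => w; apply/rowP => k; rewrite mxE/=.
case/mxvec_indexP: k => i j; rewrite mxvecE /h/= /mxvec_index.
by rewrite cast_ordK enum_rankK.
Qed.

(** Vectorisation turns right multiplication by [C] into a linear map on row vectors. The constant
    is kept abstract: later either an integral is to vanish, for which [c > 0] is enough, or [c] is
    found by integrating 1. *)
Lemma gaussian_mx_change p q (X : T -> 'M[R]_(p, q)) (C : 'M[R]_q) :
  gaussian_mx P v X -> C \in unitmx ->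
  exists2 c : R, 0 < c & forall G : 'M[R]_(p, q) -> \bar R,
  measurable_fun [set: 'M[R]_(p, q)] G -> (forall Z, 0 <= G Z)%E ->
  (\int[P]_w G (X w *m C) =
   c%:E * \int[P]_w (G (X w) * (gaussian_weight C (X w))%:E))%E.
Proof.
move=> gX uC; have mX := gaussian_mx_measurable gX.
pose L := lin_mulmxr C : 'M[R]_(p * q).
have LE Z : mxvec (Z *m C) = mxvec Z *m L by rewrite /L mul_vec_lin.
have LK : L *m lin_mulmxr (invmx C) = 1%:M :> 'M[R]_(p * q).
  apply/row_matrixP => i; rewrite !rowE mulmx1 mulmxA.
  set u := delta_mx _ _; rewrite -(vec_mxK u) -LE.
  by rewrite mul_vec_lin/= mulmxK.
have uL : L \in unitmx by case/mulmx1_unit: LK.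
have LVE Z : mxvec (Z *m invmx C) = mxvec Z *m invmx L.
  by rewrite -[in RHS](mulmxKV uC Z) LE mulmxK.
have gV := gaussian_mx_mxvec gX.
exists (`|\det L|^-1) => [|G mG G0].
  by rewrite invr_gt0 normr_gt0 -unitfE -unitmxE.
rewrite [LHS](_ : _ = \int[P]_w G (vec_mx (mxvec (X w) *m L)))%E; last first.
  by apply: eq_integral => w _; rewrite -LE mxvecK.
have mGvec : measurable_fun [set: 'rV[R]_(p * q)] (fun z => G (vec_mx z)).
  apply: (measurableT_comp mG); apply: measurable_vec_mx.
  exact: measurable_id.
apply: (etrans (gaussian_rV_change gV uL mGvec (fun z => G0 _))).
apply: (congr1 (mule _)); apply: eq_integral => w _.
by rewrite /= mxvecK /gaussian_weight -LVE !mxnorm2_mxvec.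
Qed.

(** An isometry has weight 1 everywhere, and the constant function 1 then forces [c = 1]. *)
Lemma gaussian_mx_orthogonal p q (X : T -> 'M[R]_(p, q)) (Q : 'M[R]_q)
    (G : 'M[R]_(p, q) -> \bar R) :
  gaussian_mx P v X -> Q *m Q^T = 1%:M ->
  measurable_fun [set: 'M[R]_(p, q)] G -> (forall Z, 0 <= G Z)%E ->
  (\int[P]_w G (X w *m Q) = \int[P]_w G (X w))%E.
Proof.
move=> gX QQ; have [uQ uQT] := mulmx1_unit QQ.
have wQ (Z : 'M[R]_(p, q)) : gaussian_weight Q Z = 1 :> R.
  rewrite /gaussian_weight; have -> : invmx Q = Q^T.
    by apply: (can_inj (mulKmx uQ)); rewrite mulmxV.
  rewrite /mxnorm2 trmx_mul trmxK mulmxA -(mulmxA _ Q^T Q).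
  by rewrite (mulmx1C QQ) mulmx1 subrr oppr0 mul0r expR0.
have [c c0 chg] := gaussian_mx_change gX uQ.
have c1 : c = 1.
  have := chg (cst 1%E) (measurable_cst _) (fun _ => lee01).
  under [in RHS]eq_integral do rewrite wQ mule1.
  rewrite integral_cst//= probability_setT !mul1e mule1.
  by move=> [<-].
move=> mG G0; rewrite chg// c1 mul1e.
by apply: eq_integral => w _; rewrite wQ mule1.
Qed.

End linear_change.

(** Letting [s] tend to 1 from both sides would give [2 x = 2 v]; an explicit [s] near 1 refutes
    each strict inequality. The hypotheses are the shape in which the Laplace transform of a squared
    normal variable bounds its mean. *)
Lemma eq_of_quadratic_bounds (R : realType) (v x : R) : 0 < v -> 0 <= x ->
  (forall s, 0 < s -> s < 1 -> s * (1 + s) * x <= 2 * v) ->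
  (forall s, 1 < s -> 2 * v <= s * (1 + s) * x) -> x = v.
Proof.
move=> v0 x_ge0 up lo.
apply/eqP; rewrite eq_le; apply/andP; split; rewrite leNgt; apply/negP => xv.
  have x0 : 0 < x by apply: lt_trans xv.
  (* Chosen so that [t x = (x - v) / 2]: then [2 x - 3 t x] equals [2 v + (x - v) / 2], already
     larger than [2 v]. *)
  pose t := (x - v) / (2 * x).
  have tx : t * x = (x - v) / 2 by rewrite /t; field; rewrite gt_eqF.
  have t0 : 0 < t by rewrite divr_gt0 ?mulr_gt0// subr_gt0.
  have t1 : t < 1 by rewrite /t ltr_pdivrMr ?mulr_gt0//; lra.
  have := up (1 - t); rewrite subr_gt0 t1 ltrBlDr ltrDl t0 => /(_ isT isT).
  have -> : (1 - t) * (1 + (1 - t)) * x = 2 * x - 3 * (t * x) + t * (t * x).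
    by ring.
  rewrite tx => h; have : 0 < t * ((x - v) / 2).
    by rewrite mulr_gt0// divr_gt0// subr_gt0.
  by lra.
pose t := (v - x) / (2 * v).
have tv : t * v = (v - x) / 2 by rewrite /t; field; rewrite gt_eqF.
have t0 : 0 < t by rewrite divr_gt0 ?mulr_gt0// subr_gt0.
have t1 : t < 1 by rewrite /t ltr_pdivrMr ?mulr_gt0//; lra.
have := lo (1 + t); rewrite ltrDl t0 => /(_ isT) h.
have tx : t * x < t * v by rewrite ltr_pM2l.
have ttx : t * (t * x) <= t * x 
  by apply: ler_piMl; [apply: mulr_ge0 => //|]; exact: ltW.
have e : (1 + t) * (1 + (1 + t)) * x = 2 * x + 3 * (t * x) + t * (t * x) by ring.
rewrite {}e in h; rewrite tv in tx; lra.
Qed.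

(** * Second moments and inverse Gram matrices *)

Section projections.
Context {R : realType} (v : R) (v_gt0 : 0 < v).
Context d (T : measurableType d) (P : probability T R).

Lemma mxnorm2_ge0 p q (X : 'M[R]_(p, q)) : 0 <= mxnorm2 X.
Proof.
rewrite mxnorm2E; apply: sumr_ge0 => i _; apply: sumr_ge0 => j _.
exact: sqr_ge0.
Qed.

Lemma mxnorm2_eq0 p q (X : 'M[R]_(p, q)) : mxnorm2 X = 0 -> X = 0.
Proof.
rewrite mxnorm2E => /eqP; rewrite psumr_eq0 => [/allP h|i _]; last first.
  by apply: sumr_ge0 => j _; exact: sqr_ge0.
apply/matrixP => i j; have := h i (mem_index_enum _).
rewrite psumr_eq0 => [/allP/(_ j (mem_index_enum _))|k _]; last exact: sqr_ge0.
by rewrite sqrf_eq0 mxE => /eqP.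
Qed.

Lemma mxnorm2_tr p q (X : 'M[R]_(p, q)) : mxnorm2 X^T = mxnorm2 X.
Proof. by rewrite /mxnorm2 trmxK mxtrace_mulC. Qed.

(** The Laplace transform of [|z Pi|^2], a scaled chi-square variable with [r] degrees of freedom.
    The matrix [L] scales the range of [Pi] by [s^-1], its weight is the integrand, and the change
    of variables for the constant function 1 shows that the integral is [\det L]. The rank of [Pi]
    enters through this determinant only. *)
Lemma gaussian_projection N (z : T -> 'rV[R]_N) (Pi : 'M[R]_N) (r : nat) (s : R) :
  gaussian_mx P v z -> Pi^T = Pi -> Pi *m Pi = Pi -> 0 < s ->
  \det (1%:M + (s^-1 - 1) *: Pi) = s^-1 ^+ r ->
  (\int[P]_w (expR (- ((s ^+ 2 - 1) / (v *+ 2) * mxnorm2 (z w *m Pi))))%:E =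
   (s^-1 ^+ r)%:E)%E.
Proof.
move=> gz PT PP s0 detL.
pose L := 1%:M + (s^-1 - 1) *: Pi; pose L' := 1%:M + (s - 1) *: Pi.
have LL' : L *m L' = 1%:M.
  rewrite /L /L' mulmxDr mulmx1 -scalemxAr mulmxDl mul1mx -scalemxAl PP.
  rewrite scalerDr scalerA -addrA -!scalerDl.
  rewrite [X in X *: Pi](_ : _ = 0) ?scale0r ?addr0//.
  by field; rewrite gt_eqF.
have [uL _] := mulmx1_unit LL'.
have iL : invmx L = L' by apply: (can_inj (mulKmx uL)); rewrite mulmxV.
have wE (Z : 'rV[R]_N) : gaussian_weight v L Z =
    expR (- ((s ^+ 2 - 1) / (v *+ 2) * mxnorm2 (Z *m Pi))).
  rewrite /gaussian_weight iL; congr expR.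
  have -> : mxnorm2 (Z *m L') = mxnorm2 Z + (s ^+ 2 - 1) * mxnorm2 (Z *m Pi).
    have L'T : L'^T = L' by rewrite /L' linearD linearZ/= trmx1 PT.
    have L'L' : L' *m L' = 1%:M + (s ^+ 2 - 1) *: Pi.
      rewrite /L' mulmxDr mulmx1 -scalemxAr mulmxDl mul1mx -scalemxAl PP.
      rewrite scalerDr scalerA -addrA -!scalerDl.
      by congr (_ + _ *: _); ring.
    rewrite /mxnorm2 !trmx_mul PT L'T !mulmxA -(mulmxA Z L') -(mulmxA Z Pi) PP.
    rewrite L'L' mulmxDr mulmx1 mulmxDl mxtraceD -scalemxAr -scalemxAl.
    by rewrite mxtraceZ.
  by rewrite [X in - X]addrC addKr mulNr mulrAC.
have := gaussian_rV_change v_gt0 gz uL (measurable_cst 1%E) (fun _ => lee01).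
rewrite integral_cst//= probability_setT mul1e => h.
have sr : 0 < s^-1 ^+ r by rewrite exprn_gt0// invr_gt0.
transitivity (\int[P]_w (gaussian_weight v L (z w))%:E)%E.
  by apply: eq_integral => w _; rewrite wE.
move: h; rewrite detL gtr0_norm//.
under eq_integral do rewrite mul1e.
set I := (\int[P]_w _)%E => h.
transitivity ((s^-1 ^+ r)%:E * ((s^-1 ^+ r)^-1%:E * I))%E; last by rewrite -h mule1.
by rewrite muleA -EFinM mulfV ?mul1e// gt_eqF.
Qed.

Let det_rank1 N (c : 'cV[R]_N) (a : R) : mxnorm2 c != 0 ->
  \det (1%:M + a *: ((mxnorm2 c)^-1 *: (c *m c^T))) = 1 + a.
Proof.
move=> c0; rewrite scalerA scalemxAl det_1_addmulmx -scalemxAr.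
rewrite [c^T *m c]mx11_scalar -trace_mx11 mxtrace_mulC -/(mxnorm2 c).
by rewrite scale_scalar_mx -mulrA mulVf// mulr1 -raddfD det_scalar1.
Qed.

(** The scalar [z c] is, up to [|c|], the length of the projection of [z] on the line of [c]. Its
    second moment is read off the Laplace transform [s^-1] by convexity, without differentiating
    under the integral. *)
Lemma gaussian_second_moment N (z : T -> 'rV[R]_N) (c : 'cV[R]_N) :
  gaussian_mx P v z ->
  (\int[P]_w (((z w *m c) 0 0) ^+ 2)%:E = (v * mxnorm2 c)%:E)%E.
Proof.
move=> gz; have mz := gaussian_mx_measurable gz.
have [c0|c0] := eqVneq (mxnorm2 c) 0.
  rewrite c0 mulr0 (mxnorm2_eq0 c0); apply: integral0_eq => w _.
  by rewrite mulmx0 mxE expr0n.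
have cp : 0 < mxnorm2 c by rewrite lt_neqAle eq_sym c0 mxnorm2_ge0.
pose Pi := (mxnorm2 c)^-1 *: (c *m c^T).
have PT : Pi^T = Pi by rewrite /Pi linearZ/= trmx_mul trmxK.
have cc : c^T *m c = (mxnorm2 c)%:M.
  by rewrite [LHS]mx11_scalar -trace_mx11 mxtrace_mulC.
have PP : Pi *m Pi = Pi.
  rewrite /Pi -scalemxAr -scalemxAl scalerA mulmxA -(mulmxA c) cc.
  by rewrite mul_mx_scalar -scalemxAl scalerA -mulrA mulVf// mulr1.
pose y w := mxnorm2 (z w *m Pi).
have yE w : y w = (mxnorm2 c)^-1 * ((z w *m c) 0 0) ^+ 2.
  rewrite /y /mxnorm2 trmx_mul PT mulmxA -(mulmxA (z w)) PP /Pi.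
  rewrite -scalemxAr -scalemxAl mxtraceZ; congr (_ * _).
  rewrite (mulmxA (z w)) -(mulmxA _ c^T) -trmx_mul trace_mx11; set u := _ *m c.
  by rewrite [LHS]mxE big_ord1 [u^T _ _]mxE expr2.
have my : measurable_fun [set: T] y.
  by apply: measurable_mxnorm2; exact: measurable_mulmx.
have y0 w : 0 <= y w by exact: mxnorm2_ge0.
have Ey s : 0 < s ->
    (\int[P]_w (expR (- ((s ^+ 2 - 1) / (v *+ 2) * y w)))%:E = (s^-1)%:E)%E.
  move=> s0; rewrite (gaussian_projection (r := 1) gz PT PP s0) ?expr1//.
  by rewrite det_rank1// addrC subrK.
have mexp (a : R) : measurable_fun [set: T] (fun w => (expR (- (a * y w)))%:E).
  apply/measurable_EFinP; apply: measurableT_comp => //.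
  by apply: measurable_funN; apply: measurable_funM.
pose e := (\int[P]_w (y w)%:E)%E.
have e0 : (0 <= e)%E by apply: integral_ge0 => w _; rewrite lee_fin.
have mEy : measurable_fun [set: T] (fun w => (y w)%:E) by exact/measurable_EFinP.
(* the two tangent bounds [1 + x <= exp x], for tilts [s < 1] and [s > 1] *)
have up s : 0 < s -> s < 1 -> (((1 - s ^+ 2) / (v *+ 2))%:E * e + 1 <= (s^-1)%:E)%E.
  move=> s0 s1; rewrite -Ey// -(probability_setT P) -[P _]mul1e -integral_cst//.
  have a0 : 0 <= (1 - s ^+ 2) / (v *+ 2).
    by rewrite divr_ge0 ?mulrn_wge0 ?(ltW v_gt0)// subr_ge0 expr_le1 ?ltW.
  rewrite -ge0_integralZl//; last by move=> w _; rewrite lee_fin.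
  rewrite -ge0_integralD//; first 1 last.
  - by move=> w _; rewrite mule_ge0// lee_fin.
  - exact: measurable_funeM.
  apply: ge0_le_integral => //.
  - by move=> w _; rewrite adde_ge0// mule_ge0// lee_fin.
  - by apply: emeasurable_funD => //; exact: measurable_funeM.
  - move=> w _; rewrite -EFinM -EFinD lee_fin addrC.
    rewrite (_ : - (_ * y w) = (1 - s ^+ 2) / (v *+ 2) * y w).
      exact: expR_ge1Dx.
    by rewrite -mulNr -mulNr opprB.
have lo s : 1 < s -> (1 <= (s^-1)%:E + ((s ^+ 2 - 1) / (v *+ 2))%:E * e)%E.
  move=> s1; have s0 : 0 < s by apply: lt_trans s1.
  rewrite -Ey// -{1}(probability_setT P) -[P _]mul1e -integral_cst//.
  have a0 : 0 <= (s ^+ 2 - 1) / (v *+ 2).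
    by rewrite divr_ge0 ?mulrn_wge0 ?(ltW v_gt0)// subr_ge0 expr_ge1 ?ltW.
  rewrite -ge0_integralZl//; last by move=> w _; rewrite lee_fin.
  rewrite -ge0_integralD//; first 1 last.
  - by move=> w _; rewrite mule_ge0// lee_fin.
  - exact: measurable_funeM.
  apply: ge0_le_integral => //.
  - by apply: emeasurable_funD => //; exact: measurable_funeM.
  - move=> w _; rewrite -EFinM -EFinD lee_fin.
    rewrite -lerBlDr; exact: expR_ge1Dx.
have ev : e = v%:E.
  have efin : e \is a fin_num.
    (* The upper bound at [s = 1/2] has a finite right-hand side, which excludes an infinite
       moment. *)
    rewrite ge0_fin_numE// ltNge leye_eq; apply/negP => /eqP einf.
    have i2 : (2^-1 : R) < 1 by rewrite invf_lt1// ltr1n.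
    have i0 : 0 < (2^-1 : R) by rewrite invr_gt0.
    have := up 2^-1 i0 i2; rewrite einf gt0_muley.
      by rewrite addye// leye_eq.
    by rewrite lte_fin divr_gt0 ?mulrn_wgt0// subr_gt0 expr_lt1.
  have := fine_ge0 e0.
  rewrite -(fineK efin) in up lo *; move: (fine e) up lo => x up lo x0.
  have v2 : v *+ 2 = 2 * v by rewrite mulr_natl.
  have {}up s : 0 < s -> s < 1 -> s * (1 + s) * x <= 2 * v.
    move=> s0 s1; have := up s s0 s1; rewrite -EFinM -EFinD lee_fin v2 => h.
    have vs0 : 0 <= 2 * v * s by rewrite !mulr_ge0// ltW.
    have s10 : 0 < 1 - s by rewrite subr_gt0.
    rewrite -(ler_pM2l s10); have := ler_wpM2l vs0 h.
    rewrite (_ : 2 * v * s * s^-1 = 2 * v); last by rewrite mulfK// gt_eqF.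
    rewrite (_ : 2 * v * s * _ = (1 - s) * (s * (1 + s) * x) + 2 * v * s).
      by rewrite -lerBrDr => /le_trans; apply; lra.
    by field; rewrite gt_eqF.
  have {}lo s : 1 < s -> 2 * v <= s * (1 + s) * x.
    move=> s1; have := lo s s1; rewrite -EFinM -EFinD lee_fin v2 => h.
    have s0 : 0 < s by apply: lt_trans s1.
    have vs0 : 0 <= 2 * v * s by rewrite !mulr_ge0// ltW.
    have s10 : 0 < s - 1 by rewrite subr_gt0.
    rewrite -(ler_pM2l s10); have := ler_wpM2l vs0 h.
    rewrite (_ : 2 * v * s * (_ + _) = 2 * v + (s - 1) * (s * (1 + s) * x)).
      by rewrite mulr1 -lerBlDl => h'; apply: le_trans h'; lra.
    by field; rewrite !gt_eqF.
  congr EFin; apply: (eq_of_quadratic_bounds v_gt0 x0 up lo).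
rewrite (_ : (fun w => _) = (fun w => (mxnorm2 c)%:E * (y w)%:E)%E); last first.
  by apply/funext => w; rewrite yE -EFinM mulrA mulfV// mul1r.
have c0' : (0 <= (mxnorm2 c)%:E)%E by rewrite lee_fin ltW.
rewrite ge0_integralZl//; first by rewrite -/e ev -EFinM mulrC.
by move=> w _; rewrite lee_fin.
Qed.

End projections.

(** * Inverses as integrals of exponentials, and the mean of an inverse chi-square variable *)

Section exponential_integrals.
Context {R : realType}.
Notation mu := (@lebesgue_measure R).

Let ge0_FTC (f F : R -> R) :
  (forall t, 0 <= f t) -> continuous f -> (forall t : R, is_derive t 1 F (f t)) ->
  F t @[t --> +oo] --> (0 : R) ->
  (\int[mu]_(t in `[0%R, +oo[) (f t)%:E = (- F 0)%:E)%E.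
Proof.
move=> f0 cf dF F0.
rewrite (@ge0_continuous_FTC2y R f F 0 0)//.
- by rewrite sub0e EFinN.
- exact: continuous_subspaceT.
- apply: cvg_at_right_filter; apply: differentiable_continuous.
  by apply/derivable1_diffP; exact: ex_derive.
- by move=> t _; rewrite derive1E derive_val.
Qed.

Lemma integral_expRN (c : R) : 0 < c ->
  (\int[mu]_(t in `[0%R, +oo[) (expR (- (c * t)))%:E = (c^-1)%:E)%E.
Proof.
move=> c0; pose f (t : R) : R := expR (- (c * t)); pose F (t : R) : R := - c^-1 * f t.
have f0 t : 0 <= f t by exact: expR_ge0.
have cf : continuous f.
  move=> t; apply: (@continuous_comp _ _ _ (fun t => - (c * t)) expR).
    apply: (@continuousN _ R^o); apply: (@continuousM _ _ (cst c) id) => //.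
    exact: cst_continuous.
  exact: continuous_expR.
have dF (t : R) : is_derive t 1 F (f t).
  apply: is_derive_eq.
  rewrite /f ?scaler0 ?addr0 /GRing.scale/= ?mulr1.
  by field; rewrite gt_eqF.
have Foo : F t @[t --> +oo] --> (0 : R).
  rewrite -[X in _ --> X](mulr0 (- c^-1)); apply: cvgM; first exact: cvg_cst.
  apply: (cvg_comp (fun t : R => c * t) (fun x => expR (- x)) _ (@cvgr_expR R)).
  exact: gt0_cvgMry.
rewrite (ge0_FTC f0 cf dF Foo) /F /f.
by rewrite mulr0 oppr0 expR0 mulr1 opprK.
Qed.

(** With [u = expR (2 * t) - 1] this is half the integral of [expR (- a u)]. The parametrisation by
    [expR (2 * t)] matches the tilts [s = expR t], whose Laplace transforms are powers of [s^-1]. *)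
Lemma integral_expR_expR (a : R) : 0 < a ->
  (\int[mu]_(t in `[0%R, +oo[)
     (expR (2 * t) * expR (- (a * (expR (2 * t) - 1))))%:E = ((2 * a)^-1)%:E)%E.
Proof.
move=> a0; pose h (t : R) : R := expR (- (a * (expR (2 * t) - 1))).
pose f (t : R) : R := expR (2 * t) * h t; pose F (t : R) : R := - (2 * a)^-1 * h t.
have f0 t : 0 <= f t by rewrite mulr_ge0// expR_ge0.
have c1 : continuous (fun t : R => expR (2 * t)).
  move=> t; apply: (@continuous_comp _ _ _ (fun t : R => 2 * t) expR).
    by apply: (@continuousM _ _ (cst 2) id) => //; exact: cst_continuous.
  exact: continuous_expR.
have ch : continuous h.
  move=> t; apply: (@continuous_comp _ _ _
    (fun t : R => - (a * (expR (2 * t) - 1))) expR); last exact: continuous_expR.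
  apply: (@continuousN _ R^o).
  apply: (@continuousM _ _ (cst a) (fun t : R => expR (2 * t) - 1)).
    exact: cst_continuous.
  by apply: (@continuousB _ R^o); [exact: c1|exact: cst_continuous].
have cf : continuous f.
  by move=> t; apply: (@continuousM _ _ (fun t : R => expR (2 * t)) h);
    [exact: c1|exact: ch].
have dF (t : R) : is_derive t 1 F (f t).
  apply: is_derive_eq.
  rewrite /f /h ?scaler0 ?addr0 /GRing.scale/= ?mulr1.
  by field; rewrite gt_eqF.
have Foo : F t @[t --> +oo] --> (0 : R).
  rewrite -[X in _ --> X](mulr0 (- (2 * a)^-1)).
  apply: cvgM; first exact: cvg_cst.
  apply: (cvg_comp (fun t : R => a * (expR (2 * t) - 1)) (fun x => expR (- x))
    _ (@cvgr_expR R)).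
  apply: (@ger_cvgy _ _ _ R (fun t : R => (2 * a) * t)).
    near=> t; rewrite -mulrA mulrCA ler_pM2l// lerBrDl.
    exact: expR_ge1Dx.
  by apply: gt0_cvgMry; rewrite ?mulr_gt0.
rewrite (ge0_FTC f0 cf dF Foo) /F /h.
by rewrite mulr0 expR0 subrr mulr0 oppr0 expR0 mulr1 opprK.
Unshelve. all: by end_near. Qed.

End exponential_integrals.

Lemma measurable_invr (R : realType) :
  measurable_fun [set: R] (fun x : R => x^-1).
Proof.
rewrite -(setvU [set 0 : R]); apply/measurable_funU => //.
  exact: measurableC.
split; last exact: measurable_fun_set1.
apply: open_continuous_measurable_fun.
  by rewrite openC; exact: closed_eq.
by move=> x; rewrite inE/= => /eqP x0; exact: inv_continuous.
Qed.

Section residual.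
Context {R : realType}.

(* orthogonal projection onto the orthogonal complement of the column space of
   [N], when the columns of [N] are linearly independent *)
Definition resid_proj p k (N : 'M[R]_(p, k)) : 'M[R]_p :=
  1%:M - N *m invmx (N^T *m N) *m N^T.

Lemma resid_proj_tr p k (N : 'M[R]_(p, k)) : (resid_proj N)^T = resid_proj N.
Proof.
rewrite /resid_proj linearB/= trmx1 !trmx_mul trmxK trmx_inv trmx_mul trmxK.
by rewrite mulmxA.
Qed.

Lemma resid_proj_mul p k (N : 'M[R]_(p, k)) :
  N^T *m N \in unitmx -> resid_proj N *m N = 0.
Proof.
by move=> uN; rewrite /resid_proj mulmxBl mul1mx -(mulmxA _ N^T N) mulmxKV ?subrr.
Qed.

Lemma resid_proj_idem p k (N : 'M[R]_(p, k)) :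
  N^T *m N \in unitmx -> resid_proj N *m resid_proj N = resid_proj N.
Proof.
move=> uN; rewrite {2}/resid_proj mulmxBr mulmx1 !mulmxA resid_proj_mul//.
by rewrite !mul0mx subr0.
Qed.

(** The matrix acts as [b] on a space of dimension [p - k] and as 1 on the column space of [N]. Once
    [b] is factored out, Sylvester's identity leaves a scalar matrix of size [k]. *)
Lemma det_resid_proj p k (N : 'M[R]_(p, k)) (b : R) :
  N^T *m N \in unitmx -> (k <= p)%N -> b != 0 ->
  \det (1%:M + (b - 1) *: resid_proj N) = b ^+ (p - k).
Proof.
move=> uN kp b0.
have -> : 1%:M + (b - 1) *: resid_proj N =
    b *: (1%:M + (- ((b - 1) / b) *: N) *m (invmx (N^T *m N) *m N^T)).
  rewrite /resid_proj [RHS]scalerDr scalerBr addrA -scalemxAl scalerA.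
  rewrite mulrN mulrCA mulfV// mulr1 scaleNr mulmxA; congr (_ - _).
  by rewrite -[X in X + _]scale1r -scalerDl addrC subrK.
rewrite detZ det_1_addmulmx -scalemxAr -mulmxA mulVmx// scalemx1 -raddfD det_scalar.
have -> : 1 + - ((b - 1) / b) = b^-1 by field.
by rewrite exprB ?unitfE// exprVn.
Qed.

End residual.

Section gaussian_residual.
Context {R : realType} (v : R) (v_gt0 : 0 < v).
Context d (T : measurableType d) (P : probability T R).
Context p k (N : 'M[R]_(p, k)) (uN : N^T *m N \in unitmx).
Context (z : T -> 'cV[R]_p) (gz : gaussian_mx P v z).
Notation mu := (@lebesgue_measure R).

Let tau w := mxnorm2 (resid_proj N *m z w).

Let mtau : measurable_fun [set: T] tau.
Proof.
apply: measurable_mxnorm2; apply: measurable_mulmx => //.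
exact: gaussian_mx_measurable gz.
Qed.

Let tau_ge0 w : 0 <= tau w. Proof. exact: mxnorm2_ge0. Qed.

Let gaussian_resid_exp (s : R) : (k <= p)%N -> 0 < s ->
  (\int[P]_w (expR (- ((s ^+ 2 - 1) / (v *+ 2) * tau w)))%:E =
   (s^-1 ^+ (p - k))%:E)%E.
Proof.
move=> kp s0.
have gzT : gaussian_mx P v (fun w => (z w)^T).
  have := gaussian_mx_reindex (p' := 1) (q' := p)
    (h := fun ij => (ij.2, ij.1)) _ gz.
  have hI : injective (fun ij : 'I_1 * 'I_p => (ij.2, ij.1)).
    by move=> [i j] [i' j'] [-> ->].
  move=> /(_ hI); congr (gaussian_mx P v); apply/funext => w.
  by apply/matrixP => i j; rewrite !mxE.
have := gaussian_projection (Pi := resid_proj N) (r := p - k) v_gt0 gzT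
  (resid_proj_tr N) (resid_proj_idem uN) s0.
rewrite det_resid_proj// ?invr_eq0 ?gt_eqF// => /(_ erefl) <-.
apply: eq_integral => w _; rewrite /tau -mxnorm2_tr trmx_mul.
by rewrite resid_proj_tr.
Qed.

(** On this event the exponential [expR (- a tau)] is 1, so its probability is at most the Laplace
    transform [s^-1 ^+ (p - k)], which is as small as desired for large [s]. *)
Lemma gaussian_resid_neq0 : (k < p)%N ->
  P [set w | mxnorm2 (resid_proj N *m z w) = 0] = 0%E.
Proof.
move=> kp; have mE : measurable [set w | tau w = 0].
  have := mtau measurableT (measurable_set1 0).
  by rewrite setTI.
apply/eqP; rewrite eq_le measure_ge0 andbT; apply/lee_addgt0Pr => e e0.
rewrite add0e -[X in P X]setIT -integral_indic//.
(* Ensures both [s^-1 <= e] and [s^-1 <= 1], so the exponent [p - k >= 1] only helps. *)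
pose s := e^-1 + 1.
have s0 : 0 < s by rewrite addr_gt0// invr_gt0.
have s1 : s^-1 <= 1 by rewrite invf_le1// lerDr invr_ge0 ltW.
apply: (@le_trans _ _ (s^-1 ^+ (p - k))%:E); last first.
  rewrite lee_fin; apply: (@le_trans _ _ s^-1).
    rewrite -[leRHS]expr1 ler_wiXn2l// ?invr_ge0 ?ltW// subn_gt0//.
  by rewrite invf_ple ?posrE// /s lerDl ler01.
rewrite -(gaussian_resid_exp (ltnW kp) s0).
apply: ge0_le_integral => //=.
- exact/measurable_EFinP/measurable_indic.
- apply/measurable_EFinP; apply: measurableT_comp => //.
  by apply: measurable_funN; apply: measurable_funM.
- move=> w _; rewrite lee_fin indicE.
  case: (boolP (_ \in _)) => [|_]; last exact: expR_ge0.
  by rewrite inE/= => h; rewrite /tau h mulr0 oppr0 expR0.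
Qed.

(** The inverse moment of a chi-square variable with [p - k] degrees of freedom. For [tau > 0],
    [v / tau] is the integral over [t >= 0] of [expR (2 t) expR (- tau (expR (2 t) - 1) / (2 v))].
    By Tonelli and the Laplace transform at [s = expR t], its mean is the integral of
    [expR (- (p - k - 2) t)], which converges because [p - k > 2]. *)
Lemma gaussian_resid_inv : (k + 2 < p)%N ->
  (\int[P]_w ((mxnorm2 (resid_proj N *m z w))^-1)%:E =
   ((v * (p - k - 2)%:R)^-1)%:E)%E.
Proof.
move=> kp; have kp' : (k < p)%N by lia.
pose K w (t : R) : R :=
  expR (2 * t) * expR (- (tau w / (v *+ 2) * (expR (2 * t) - 1))).
pose D := `[0%R, +oo[%classic : set R.
have mD : measurable D by exact: measurable_itv.
pose f (wt : T * R) := ((\1_D wt.2)%:E * (K wt.1 wt.2)%:E)%E.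
have mf : measurable_fun [set: T * R] f.
  apply: emeasurable_funM.
    apply/measurable_EFinP; exact: (measurableT_comp (measurable_indic _)).
  apply/measurable_EFinP; apply: measurable_funM.
    apply: measurableT_comp => //.
    by apply: measurable_funM => //; exact: measurable_snd.
  apply: measurableT_comp => //; apply: measurable_funN.
  apply: measurable_funM.
    apply: measurable_funM => //.
    exact: (measurableT_comp mtau measurable_fst).
  apply: measurable_funB => //; apply: measurableT_comp => //.
  by apply: measurable_funM => //; exact: measurable_snd.
have f0 wt : (0 <= f wt)%E.
  by rewrite mule_ge0// lee_fin// mulr_ge0// expR_ge0.
have intD (h : R -> R) :
    (\int[mu]_t ((\1_D t)%:E * (h t)%:E) = \int[mu]_(t in D) (h t)%:E)%E.
  rewrite [RHS]integral_mkcond; apply: eq_integral => t _.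
  rewrite patchE indicE; case: ifP => _; first by rewrite mul1e.
  by rewrite mul0e.
have mtauV : measurable_fun [set: T] (fun w => ((tau w)^-1)%:E).
  apply/measurable_EFinP.
  exact: (measurableT_comp (@measurable_invr R) mtau).
have e1 : (\int[P]_w \int[mu]_t f (w, t) = \int[P]_w (v%:E * ((tau w)^-1)%:E))%E.
  apply: ge0_ae_eq_integral => //.
  - exact: measurable_fun_fubini_tonelli_F.
  - exact: measurable_funeM.
  - by move=> w _; apply: integral_ge0.
  - by move=> w _; rewrite mule_ge0 ?lee_fin ?invr_ge0// ltW.
  exists [set w | tau w = 0]; split.
  - have := mtau measurableT (measurable_set1 0).
    by rewrite setTI.
  - exact: gaussian_resid_neq0.
  move=> w /= h; apply: contrapT => /eqP tw; apply: h => _.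
  have a0 : 0 < tau w / (v *+ 2).
    by rewrite divr_gt0 ?mulrn_wgt0// lt_neqAle eq_sym tw tau_ge0.
  apply: (etrans (intD (K w))); apply: (etrans (integral_expR_expR a0)).
  by rewrite -EFinM; congr EFin; rewrite -mulr_natl; field; rewrite tw gt_eqF.
have mK t : measurable_fun [set: T] (fun w => (K w t)%:E).
  apply/measurable_EFinP; apply: measurable_funM => //.
  apply: measurableT_comp => //; apply: measurable_funN.
  by apply: measurable_funM => //; apply: measurable_funM.
have K0 w t : (0 <= (K w t)%:E)%E by rewrite lee_fin mulr_ge0// expR_ge0.
have EK t : (\int[P]_w (K w t)%:E = (expR (- ((p - k - 2)%:R * t)))%:E)%E.
  pose s := expR t; have s0 : 0 < s by exact: expR_gt0.
  have s2 : expR (2 * t) = s ^+ 2 by rewrite expRM_natl.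
  transitivity (\int[P]_w ((s ^+ 2)%:E *
      (expR (- ((s ^+ 2 - 1) / (v *+ 2) * tau w)))%:E))%E.
    apply: eq_integral => w _; rewrite -EFinM /K s2; congr (_ * expR _)%:E.
    by rewrite mulrC mulrA mulrAC.
  rewrite ge0_integralZl//.
  - rewrite gaussian_resid_exp ?(ltnW kp')// -EFinM; congr EFin.
    rewrite /s -expRN -!expRM_natl -expRD; congr expR.
    have -> : (p - k - 2)%:R = (p - k)%:R - 2 :> R by rewrite -natrB//; lia.
    by ring.
  - apply/measurable_EFinP; apply: measurableT_comp => //.
    by apply: measurable_funN; apply: measurable_funM.
  - by rewrite lee_fin sqr_ge0.
have e2 : (\int[P]_w \int[mu]_t f (w, t) = ((p - k - 2)%:R^-1)%:E)%E.
  apply: (etrans (fubini_tonelli (m1 := P) (m2 := mu) f mf f0)).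
  have n0 : 0 < (p - k - 2)%:R :> R by rewrite ltr0n; lia.
  rewrite -(integral_expRN n0) -intD; apply: eq_integral => t _.
  by rewrite -EK -ge0_integralZl// lee_fin.
move: e2; rewrite e1 ge0_integralZl//; last first.
- by rewrite lee_fin ltW.
- by move=> w _; rewrite lee_fin invr_ge0.
move=> h; rewrite invfM EFinM -h muleA -EFinM mulVf ?mul1e// gt_eqF//.
Qed.

End gaussian_residual.

(** * Gram determinants and the mean of the inverse Gram matrix *)

Section gram.
Context {R : realType}.

Lemma mul_col' p q r (A : 'M[R]_(p, q)) (B : 'M[R]_(q, r)) j :
  A *m col' j B = col' j (A *m B).
Proof.
apply/matrixP => i l; rewrite !mxE; apply: eq_bigr => s _.
by rewrite mxE.
Qed.

Lemma adj_gram p k (M : 'M[R]_(p, k.+1)) j :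
  (\adj (M^T *m M)) j j = \det ((col' j M)^T *m col' j M).
Proof.
rewrite mxE /cofactor -signr_odd addnn odd_double expr0 mul1r; congr (\det _).
apply/matrixP => a b; rewrite !mxE; apply: eq_bigr => i _.
by rewrite !mxE.
Qed.

(* replacing the [j]-th column by its residual on the other ones does not
   change the determinant *)
Lemma det_gram_col' p k (M : 'M[R]_(p, k.+1)) j (N := col' j M) :
  N^T *m N \in unitmx ->
  \det (M^T *m M) =
  mxnorm2 (resid_proj N *m col j M) * \det (N^T *m N).
Proof.
move=> uN; set y := resid_proj N *m col j M.
(* The [j]-th unit vector minus the regression coefficients of column [j] on the others, so that
   [M u] is the residual. As [u j 0 = 1], the column operation [set_col j u] has determinant 1. *)
pose u : 'cV[R]_k.+1 :=
  delta_mx j 0 - col' j 1%:M *m (invmx (N^T *m N) *m N^T *m col j M).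
have uj : u j 0 = 1.
  rewrite !mxE !eqxx big1 ?subr0// => l _.
  by rewrite !mxE (negbTE (neq_lift _ _)) mul0r.
have Mu : M *m u = y.
  rewrite /u mulmxBr -colE (mulmxA M (col' j 1%:M)) mul_col' mulmx1 -/N /y /resid_proj mulmxBl.
  by rewrite mul1mx !mulmxA.
pose M' := M *m set_col j u.
have -> : \det (M^T *m M) = \det (M'^T *m M').
  rewrite /M' trmx_mul mulmxA -(mulmxA _ M^T) !det_mulmx det_tr det_set_col uj.
  by rewrite mul1r mulr1.
have M'j : col j M' = y.
  by rewrite -Mu; apply/colP => i; rewrite mxE mul_set_col eqxx.
have M'N : col' j M' = N.
  apply/matrixP => i l; rewrite [LHS]mxE mul_set_col [RHS]mxE.
  by rewrite eq_sym (negbTE (neq_lift _ _)).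
have Ny : N^T *m y = 0.
  apply: trmx_inj; rewrite trmx_mul trmxK /y trmx_mul resid_proj_tr -mulmxA.
  by rewrite resid_proj_mul// mulmx0 trmx0.
(* The residual is orthogonal to the other columns, so only the diagonal term of the expansion
   survives. *)
rewrite (expand_det_col _ j) (bigD1 j)//= [X in _ + X]big1 ?addr0.
  congr (_ * _).
    rewrite -M'j /mxnorm2 mxtrace_mulC trace_mx11 !mxE; apply: eq_bigr => l _.
    by rewrite !mxE.
  have := adj_gram M' j; rewrite M'N mxE => <-.
  by [].
move=> i ij; case: (unliftP j i) ij => [l ->|->]; last by rewrite eqxx.
move=> _; rewrite (_ : (M'^T *m M') _ _ = 0) ?mul0r//.
have := congr1 (fun A : 'cV[R]_k => A l 0) Ny.
rewrite -M'N -M'j !mxE => e; rewrite -[RHS]e; apply: eq_bigr => s _.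
by rewrite !mxE.
Qed.

(** Induction through the residual formula. If the Gram matrix of the other columns is singular, a
    vector of its kernel extended by a zero shows that the full Gram matrix is singular too. *)
Lemma det_gram_ge0 p k (M : 'M[R]_(p, k)) : 0 <= \det (M^T *m M).
Proof.
elim: k M => [|k IH] M; first by rewrite det_mx00 ler01.
have [detN|] := eqVneq (\det ((col' ord0 M)^T *m col' ord0 M)) 0; last first.
  move=> detN; rewrite (@det_gram_col' _ _ _ ord0) ?unitmxE ?unitfE//=.
  by rewrite mulr_ge0// ?mxnorm2_ge0.
have /eqP/det0P[u u0 uN] := detN.
have uN0 : u *m (col' ord0 M)^T = 0.
  apply: mxnorm2_eq0; rewrite /mxnorm2 trmx_mul trmxK mulmxA -(mulmxA u) uN.
  by rewrite mul0mx mxtrace0.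
pose E := col' ord0 (1%:M : 'M[R]_k.+1).
have ME : M *m E = col' ord0 M by rewrite /E mul_col' mulmx1.
suff /eqP -> : \det (M^T *m M) == 0 by [].
apply/det0P; exists (u *m E^T).
  apply: contra_neq u0 => uE; apply/rowP => l.
  have := congr1 (fun A : 'rV[R]_k.+1 => A 0 (lift ord0 l)) uE.
  rewrite !mxE (bigD1 l)//= !mxE eqxx mulr1 big1 ?addr0// => l' l'l.
  by rewrite !mxE (inj_eq lift_inj) eq_sym (negbTE l'l) mulr0.
by rewrite mulmxA -(mulmxA u) -trmx_mul ME uN0 mul0mx.
Qed.

End gram.

Section gaussian_gram.
Context {R : realType} (v : R) (v_gt0 : 0 < v).
Context d (T : measurableType d) (P : probability T R).

Let measurable_det_gram p k d' (T' : measurableType d')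
    (Y : T' -> 'M[R]_(p, k)) : measurable_fun [set: T'] Y ->
  measurable_fun [set: T'] (fun w => \det ((Y w)^T *m Y w)).
Proof.
move=> mY; apply: measurable_det; apply: measurable_mulmx => //.
exact: measurable_trmx.
Qed.

Let other_columns p k (j : 'I_k.+1) : pred ('I_p * 'I_k.+1) :=
  [pred il | il.2 != j].

Let col'_mix p k (j : 'I_k.+1) (A B : 'M[R]_(p, k.+1)) :
  col' j (mix_mx (@other_columns p k j) A B) = col' j A.
Proof.
apply/matrixP => i l; rewrite !mxE /other_columns/=.
by rewrite eq_sym neq_lift.
Qed.

Let col_mix p k (j : 'I_k.+1) (A B : 'M[R]_(p, k.+1)) :
  col j (mix_mx (@other_columns p k j) A B) = col j B.
Proof. by apply/matrixP => i l; rewrite !mxE /other_columns/= eqxx. Qed.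

Lemma gaussian_mx_col' p k (X : T -> 'M[R]_(p, k.+1)) j :
  gaussian_mx P v X -> gaussian_mx P v (fun w => col' j (X w)).
Proof.
have hI : injective (fun il : 'I_p * 'I_k => (il.1, lift j il.2)).
  move=> [i l] [i' l'] e.
  have [/= -> /lift_inj ->//] := (congr1 fst e, congr1 snd e).
exact: gaussian_mx_reindex hI.
Qed.

Lemma gaussian_mx_col p k (X : T -> 'M[R]_(p, k)) j :
  gaussian_mx P v X -> gaussian_mx P v (fun w => col j (X w)).
Proof.
have hI : injective (fun il : 'I_p * 'I_1 => (il.1, j)).
  by move=> [i l] [i' l'] [->]; rewrite !ord1.
exact: gaussian_mx_reindex hI.
Qed.

(** Induction on the number of columns: with the other columns fixed and independent, the
    determinant is a nonzero factor times the squared residual of a fresh Gaussian column, which is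
    almost surely nonzero. *)
Lemma gaussian_gram_neq0 p k (X : T -> 'M[R]_(p, k)) :
  gaussian_mx P v X -> (k <= p)%N ->
  P [set w | \det ((X w)^T *m X w) = 0] = 0%E.
Proof.
elim: k X => [|k IH] X gX kp.
  rewrite (_ : [set w | _] = set0) ?measure0//.
  apply/seteqP; split => // w /= /eqP.
  by rewrite det_mx00 oner_eq0.
have mX := gaussian_mx_measurable gX.
have mdet := measurable_det_gram mX.
have mE : measurable [set w | \det ((X w)^T *m X w) = 0].
  by have := mdet measurableT _ (measurable_set1 0); rewrite setTI.
pose G (M : 'M[R]_(p, k.+1)) : \bar R := (\1_[set 0 : R] (\det (M^T *m M)))%:E.
have mG : measurable_fun [set: 'M[R]_(p, k.+1)] G.
  apply/measurable_EFinP; apply: measurableT_comp => //.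
  by apply: measurable_det_gram; exact: measurable_id.
have G0 M : (0 <= G M)%E by rewrite lee_fin.
transitivity (\int[P]_w G (X w))%E.
  rewrite -[X in P X]setIT -integral_indic//.
rewrite (gaussian_mx_resample (@other_columns p k ord0) gX gX mG G0).
transitivity (\int[P]_w (cst 0 w : \bar R))%E; last by rewrite integral0.
apply: ge0_ae_eq_integral => //.
- have mmix : measurable_fun [set: T * T]
      (fun ww => mix_mx (@other_columns p k ord0) (X ww.1) (X ww.2)).
    exact: gaussian_mx_measurable (gaussian_mx_mix _ gX gX).
  exact: (measurable_fun_fubini_tonelli_F (m2 := P) _ (measurableT_comp mG mmix)
    (fun _ => G0 _)).
- by move=> w _; apply: integral_ge0.
have gN := gaussian_mx_col' ord0 gX.
exists [set w | \det ((col' ord0 (X w))^T *m col' ord0 (X w)) = 0]; split.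
- have := measurable_det_gram (gaussian_mx_measurable gN).
  by move=> /(_ measurableT _ (measurable_set1 0)); rewrite setTI.
- by apply: IH => //; exact: ltnW.
move=> w /= h; apply: contrapT => /eqP detN; apply: h => _.
have uN : (col' ord0 (X w))^T *m col' ord0 (X w) \in unitmx.
  by rewrite unitmxE unitfE.
have gz := gaussian_mx_col ord0 gX.
rewrite -[RHS](gaussian_resid_neq0 v_gt0 uN gz)//.
rewrite -[X in P X]setIT -integral_indic//; last first.
  have mr : measurable_fun [set: T] (fun w' =>
      mxnorm2 (resid_proj (col' ord0 (X w)) *m col ord0 (X w'))).
    apply: measurable_mxnorm2; apply: measurable_mulmx => //.
    exact: gaussian_mx_measurable gz.
  by have := mr measurableT _ (measurable_set1 0); rewrite setTI.
apply: eq_integral => w' _; rewrite /G (@det_gram_col' _ _ _ _ ord0) /= col'_mix//.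
rewrite col_mix !indicE; congr (nat_of_bool _)%:R%:E.
apply/idP/idP; rewrite !inE/=; last by move=> ->; rewrite mul0r.
by move=> /eqP; rewrite mulf_eq0 (negbTE detN) orbF => /eqP.
Qed.

(** A diagonal entry of the inverse Gram matrix is a ratio of two Gram determinants, that is, the
    inverse squared norm of the residual of column [j] on the [k] others. Resampling column [j] with
    the others fixed reduces its mean to the inverse moment of a residual. Singular cases form null
    sets. *)
Lemma gaussian_gram_inv_diag p k (X : T -> 'M[R]_(p, k.+1)) j :
  gaussian_mx P v X -> (k + 2 < p)%N ->
  (\int[P]_w ((\det ((X w)^T *m X w))^-1 * (\adj ((X w)^T *m X w)) j j)%:E =
   ((v * (p - k - 2)%:R)^-1)%:E)%E.
Proof.
move=> gX kp.
pose G (M : 'M[R]_(p, k.+1)) : \bar R :=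
  ((\det (M^T *m M))^-1 * (\adj (M^T *m M)) j j)%:E.
have GE M : G M =
    ((\det (M^T *m M))^-1 * \det ((col' j M)^T *m col' j M))%:E.
  by rewrite /G adj_gram.
have mG : measurable_fun [set: 'M[R]_(p, k.+1)] G.
  apply/measurable_EFinP; apply: measurable_funM.
    apply: (measurableT_comp (@measurable_invr R)).
    by apply: measurable_det_gram; exact: measurable_id.
  apply: measurable_entry; apply: measurable_adj; apply: measurable_mulmx => //.
  exact: measurable_trmx.
have G0 M : (0 <= G M)%E.
  by rewrite GE lee_fin mulr_ge0// ?invr_ge0 det_gram_ge0.
rewrite (gaussian_mx_resample (@other_columns p k j) gX gX mG G0).
transitivity (\int[P]_w ((v * (p - k - 2)%:R)^-1)%:E)%E; last first.
  rewrite integral_cst// -[RHS]mule1; congr (_ * _)%E.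
  exact: probability_setT.
apply: ge0_ae_eq_integral => //.
- have mmix : measurable_fun [set: T * T]
      (fun ww => mix_mx (@other_columns p k j) (X ww.1) (X ww.2)).
    exact: gaussian_mx_measurable (gaussian_mx_mix _ gX gX).
  exact: (measurable_fun_fubini_tonelli_F (m2 := P) _ (measurableT_comp mG mmix)
    (fun _ => G0 _)).
- by move=> w _; apply: integral_ge0.
- by move=> w _; rewrite lee_fin invr_ge0 mulr_ge0// ltW.
have gN := gaussian_mx_col' j gX.
exists [set w | \det ((col' j (X w))^T *m col' j (X w)) = 0]; split.
- have := measurable_det_gram (gaussian_mx_measurable gN).
  by move=> /(_ measurableT _ (measurable_set1 0)); rewrite setTI.
- by apply: gaussian_gram_neq0 => //; lia.
move=> w /= h; apply: contrapT => /eqP detN; apply: h => _.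
have uN : (col' j (X w))^T *m col' j (X w) \in unitmx.
  by rewrite unitmxE unitfE.
have gz := gaussian_mx_col j gX.
rewrite -(gaussian_resid_inv v_gt0 uN gz)//.
apply: eq_integral => w' _; rewrite GE (@det_gram_col' _ _ _ _ j) /= col'_mix//.
by rewrite col_mix invfM mulfVK.
Qed.

End gaussian_gram.

(** * Vanishing moments *)

Section density_measure.
Local Open Scope ereal_scope.
Context d (T : measurableType d) (R : realType) (mu : {measure set T -> \bar R}).
Variables (f : T -> R) (mf : measurable_fun [set: T] f).
Hypothesis f0 : forall x, (0 <= f x)%R.

Let m (A : set T) := \int[mu]_(x in A) (f x)%:E.

Let m0 : m set0 = 0.
Proof. by rewrite /m integral_set0. Qed.

Let m_ge0 A : 0 <= m A.
Proof. by apply: integral_ge0 => x _; rewrite lee_fin. Qed.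

Let m_sigma_additive : semi_sigma_additive m.
Proof.
move=> A mA tA mUA; rewrite /m ge0_integral_bigcup//.
- apply: is_cvg_ereal_nneg_natsum_cond => n _ _.
  by apply: integral_ge0 => x _; rewrite lee_fin.
- exact/measurable_EFinP/measurable_funTS.
- by move=> x _; rewrite lee_fin.
Qed.

Definition density_measure : {measure set T -> \bar R} :=
  HB.pack_for {measure set T -> \bar R} m
    (isMeasure.Build _ _ _ m m0 m_ge0 m_sigma_additive).

End density_measure.

(** * Moments of variables in the unit interval determine integrable functions of them *)

Section step_polynomials.
Context {R : realType}.

(** Bernoulli's inequality. *)
Lemma ge1Dnx_expr (t : R) n : -1 <= t -> 1 + n%:R * t <= (1 + t) ^+ n.
Proof.
move=> t1; have t10 : 0 <= 1 + t by lra.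
elim: n => [|n IH]; first by rewrite mul0r addr0 expr0.
rewrite exprS; apply: le_trans (ler_wpM2l t10 IH).
rewrite -[in leLHS]natr1; have : 0 <= n%:R * t ^+ 2.
  by rewrite mulr_ge0 ?sqr_ge0.
by nra.
Qed.

(* these powers separate [0, 1/2[ from [1/2, 1]; the exponent is chosen to send
   the boundary point 1/2 to 0 *)
Lemma cvg_step (x : R) : 0 <= x -> x <= 1 ->
  (fun n => (1 - x ^+ n) ^+ (n * 2 ^ n)) @ \oo --> ((x < 2^-1)%R%:R : R).
Proof.
move=> x0 x1; have xn0 n : 0 <= x ^+ n by exact: exprn_ge0.
have xn1 n : 0 <= 1 - x ^+ n by rewrite subr_ge0 exprn_ile1.
have [x_half|x_half] := ltP x 2^-1.
  (* Bernoulli bounds the power below by [1 - n r^n], since [2^n x^n = r^n]. The choice of [s < 1]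
     with [r <= s^2] gives [n r^n <= (n s^n) s^n], where Bernoulli for [s^-1 = 1 + delta] bounds the
     first factor by [delta^-1]. *)
  pose r := 2 * x; pose s := (1 + r) / 2; pose delta := s^-1 - 1.
  have r0 : 0 <= r by rewrite mulr_ge0.
  have r1 : r < 1 by rewrite /r -ltr_pdivlMl ?mulr1.
  have s0 : 0 < s by rewrite divr_gt0//; lra.
  have s1 : s < 1 by rewrite ltr_pdivrMr//; lra.
  have rs : r <= s * s by rewrite /s; nra.
  have d0 : 0 < delta by rewrite subr_gt0 invf_gt1.
  have nr n : n%:R * r ^+ n <= delta^-1 * s ^+ n.
    have h : n%:R * s ^+ n <= delta^-1.
      rewrite -(ler_pM2r d0) mulVf ?gt_eqF// mulrAC -ler_pdivlMr ?exprn_gt0//.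
      rewrite div1r -exprVn; have -> : s^-1 = 1 + delta by rewrite /delta addrC subrK.
      apply: le_trans (ge1Dnx_expr n _); first by rewrite lerDr.
      by apply: le_trans (ltW d0); rewrite oppr_le0.
    apply: (@le_trans _ _ (n%:R * s ^+ n * s ^+ n)).
      rewrite -mulrA ler_wpM2l// -exprMn lerXn2r// nnegrE//.
      by rewrite mulr_ge0// ltW.
    by rewrite ler_wpM2r// exprn_ge0// ltW.
  apply: (@squeeze_cvgr _ _ _ _ (fun n => 1 - delta^-1 * s ^+ n) (cst 1)).
  - near=> n; apply/andP; split; last by rewrite exprn_ile1// lerBlDr lerDl.
    apply: le_trans (ge1Dnx_expr (t := - x ^+ n) _ _).
      rewrite lerD2l mulrN lerN2; apply: le_trans (nr n).
      by rewrite natrM natrX -mulrA -exprMn.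
    by rewrite lerN2 exprn_ile1.
  - rewrite -[X in _ --> X]subr0; apply: cvgB; first exact: cvg_cst.
    by apply: cvg_geometric; rewrite gtr0_norm.
  - exact: cvg_cst.
(* Here [1 - x^n <= expR (- 2^-n)], and the exponent [n * 2 ^ n] turns this into [expR (- n)], also
   at [x = 1/2]. *)
apply: (@squeeze_cvgr _ _ _ _ (cst 0) (fun n => expR (1 *- n))).
- near=> n; rewrite exprn_ge0//=.
  apply: (@le_trans _ _ (expR (- 2^-1 ^+ n) ^+ (n * 2 ^ n))).
    apply: lerXn2r; rewrite ?nnegrE ?expR_ge0//.
    apply: le_trans (expR_ge1Dx _); rewrite lerD2l lerN2.
    by rewrite lerXn2r// nnegrE// invr_ge0.
  rewrite -expRM_natl ler_expR natrM natrX mulrN -mulrA -exprMn divff//.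
  by rewrite expr1n mulr1.
- exact: cvg_cst.
- exact: cvgn_expR.
Unshelve. all: by end_near. Qed.

End step_polynomials.

Lemma maxM0 (R : realType) (x y : R) : Num.max (x * y) 0 =
  Num.max y 0 * Num.max x 0 + Num.max (- y) 0 * Num.max (- x) 0.
Proof.
have p1 (z : R) : 0 <= z -> Num.max z 0 = z by move=> z0; rewrite max_l.
have n1 (z : R) : z <= 0 -> Num.max z 0 = 0 by move=> z0; rewrite max_r.
have [x0|x0] := orP (le_total 0 x); have [y0|y0] := orP (le_total 0 y).
- rewrite (p1 _ x0) (p1 _ y0) (p1 _ (mulr_ge0 x0 y0)) (n1 (- x)) ?oppr_le0//.
  by rewrite mulr0 addr0 mulrC.
- rewrite (p1 _ x0) (n1 _ y0) (n1 _ (mulr_ge0_le0 x0 y0)) (n1 (- x)) ?oppr_le0//.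
  by rewrite mulr0 mul0r addr0.
- rewrite (n1 _ x0) (p1 _ y0) (n1 _ (mulr_le0_ge0 x0 y0)) (n1 (- y)) ?oppr_le0//.
  by rewrite mulr0 mul0r addr0.
- rewrite (n1 _ x0) (n1 _ y0) (p1 _ (mulr_le0 x0 y0)) !p1 ?oppr_ge0//.
  by rewrite mulr0 add0r mulrNN mulrC.
Qed.

Section completeness.
Context {R : realType} d (T : measurableType d) (P : probability T R).

Let integrable_mul_bounded (F phi : T -> R) :
  P.-integrable setT (EFin \o F) -> measurable_fun [set: T] phi ->
  (forall w, `|phi w| <= 1) ->
  P.-integrable setT (fun w => (F w * phi w)%:E).
Proof.
move=> iF mphi phi1; have /measurable_EFinP mF := measurable_int _ iF.
apply: (le_integrable measurableT _ _ iF).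
  by apply/measurable_EFinP; exact: measurable_funM.
by move=> w _; rewrite /= lee_fin normrM ler_piMr.
Qed.

(** Vanishing moments make [F] orthogonal to all polynomials in [u]. A sequence of these, bounded by
    1, converges pointwise to the indicator of [u < c], and dominated convergence with majorant
    [|F|] concludes. Pointwise convergence at every point matters, since [u] may have atoms. *)
Let integral_step (F u : T -> R) (c : R) :
  P.-integrable setT (EFin \o F) -> measurable_fun [set: T] u ->
  (forall w, 0 <= u w <= 1) ->
  (forall k, \int[P]_w (F w * u w ^+ k)%:E = 0)%E ->
  (\int[P]_w (F w * (u w < c)%R%:R)%:E = 0)%E.
Proof.
move=> iF mu u01 H; have /measurable_EFinP mF := measurable_int _ iF.
have uk1 k w : `|u w ^+ k| <= 1.
  have /andP[u0 u1] := u01 w.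
  by rewrite ger0_norm ?exprn_ge0// exprn_ile1.
have [c0|c0] := leP c 0.
  rewrite -(integral0 P setT); apply: eq_integral => w _.
  have /andP[u0 _] := u01 w; rewrite ltNge (le_trans c0 u0) mulr0//.
have [c1|c1] := ltP 1 c.
  rewrite -[RHS](H 0%N); apply: eq_integral => w _.
  have /andP[_ u1] := u01 w; rewrite (le_lt_trans u1 c1) expr0//.
have Hpoly (q : {poly R}) : (\int[P]_w (F w * q.[u w])%:E = 0)%E.
  transitivity (\int[P]_w (\sum_(i < size q) (q`_i)%:E * (F w * u w ^+ i)%:E))%E.
    apply: eq_integral => w _; rewrite horner_coef mulr_sumr -sumEFin.
    by apply: eq_bigr => i _; rewrite -EFinM mulrCA.
  rewrite integral_sum//.
    apply: big1 => i _; rewrite integralZl// ?H ?mule0//.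
    by apply: integrable_mul_bounded => //; exact: measurable_funX.
  move=> i; apply: integrableZl => //.
  by apply: integrable_mul_bounded => //; exact: measurable_funX.
(* The affine map that sends [c] to [1/2] and, for [c] in the unit interval, keeps [u] in the unit
   interval. *)
pose p : {poly R} := ((1 - c) / 2)%:P + 2^-1 *: 'X.
pose x w := p.[u w].
have xE w : x w = (1 - c) / 2 + 2^-1 * u w by rewrite /x /p !hornerE.
have x0 w : 0 <= x w.
  by rewrite xE; have /andP[u0 u1] := u01 w; lra.
have x1 w : x w <= 1.
  by rewrite xE; have /andP[u0 u1] := u01 w; lra.
have xc w : (x w < 2^-1) = (u w < c).
  by rewrite xE; apply/idP/idP => ?; lra.
have mx : measurable_fun [set: T] x.
  rewrite (_ : x = (fun w => (1 - c) / 2 + 2^-1 * u w)); last exact/funext.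
  by apply: measurable_funD => //; apply: measurable_funM.
pose a n w := (1 - x w ^+ n) ^+ (n * 2 ^ n).
have ma n : measurable_fun [set: T] (a n).
  by apply: measurable_funX; apply: measurable_funB => //; exact: measurable_funX.
have a1 n w : `|a n w| <= 1.
  have xn0 : 0 <= x w ^+ n by exact: exprn_ge0.
  have xn1 : x w ^+ n <= 1 by exact: exprn_ile1.
  rewrite ger0_norm ?exprn_ge0 ?subr_ge0// exprn_ile1 ?subr_ge0//.
  by rewrite lerBlDr lerDl.
have mi : measurable_fun [set: T] (fun w => (u w < c)%R%:R : R).
  rewrite (_ : (fun w => _) = (\1_`]-oo, c[%classic : R -> R) \o u).
    by apply: measurableT_comp => //; exact: measurable_indic.
  by apply/funext => w; rewrite /= indicE mem_setE in_itv.
have lim0 : (\int[P]_w (F w * a n w)%:E)%E @[n --> \oo] -->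
    (\int[P]_w (F w * (u w < c)%R%:R)%:E)%E.
  have := @dominated_convergence _ T R P setT measurableT
    (fun n w => (F w * a n w)%:E) (fun w => (F w * (u w < c)%R%:R)%:E)
    (fun w => `|F w|%:E).
  case => //.
  - by move=> n; apply/measurable_EFinP; exact: measurable_funM.
  - by apply/measurable_EFinP; exact: measurable_funM.
  - apply: aeW => w _; apply: cvg_EFin; first by near=> n.
    apply: cvgM; first exact: cvg_cst.
    by rewrite -xc; exact: cvg_step.
  - exact: integrable_norm iF.
  - by apply: aeW => w n _; rewrite abse_EFin lee_fin normrM ler_piMr.
have a0 n : (\int[P]_w (F w * a n w)%:E = 0)%E.
  rewrite -[RHS](Hpoly ((1 - p ^+ n) ^+ (n * 2 ^ n))).
  by apply: eq_integral => w _; rewrite !hornerE /a xE.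
apply: (etrans (esym (cvg_lim (@ereal_hausdorff R) lim0))).
under eq_fun do rewrite a0.
exact: lim_cst.
Unshelve. all: by end_near. Qed.

(** The entries are turned from monomials into step functions one at a time. The induction carries
    arbitrary exponents for all the entries, so that the powers of the next entry, required by the
    one-variable case, are available for the function already multiplied by the previous steps. *)
Lemma integral_lower_orthant p q (F : T -> R) (U : T -> 'M[R]_(p, q)) :
  P.-integrable setT (EFin \o F) -> measurable_fun [set: T] U ->
  (forall w i j, 0 <= U w i j <= 1) ->
  (forall k : 'I_p * 'I_q -> nat,
    \int[P]_w (F w * \prod_ij U w ij.1 ij.2 ^+ k ij)%:E = 0)%E ->
  forall c : 'M[R]_(p, q),
  (\int[P]_w (F w * [forall ij, U w ij.1 ij.2 < c ij.1 ij.2]%:R)%:E = 0)%E.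
Proof.
move=> iF mU U01 H c.
have /measurable_EFinP mF := measurable_int _ iF.
pose step w ij : R := (U w ij.1 ij.2 < c ij.1 ij.2)%R%:R.
have mstep ij : measurable_fun [set: T] (step^~ ij).
  rewrite (_ : (fun w => _) =
    (\1_`]-oo, c ij.1 ij.2[%classic : R -> R) \o (fun w => U w ij.1 ij.2)).
    apply: measurableT_comp; first exact: measurable_indic.
    exact: measurable_entry.
  by apply/funext => w; rewrite /= indicE mem_setE in_itv.
have step1 w ij : `|step w ij| <= 1 by rewrite /step; case: (_ < _); rewrite ?normr1 ?normr0.
have prodle1 (I : eqType) (s : seq I) (f : I -> R) :
    (forall i, `|f i| <= 1) -> `|\prod_(i <- s) f i| <= 1.
  move=> f1; elim: s => [|a s IH]; first by rewrite big_nil normr1.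
  by rewrite big_cons normrM mulr_ile1.
have key s k : (\int[P]_w (F w * (\prod_(ij <- s) step w ij) *
    \prod_ij U w ij.1 ij.2 ^+ k ij)%:E = 0)%E.
  elim: s k => [|a s IH] k.
    by rewrite -[RHS](H k); apply: eq_integral => w _; rewrite big_nil mulr1.
  pose F' w := F w * (\prod_(ij <- s) step w ij) * \prod_ij U w ij.1 ij.2 ^+ k ij.
  rewrite -(@integral_step F' (fun w => U w a.1 a.2) (c a.1 a.2)).
  - by apply: eq_integral => w _; rewrite big_cons /F' /step; congr EFin; ring.
  - rewrite /F'; under eq_fun do rewrite -mulrA.
    apply: integrable_mul_bounded => //.
      apply: measurable_funM; apply: measurable_prod => ij _ //.
      by apply: measurable_funX; exact: measurable_entry.
    move=> w; rewrite normrM mulr_ile1//; apply: prodle1 => // ij.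
    have /andP[u0 u1] := U01 w ij.1 ij.2.
    by rewrite ger0_norm ?exprn_ge0// exprn_ile1.
  - exact: measurable_entry.
  - by move=> w; exact: U01.
  - move=> l; pose k' ij := (k ij + (ij == a) * l)%N.
    rewrite -[RHS](IH k'); apply: eq_integral => w _.
    rewrite /F' -mulrA; congr (_ * _)%:E.
    under [in RHS]eq_bigr do rewrite exprD.
    rewrite big_split/=; congr (_ * _).
    rewrite (bigD1 a)//= eqxx mul1n big1 ?mulr1// => ij /negbTE ->.
    by rewrite expr0.
rewrite -[RHS](key (index_enum _) (fun=> 0%N)); apply: eq_integral => w _.
rewrite [X in _ = (_ * X)%:E]big1 ?mulr1//; congr (_ * _)%:E.
case: (boolP [forall ij, _]) => [/forallP h|].
  by rewrite big1// => ij _; rewrite /step h.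
rewrite negb_forall => /existsP[ij /negbTE h].
by rewrite (bigD1 ij)//= /step h mul0r.
Qed.

(** The positive and negative parts of [F] are densities of two finite measures. Their images under
    [U] agree on lower orthants, hence everywhere, so both give the same integral to the positive
    part of [h], and likewise to its negative part. Integrability of the product then allows the two
    to be subtracted. *)
Lemma moment_completeness p q (F : T -> R) (U : T -> 'M[R]_(p, q)) :
  P.-integrable setT (EFin \o F) -> measurable_fun [set: T] U ->
  (forall w i j, 0 <= U w i j <= 1) ->
  (forall k : 'I_p * 'I_q -> nat,
    \int[P]_w (F w * \prod_ij U w ij.1 ij.2 ^+ k ij)%:E = 0)%E ->
  forall h : 'M[R]_(p, q) -> R, measurable_fun [set: 'M[R]_(p, q)] h ->
  P.-integrable setT (fun w => (F w * h (U w))%:E) ->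
  (\int[P]_w (F w * h (U w))%:E = 0)%E.
Proof.
move=> iF mU U01 H h mh ih.
have /measurable_EFinP mF := measurable_int _ iF.
pose pos (x : R) : R := Num.max x 0; pose neg (x : R) : R := Num.max (- x) 0.
have pos0 x : 0 <= pos x by rewrite le_max lexx orbT.
have neg0 x : 0 <= neg x by rewrite le_max lexx orbT.
have mpos d' (T' : measurableType d') (f : T' -> R) :
    measurable_fun [set: T'] f -> measurable_fun [set: T'] (fun x => pos (f x)).
  by move=> mf; apply: measurable_maxr.
have mneg d' (T' : measurableType d') (f : T' -> R) :
    measurable_fun [set: T'] f -> measurable_fun [set: T'] (fun x => neg (f x)).
  by move=> mf; apply: measurable_maxr => //; exact: measurable_funN.
have mpF := mpos _ _ _ mF; have mnF := mneg _ _ _ mF.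
pose D1 := density_measure P mpF (fun w => pos0 _).
pose D2 := density_measure P mnF (fun w => neg0 _).
have intD1 (g : T -> \bar R) : measurable_fun [set: T] g ->
    (forall w, 0 <= g w)%E ->
    (\int[D1]_w g w = \int[P]_w (g w * (pos (F w))%:E))%E.
  by move=> mg g0; apply: integral_density => //.
have intD2 (g : T -> \bar R) : measurable_fun [set: T] g ->
    (forall w, 0 <= g w)%E ->
    (\int[D2]_w g w = \int[P]_w (g w * (neg (F w))%:E))%E.
  by move=> mg g0; apply: integral_density => //.
have Fpn x : x = pos x - neg x.
  rewrite /pos /neg; have [x0|x0] := orP (le_total 0 x).
    by rewrite max_l// max_r ?subr0// oppr_le0.
  by rewrite max_r// max_l ?oppr_ge0// sub0r opprK.
have pos_le x : pos x <= `|x| by rewrite ge_max ler_norm normr_ge0.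
have neg_le x : neg x <= `|x| by rewrite ge_max -normrN ler_norm normr_ge0.
have ipF : P.-integrable setT (fun w => (pos (F w))%:E).
  apply: (le_integrable measurableT _ _ iF); first exact/measurable_EFinP.
  by move=> w _; rewrite /= lee_fin ger0_norm.
have inF : P.-integrable setT (fun w => (neg (F w))%:E).
  apply: (le_integrable measurableT _ _ iF); first exact/measurable_EFinP.
  by move=> w _; rewrite /= lee_fin ger0_norm.
have Horth (c : 'M[R]_(p, q)) :
    image_measure D1 mU [set X : 'M[R]_(p, q) | forall i j, X i j < c i j] =
    image_measure D2 mU [set X : 'M[R]_(p, q) | forall i j, X i j < c i j].
  pose O := [set w | forall i j, U w i j < c i j].
  have mO : measurable O.
    by have := mU measurableT _ (measurable_lower_orthant c); rewrite setTI.
  rewrite -[LHS]/(\int[P]_(w in O) (pos (F w))%:E)%E.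
  rewrite -[RHS]/(\int[P]_(w in O) (neg (F w))%:E)%E.
  have F0 : (\int[P]_(w in O) ((pos (F w))%:E - (neg (F w))%:E) = 0)%E.
    rewrite integral_mkcond -[RHS](integral_lower_orthant iF mU U01 H c).
    apply: eq_integral => w _; rewrite patchE -EFinB -Fpn.
    case: ifP => [|/negP wO].
      rewrite inE => wO; rewrite (_ : [forall ij, _] = true) ?mulr1//.
      by apply/forallP => -[i j]; exact: wO.
    rewrite (_ : [forall ij, _] = false) ?mulr0//; apply/negP => /forallP h'.
    by apply: wO; rewrite inE => i j; exact: (h' (i, j)).
  have ip : P.-integrable O (fun w => (pos (F w))%:E) by exact: integrableS ipF.
  have ie : P.-integrable O (fun w => (neg (F w))%:E) by exact: integrableS inF.
  rewrite integralB// in F0.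
  by rewrite -[LHS](subeK _ (integrable_fin_num mO ie)) F0 add0e.
have D1oo : (image_measure D1 mU setT < +oo)%E.
  rewrite -[image_measure D1 mU setT]/(\int[P]_(w in setT) (pos (F w))%:E)%E.
  have /integrableP[_] := ipF; apply: le_lt_trans.
  rewrite le_eqVlt; apply/orP; left; apply/eqP; apply: eq_integral => w _.
  by rewrite gee0_abs ?lee_fin.
have m12 := matrix_measure_unique D1oo Horth.
have E12 (g : 'M[R]_(p, q) -> R) : measurable_fun [set: 'M[R]_(p, q)] g ->
    (forall Z, 0 <= g Z) ->
    (\int[P]_w (g (U w) * pos (F w))%:E = \int[P]_w (g (U w) * neg (F w))%:E)%E.
  move=> mg g0.
  have mgE : measurable_fun [set: 'M[R]_(p, q)] (EFin \o g) by exact/measurable_EFinP.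
  have gE0 (Z : 'M[R]_(p, q)) : (0 <= (EFin \o g) Z)%E by rewrite lee_fin.
  have e1 := @ge0_integral_pushforward _ _ _ _ R U mU D1 setT _ measurableT mgE
    (fun y _ => gE0 y).
  have e2 := @ge0_integral_pushforward _ _ _ _ R U mU D2 setT _ measurableT mgE
    (fun y _ => gE0 y).
  rewrite preimage_setT in e1; rewrite preimage_setT in e2.
  have mgU : measurable_fun [set: T] (EFin \o g \o U).
    exact: measurableT_comp.
  transitivity (\int[D1]_w (EFin \o g \o U) w)%E.
    by rewrite (intD1 _ mgU (fun w => gE0 _)); apply: eq_integral.
  rewrite -e1; transitivity (\int[D2]_w (EFin \o g \o U) w)%E.
    by rewrite -e2; apply: eq_measure_integral => A mA _; exact: m12.
  by rewrite (intD2 _ mgU (fun w => gE0 _)); apply: eq_integral.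
pose f w := F w * h (U w).
have mf : measurable_fun [set: T] f.
  by apply: measurable_funM => //; exact: measurableT_comp.
have mhU : measurable_fun [set: T] (fun w => h (U w)) by exact: measurableT_comp.
have fpos w : ((EFin \o f)^\+ w =
    (pos (h (U w)) * pos (F w))%:E + (neg (h (U w)) * neg (F w))%:E)%E.
  by rewrite funeposE /= /f -EFin_max -EFinD (maxM0 (F w)).
have fneg w : ((EFin \o f)^\- w =
    (neg (h (U w)) * pos (F w))%:E + (pos (h (U w)) * neg (F w))%:E)%E.
  rewrite funenegE /= /f -EFin_max -EFinD -mulNr (maxM0 (- F w)) opprK.
  by rewrite addrC.
have eqpn : (\int[P]_w (EFin \o f)^\+ w = \int[P]_w (EFin \o f)^\- w)%E.
  under eq_integral do rewrite fpos.
  under [RHS]eq_integral do rewrite fneg.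
  have m1 : measurable_fun [set: T] (fun w => (pos (h (U w)) * pos (F w))%:E).
    by apply/measurable_EFinP; apply: measurable_funM => //; exact: mpos.
  have m2 : measurable_fun [set: T] (fun w => (neg (h (U w)) * neg (F w))%:E).
    by apply/measurable_EFinP; apply: measurable_funM => //; exact: mneg.
  have m3 : measurable_fun [set: T] (fun w => (neg (h (U w)) * pos (F w))%:E).
    by apply/measurable_EFinP; apply: measurable_funM => //; exact: mneg.
  have m4 : measurable_fun [set: T] (fun w => (pos (h (U w)) * neg (F w))%:E).
    by apply/measurable_EFinP; apply: measurable_funM => //; exact: mpos.
  rewrite ge0_integralD//; [|by move=> w _; rewrite lee_fin mulr_ge0..].
  rewrite ge0_integralD//; [|by move=> w _; rewrite lee_fin mulr_ge0..].
  rewrite (E12 (fun Z => pos (h Z)))//; last exact: mpos.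
  rewrite -(E12 (fun Z => neg (h Z)))//; last exact: mneg.
  by rewrite addeC.
rewrite -[LHS]/(\int[P]_w (EFin \o f) w)%E integralE eqpn subee//.
exact: integrable_neg_fin_num ih.
Qed.

End completeness.

(** * Least squares *)

Section tilts.
Context {R : realType}.

(** A square root of the form [1 + g c c^T]: on the line of [c] its eigenvalue [1 + g s] has to be
    the root [r] of [1 + k s]. *)
Let rank1_sqrt n (c : 'cV[R]_n) (k : R) : 0 <= k ->
  exists2 H : 'M[R]_n, H \in unitmx & H *m H^T = 1%:M + k *: (c *m c^T).
Proof.
move=> k0; pose s := mxnorm2 c; pose r := Num.sqrt (1 + k * s).
have ks0 : 0 <= k * s by rewrite mulr_ge0// mxnorm2_ge0.
have r2 : r ^+ 2 = 1 + k * s by rewrite sqr_sqrtr// addr_ge0.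
have r0 : 0 < r by rewrite sqrtr_gt0 ltr_wpDr.
(* This is [(r - 1) / s], in a form that is also correct for [s = 0]. *)
pose g := k / (r + 1).
have gs : g * s = r - 1.
  have r1 : r + 1 != 0 by rewrite gt_eqF// addr_gt0.
  apply: (mulIf r1); rewrite mulrAC divfK// -(addrK 1 (k * s)) [k * s + 1]addrC.
  by rewrite -r2; ring.
have g1 : g * (r + 1) = k by rewrite divfK// gt_eqF// addr_gt0.
have cc : c^T *m c = s%:M by rewrite [LHS]mx11_scalar -trace_mx11 mxtrace_mulC.
pose C := c *m c^T.
have CC : C *m C = s *: C.
  rewrite /C mulmxA -(mulmxA c) cc mul_mx_scalar -scalemxAl//.
have CT : C^T = C by rewrite /C trmx_mul trmxK.
have mulC x y : (1%:M + x *: C) *m (1%:M + y *: C) =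
    1%:M + (x + y + x * y * s) *: C.
  rewrite mulmxDr mulmx1 -scalemxAr mulmxDl mul1mx -scalemxAl CC.
  rewrite scalerDr !scalerA -addrA -!scalerDl; congr (_ + _ *: _); ring.
exists (1%:M + g *: C).
  have : (1%:M + g *: C) *m (1%:M + (- (g / r)) *: C) = 1%:M.
    rewrite mulC [X in X *: C](_ : _ = 0) ?scale0r ?addr0//.
    rewrite (_ : g * - (g / r) * s = - (g * s) * (g / r)).
      by rewrite gs; field; rewrite gt_eqF.
    by rewrite mulrN !mulNr mulrAC.
  by case/mulmx1_unit.
rewrite linearD/= trmx1 linearZ/= CT mulC; congr (_ + _ *: _).
by rewrite -g1 -mulrA gs; ring.
Qed.

(** If [H H^T] is the matrix built so far, adding [k c c^T] amounts to inserting between [H] and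
    [H^T] the rank-one perturbation of the identity along [invmx H *m c], of which a square root is
    known. *)
Lemma tilt_sqrt (I : Type) (s : seq I) n (c : I -> 'cV[R]_n) (k : I -> R) :
  (forall i, 0 <= k i) ->
  exists2 H : 'M[R]_n, H \in unitmx &
    H *m H^T = 1%:M + \sum_(i <- s) k i *: (c i *m (c i)^T).
Proof.
move=> k0; elim: s => [|i s [H uH HE]].
  by exists 1%:M; rewrite ?unitmx1// big_nil trmx1 mulmx1 addr0.
have [H1 uH1 H1E] := rank1_sqrt (invmx H *m c i) (k0 i).
exists (H *m H1); first by rewrite unitmx_mul uH.
rewrite trmx_mul mulmxA -(mulmxA H) H1E big_cons.
rewrite mulmxDr mulmx1 mulmxDl HE addrCA addrC; congr (_ + _).
rewrite -scalemxAr -scalemxAl trmx_mul !mulmxA mulmxV// mul1mx.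
by rewrite -!mulmxA -trmx_mul mulmxV// trmx1 mulmx1.
Qed.

End tilts.

(** * Normal equations *)

Section least_squares.
Context {R : realType}.

(* [(\det W)^-1 *: \adj W] is [invmx W] with value 0 instead of [W] at singular
   matrices; it is a measurable function of [W] *)
Definition pinv p k (M : 'M[R]_(p, k)) : 'M[R]_(k, p) :=
  ((\det (M^T *m M))^-1 *: \adj (M^T *m M)) *m M^T.

Lemma pinv_mul p k (M : 'M[R]_(p, k)) :
  \det (M^T *m M) != 0 -> pinv M *m M = 1%:M.
Proof.
move=> dM; rewrite /pinv -mulmxA -scalemxAl mul_adj_mx scale_scalar_mx.
by rewrite mulVf.
Qed.

Lemma gram_pinv p k (M : 'M[R]_(p, k)) :
  \det (M^T *m M) != 0 -> M^T *m M *m pinv M = M^T.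
Proof.
move=> dM; rewrite /pinv mulmxA -scalemxAr mul_mx_adj scale_scalar_mx.
by rewrite mulVf// mul1mx.
Qed.

(** At full rank, [pinv M] times its transpose is the inverse of [M^T M]; at singular Gram matrices
    both sides are 0 by the convention on inverses. *)
Lemma pinv_row_norm p k (M : 'M[R]_(p, k)) j :
  mxnorm2 (row j (pinv M)) =
  (\det (M^T *m M))^-1 * (\adj (M^T *m M)) j j.
Proof.
have [d0|d0] := eqVneq (\det (M^T *m M)) 0.
  by rewrite /pinv d0 invr0 scale0r mul0mx row0 /mxnorm2 mul0mx mxtrace0 mul0r.
have WT : (M^T *m M)^T = M^T *m M by rewrite trmx_mul trmxK.
have -> : mxnorm2 (row j (pinv M)) = (pinv M *m (pinv M)^T) j j.
  by rewrite /mxnorm2 trace_mx11 tr_row -row_mul [LHS]mxE -tr_row !mxE;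
    apply: eq_bigr => l _; rewrite !mxE.
rewrite {2}/pinv trmx_mul trmxK mulmxA pinv_mul// mul1mx linearZ/= mxE.
by congr (_ * _); rewrite trmx_adj WT.
Qed.

Lemma full_rank_inj n k (A : 'M[R]_(n, k)) p (u : 'M[R]_(k, p)) :
  \rank A = k -> A *m u = 0 -> u = 0.
Proof.
move=> rA Au; apply: trmx_inj; rewrite trmx0.
have fA : row_free A^T by rewrite /row_free mxrank_tr rA.
by apply/eqP; rewrite -(mulmx_free_eq0 _ fA) -trmx_mul Au trmx0.
Qed.

Lemma det_gram_full_rank n k (A : 'M[R]_(n, k)) :
  \rank A = k -> \det (A^T *m A) != 0.
Proof.
move=> rA; rewrite -unitfE -unitmxE -row_free_unit; apply: inj_row_free => u uA.
have : u *m A^T = 0.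
  apply: mxnorm2_eq0; rewrite /mxnorm2 trmx_mul trmxK mulmxA -(mulmxA u) uA.
  by rewrite mul0mx mxtrace0.
move=> /(congr1 trmx); rewrite trmx_mul trmxK trmx0 => /(full_rank_inj rA).
by move=> /(congr1 trmx); rewrite trmxK trmx0.
Qed.

Lemma sqnorm2E n (u : 'cV[R]_n) : sqnorm2 u = mxnorm2 u.
Proof. by rewrite mxnorm2E; apply: eq_bigr => i _; rewrite big_ord1. Qed.

Lemma mxnorm2D_orthogonal n p (u w : 'M[R]_(n, p)) :
  u^T *m w = 0 -> mxnorm2 (u + w) = mxnorm2 u + mxnorm2 w.
Proof.
move=> uw; have wu : w^T *m u = 0.
  by apply: trmx_inj; rewrite trmx_mul trmxK uw trmx0.
rewrite /mxnorm2 [(u + w)^T](linearD trmx)/= mulmxDr !mulmxDl !mxtraceD.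
rewrite (mxtrace_mulC w u^T) uw (mxtrace_mulC u w^T) wu !mxtrace0.
by rewrite addr0 add0r.
Qed.

Lemma mxnorm2_isometry p q s (M : 'M[R]_(p, q)) (u : 'M[R]_(q, s)) :
  M^T *m M = 1%:M -> mxnorm2 (M *m u) = mxnorm2 u.
Proof.
move=> MM; rewrite /mxnorm2 trmx_mul mxtrace_mulC !mulmxA -(mulmxA u^T) MM.
by rewrite mulmx1 mxtrace_mulC.
Qed.

(** Under the normal equations, Pythagoras splits the squared error at [z] into the residual and
    [|A (z - x)|^2]; the second term vanishes only at [x] because [A] is injective. *)
Lemma x_LS_unique n k (A : 'M[R]_(n, k)) (y : 'cV[R]_n) x :
  \rank A = k -> A^T *m (y - A *m x) = 0 -> x_LS A y = x.
Proof.
move=> rA Ar; pose r := A *m x - y.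
have Ar0 : A^T *m r = 0 by rewrite /r -opprB mulmxN Ar oppr0.
have dec z : sqnorm2 (A *m z - y) = sqnorm2 r + sqnorm2 (A *m (z - x)).
  have -> : A *m z - y = A *m (z - x) + r by rewrite /r mulmxBr addrA subrK.
  rewrite !sqnorm2E mxnorm2D_orthogonal 1?addrC//.
  by rewrite trmx_mul -mulmxA Ar0 mulmx0.
apply: xget_unique.
  by move=> z; rewrite (dec z) -/r lerDl sqnorm2E mxnorm2_ge0.
move=> z /(_ x); rewrite (dec z) -/r gerDl sqnorm2E => h.
have : mxnorm2 (A *m (z - x)) = 0.
  by apply/eqP; rewrite eq_le h mxnorm2_ge0.
by move=> /mxnorm2_eq0/(full_rank_inj rA)/eqP; rewrite subr_eq0 => /eqP ->.
Qed.

Lemma x_LS_pinv n k (A : 'M[R]_(n, k)) (y : 'cV[R]_n) :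
  \rank A = k -> x_LS A y = pinv A *m y.
Proof.
move=> rA; apply: x_LS_unique => //; rewrite mulmxBr (mulmxA A) 2!(mulmxA A^T).
by rewrite gram_pinv ?subrr// det_gram_full_rank.
Qed.

End least_squares.

(** * Orthonormalisation *)

Section QR.
Context {R : realType}.

(* Gram-Schmidt, as column operations of upper triangular matrix [U] *)
Let gram_schmidt n (C : 'M[R]_n) : C \in unitmx -> forall k, (k <= n)%N ->
  exists U : 'M[R]_n, [/\ U \in unitmx,
    forall i j : 'I_n, (j < i)%N -> U i j = 0 &
    forall i j : 'I_n, (i < k)%N -> (j < k)%N ->
      ((C *m U)^T *m (C *m U)) i j = (i == j)%:R].
Proof.
move=> uC; elim=> [|k IH] kn.
  exists 1%:M; split => //; first exact: unitmx1.
  by move=> i j ji; rewrite mxE -val_eqE/= gtn_eqF.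
have [U [uU tU oU]] := IH (ltnW kn).
pose kk := Ordinal kn; pose B := C *m U; pose G := B^T *m B.
(* [B u] is column [k] minus its components on the earlier, orthonormal columns; the zeros after [k]
   keep the operation upper triangular. *)
pose u : 'cV[R]_n :=
  \col_i (if i == kk then 1 else if (i < k)%N then - G i kk else 0).
have ukk : u kk 0 = 1 by rewrite mxE eqxx.
have u0 (i : 'I_n) : (k < i)%N -> u i 0 = 0.
  by move=> ki; rewrite mxE -val_eqE/= gtn_eqF// ltnNge ltnW.
pose w := B *m u; pose b := (Num.sqrt (mxnorm2 w))^-1 *: u.
have uB : B \in unitmx by rewrite unitmx_mul uC.
have w0 : 0 < mxnorm2 w.
  rewrite lt_neqAle mxnorm2_ge0 andbT eq_sym; apply/eqP => /mxnorm2_eq0 w0.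
  have := congr1 (fun z : 'cV[R]_n => (invmx B *m z) kk 0) w0.
  by rewrite mulKmx// mulmx0 ukk mxE => /eqP; rewrite oner_eq0.
have s0 : 0 < Num.sqrt (mxnorm2 w) by rewrite sqrtr_gt0.
have bkk : b kk 0 != 0 by rewrite mxE ukk mulr1 invr_eq0 gt_eqF.
exists (U *m set_col kk b); split.
- by rewrite unitmx_mul uU unitmxE det_set_col unitfE.
- move=> i j ji; rewrite mul_set_col; case: eqP => [jk|_]; last exact: tU.
  rewrite mxE big1// => l _; have [lk|kl] := leqP l k.
    by rewrite tU ?mul0r// (leq_ltn_trans lk)//; move: ji; rewrite jk.
  by rewrite mxE u0// !mulr0.
have BE i j : (C *m (U *m set_col kk b)) i j =
    if j == kk then (Num.sqrt (mxnorm2 w))^-1 * w i 0 else B i j.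
  by rewrite mulmxA mul_set_col -scalemxAr; case: ifP => _ //; rewrite mxE.
have GE i j : ((C *m (U *m set_col kk b))^T *m (C *m (U *m set_col kk b))) i j =
    \sum_l (if i == kk then (Num.sqrt (mxnorm2 w))^-1 * w l 0 else B l i) *
      (if j == kk then (Num.sqrt (mxnorm2 w))^-1 * w l 0 else B l j).
  by rewrite mxE; apply: eq_bigr => l _; rewrite mxE !BE.
have Bw (i : 'I_n) : (i < k)%N -> \sum_l B l i * w l 0 = 0.
  move=> ik; transitivity ((G *m u) i 0).
    rewrite /G -mulmxA -/w mxE; apply: eq_bigr => l _.
    by rewrite [in RHS]mxE.
  have ikk : i != kk by rewrite -val_eqE/= ltn_eqF.
  rewrite mxE (bigD1 kk)//= ukk mulr1 (bigD1 i)//= big1 ?addr0.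
    by rewrite [u i 0]mxE (negbTE ikk) ik [G i i](oU i i ik ik) eqxx mul1r subrr.
  move=> l /andP[lk li]; have [kl|] := ltnP k l; first by rewrite u0// mulr0.
  rewrite leq_eqVlt => /orP[/eqP lk'|lk'].
    by move: lk; rewrite -val_eqE/= lk' eqxx.
  by rewrite oU// eq_sym (negbTE li) mul0r.
move=> i j; rewrite !ltnS => ik jk; rewrite GE.
have lt_k (l : 'I_n) : (l <= k)%N -> l != kk -> (l < k)%N.
  by move=> lk lkk; rewrite ltn_neqAle lk andbT.
case: (eqVneq i kk) => ikk; case: (eqVneq j kk) => jkk.
- rewrite ikk jkk eqxx.
  under eq_bigr do rewrite mulrACA -!expr2.
  rewrite -mulr_sumr exprVn sqr_sqrtr ?mxnorm2_ge0//.
  rewrite (_ : \sum_i0 _ = mxnorm2 w) ?mulVf ?gt_eqF//.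
  by rewrite mxnorm2E; apply: eq_bigr => l _; rewrite big_ord1.
- under eq_bigr do rewrite -mulrA.
  rewrite -mulr_sumr; under eq_bigr do rewrite mulrC.
  by rewrite Bw ?lt_k// mulr0 ikk eq_sym (negbTE jkk).
- under eq_bigr do rewrite mulrCA.
  by rewrite -mulr_sumr Bw ?lt_k// mulr0 jkk (negbTE ikk).
- rewrite -oU ?lt_k// [RHS]mxE; apply: eq_bigr => l _.
  by rewrite [in RHS]mxE.
Qed.

(** The rank factorisation gives [A] as an invertible matrix times [E] times another one.
    Orthonormalising the columns of the first factor costs a triangular matrix, which can be moved
    across [E]. *)
Lemma QR_decomposition n d (A : 'M[R]_(n, d)) : (d <= n)%N -> \rank A = d ->
  exists (V : 'M[R]_n) (S : 'M[R]_d), [/\ V *m V^T = 1%:M, S \in unitmx &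
    A = V *m pid_mx d *m S].
Proof.
move=> dn rA; have uC := col_ebase_unit A.
have [U [uU tU oU]] := gram_schmidt uC (leqnn n).
pose V := col_ebase A *m U; pose E : 'M[R]_(n, d) := pid_mx d.
have VV : V^T *m V = 1%:M.
  by apply/matrixP => i j; rewrite oU// mxE.
have EE : E^T *m E = 1%:M.
  by rewrite tr_pid_mx mul_pid_mx minnn (minn_idPr dn) pid_mx_1.
pose Ud := E^T *m U *m E.
(* An upper triangular matrix preserves the span of the first [d] coordinates; [Ud] is its leading
   block. *)
have UE : U *m E = E *m Ud.
  rewrite /Ud !mulmxA tr_pid_mx mul_pid_mx !minnn.
  rewrite -mulmxA; apply/matrixP => i j; rewrite [RHS]mxE (bigD1 i)//= big1 => [|l li].
    rewrite addr0 [pid_mx _ _ _]mxE eqxx/=; case: ltnP => di; first by rewrite mul1r.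
    rewrite mul0r mxE big1// => l _; rewrite [E _ _]mxE.
    case: eqP => [lj|_]; last by rewrite /= mulr0.
    by rewrite tU ?mul0r// lj; exact: leq_trans (ltn_ord j) di.
  by rewrite [pid_mx _ _ _]mxE val_eqE eq_sym (negbTE li) mul0r.
have uUd : Ud \in unitmx.
  have : E^T *m invmx U *m E *m Ud = 1%:M.
    by rewrite -mulmxA -UE !mulmxA mulmxKV.
  by case/mulmx1_unit.
exists V, (invmx Ud *m row_ebase A); split.
- exact: mulmx1C VV.
- by rewrite unitmx_mul unitmx_inv uUd row_ebase_unit.
- rewrite -[LHS]mulmx_ebase rA -/E /V !mulmxA -(mulmxA _ U E) UE.
  by rewrite mulmxA mulmxK.
Qed.

End QR.

(** * Moments of the error of the sketched least-squares solution *)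

Section least_squares_estimator.
Context {R : realType} d (T : measurableType d) (P : probability T R).

Lemma iid_gaussian_mx p q (S : {RV P >-> 'M[R]_(p, q)}) v :
  iid_gaussian_entries S 0 v -> gaussian_mx P v S.
Proof.
move=> [indep law]; split => [|B mB]; first exact: measurable_funPT.
have := indep [set: _]%SET B mB; rewrite [X in P X](_ : _ =
  [set w | forall ij, B ij (S w ij.1 ij.2)]).
  move=> ->; apply: eq_big => [ij|ij _]; first by rewrite inE.
  exact: law.
apply/seteqP; split => [w h ij|w h ij _]; last exact: h.
by apply: h; rewrite /= inE.
Qed.

Variables (v : R) (v_gt0 : 0 < v).

(** The bilinear form is the scalar product of [mxvec Y] with the vectorised rank-one matrix
    [a^T b^T], whose norm is the product of the two norms. *)
Lemma gaussian_bilinear_second_moment p q (Y : T -> 'M[R]_(p, q))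
    (a : 'rV[R]_p) (b : 'cV[R]_q) : gaussian_mx P v Y ->
  (\int[P]_w (((a *m Y w *m b) 0 0) ^+ 2)%:E =
   (v * (mxnorm2 a * mxnorm2 b))%:E)%E.
Proof.
move=> gY; pose c := (mxvec (a^T *m b^T))^T.
have := gaussian_second_moment v_gt0 c (gaussian_mx_mxvec gY).
rewrite /c mxnorm2_tr mxnorm2_mxvec.
rewrite (_ : mxnorm2 (a^T *m b^T) = mxnorm2 a * mxnorm2 b).
  move=> <-; apply: eq_integral => w _; congr (_ ^+ 2)%:E.
  rewrite [RHS]mxE (reindex _ (curry_mxvec_bij p q))/=.
  transitivity (\sum_l \sum_i a 0 i * Y w i l * b l 0).
    by rewrite mxE; apply: eq_bigr => l _; rewrite mxE mulr_suml.
  rewrite exchange_big pair_bigA/=; apply: eq_bigr => -[i j] _.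
  by rewrite mxE !mxvecE mxE big_ord1 !mxE; ring.
rewrite !mxnorm2E big_ord1; under [X in _ = _ * X]eq_bigr do rewrite big_ord1.
rewrite mulr_suml; apply: eq_bigr => i _; rewrite mulr_sumr.
by apply: eq_bigr => j _; rewrite mxE big_ord1 !mxE exprMn.
Qed.

Lemma gaussian_mx_pid p n k (X : T -> 'M[R]_(p, n)) : (k <= n)%N ->
  gaussian_mx P v X -> gaussian_mx P v (fun w => X w *m (pid_mx k : 'M[R]_(n, k))).
Proof.
move=> kn gX; have hI : injective (fun il : 'I_p * 'I_k => (il.1, widen_ord kn il.2)).
  move=> [i l] [i' l'] e.
  have [/= -> /(congr1 val)/= ll'] := (congr1 fst e, congr1 snd e).
  by congr pair; apply: val_inj.
rewrite (_ : (fun w => _) = (fun w =>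
    \matrix_(i < p, j < k) X w (i, widen_ord kn j).1 (i, widen_ord kn j).2)).
  exact: gaussian_mx_reindex hI gX.
apply/funext => w; apply/matrixP => i j; rewrite [RHS]mxE /= mxE.
rewrite (bigD1 (widen_ord kn j))//= big1 ?addr0 => [|l lj].
  by rewrite mxE/= eqxx ltn_ord mulr1.
rewrite mxE; case: eqP => [lj'|]; last by rewrite mulr0.
by case/eqP: lj; apply: val_inj.
Qed.

(* The error of the least-squares solution of the sketched problem, for the data
   matrix [pid_mx k] and a vector with residual [r]. *)
Definition ls_error p n k (r : 'cV[R]_n) (Z : 'M[R]_(p, n)) : 'cV[R]_k :=
  pinv (Z *m pid_mx k) *m (Z *m r).

Lemma measurable_pinv d' (T' : measurableType d') p k
    (F : T' -> 'M[R]_(p, k)) : measurable_fun [set: T'] F ->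
  measurable_fun [set: T'] (fun w => pinv (F w)).
Proof.
move=> mF; have mW : measurable_fun [set: T'] (fun w => (F w)^T *m F w).
  by apply: measurable_mulmx => //; exact: measurable_trmx.
apply: measurable_mulmx; last exact: measurable_trmx.
apply/measurable_fun_matrixP => i j; under eq_fun do rewrite mxE.
apply: measurable_funM; last by apply: measurable_entry; exact: measurable_adj.
by apply: (measurableT_comp (@measurable_invr R)); exact: measurable_det.
Qed.

Lemma measurable_ls_error d' (T' : measurableType d') p n k (r : 'cV[R]_n)
    (F : T' -> 'M[R]_(p, n)) : measurable_fun [set: T'] F ->
  measurable_fun [set: T'] (fun w => ls_error k r (F w)).
Proof.
by move=> mF; apply: measurable_mulmx; [apply: measurable_pinv|];
  apply: measurable_mulmx.
Qed.

(** The condition on [r] says that its first [k] coordinates vanish, so [Z *m pid_mx k] and [Z *m r]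
    involve disjoint sets of columns. With the first [k] columns fixed, the error is a bilinear form
    in a fresh copy, of second moment [v |r|^2] times the squared norm of a row of [pinv]; the mean
    of the latter carries the factor [v^-1]. *)
Lemma ls_error_second_moment p n k (r : 'cV[R]_n) (X : T -> 'M[R]_(p, n)) j :
  gaussian_mx P v X -> (k <= n)%N -> (k + 1 < p)%N ->
  (pid_mx k : 'M[R]_(n, k))^T *m r = 0 ->
  (\int[P]_w ((ls_error k r (X w) j 0) ^+ 2)%:E =
   (mxnorm2 r / (p - k - 1)%:R)%:E)%E.
Proof.
case: k j => [[]//|k] j gX kn kp Er.
have mX := gaussian_mx_measurable gX.
have r0 (l : 'I_n) : (l < k.+1)%N -> r l 0 = 0.
  move=> lk; have := congr1 (fun A : 'cV[R]_k.+1 => A (Ordinal lk) 0) Er.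
  rewrite !mxE (bigD1 l)//= big1 => [|l' l'l].
    by rewrite !mxE/= eqxx lk mul1r addr0.
  by rewrite !mxE/= -[_ == _]/(l' == l) (negbTE l'l) mul0r.
pose J : pred ('I_p * 'I_n) := [pred il : 'I_p * 'I_n | (il.2 < k.+1)%N].
pose G (Z : 'M[R]_(p, n)) : \bar R := ((ls_error k.+1 r Z j 0) ^+ 2)%:E.
have mG : measurable_fun [set: 'M[R]_(p, n)] G.
  apply/measurable_EFinP; apply: measurable_funX; apply: measurable_entry.
  by apply: measurable_ls_error; exact: measurable_id.
rewrite (gaussian_mx_resample J gX gX mG); last first.
  by move=> Z; rewrite lee_fin sqr_ge0.
have gXE := gaussian_mx_pid kn gX.
pose E : 'M[R]_(n, k.+1) := pid_mx k.+1.
transitivity (\int[P]_w ((v * mxnorm2 r)%:E * (mxnorm2 (row j (pinv (X w *m E))))%:E))%E.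
  apply: eq_integral => w _.
  rewrite -EFinM -mulrA [mxnorm2 r * _]mulrC.
  rewrite -(gaussian_bilinear_second_moment _ _ gX).
  apply: eq_integral => w' _; rewrite /G /ls_error; congr (_ ^+ 2)%:E.
  have -> : mix_mx J (X w) (X w') *m pid_mx k.+1 = X w *m E.
    apply/matrixP => i l; rewrite !mxE; apply: eq_bigr => s _.
    rewrite !mxE /J/=; case: ifP => // sk.
    by rewrite andbF !mulr0.
  have -> : mix_mx J (X w) (X w') *m r = X w' *m r.
    apply/matrixP => i l; rewrite !mxE; apply: eq_bigr => s _.
    rewrite !mxE /J/=; case: ifP => // sk.
    by rewrite ord1 r0// !mulr0.
  by rewrite -mulmxA -row_mul [RHS]mxE.
rewrite ge0_integralZl//.
- under eq_integral do rewrite pinv_row_norm.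
  rewrite (gaussian_gram_inv_diag v_gt0 j gXE)//; last by lia.
  rewrite -EFinM; congr EFin.
  have -> : (p - k - 2 = p - k.+1 - 1)%N by lia.
  have n0 : (p - k.+1 - 1)%:R != 0 :> R by rewrite pnatr_eq0; lia.
  by field; rewrite n0 gt_eqF.
- apply/measurable_EFinP; apply: measurable_mxnorm2.
  apply/measurable_fun_matrixP => a b; under eq_fun do rewrite mxE.
  apply: measurable_entry; apply: measurable_pinv.
  exact: gaussian_mx_measurable gXE.
- by move=> w _; rewrite lee_fin mxnorm2_ge0.
- by rewrite lee_fin mulr_ge0 ?mxnorm2_ge0// ltW.
Qed.

End least_squares_estimator.

Section unbiasedness.
Context {R : realType} (v : R) (v_gt0 : 0 < v).
Context d (T : measurableType d) (P : probability T R).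

Lemma gaussian_mx_mul_orthogonal p q (X : T -> 'M[R]_(p, q)) (Q : 'M[R]_q) :
  gaussian_mx P v X -> Q *m Q^T = 1%:M -> gaussian_mx P v (fun w => X w *m Q).
Proof.
move=> gX QQ; have mX := gaussian_mx_measurable gX.
have mXQ : measurable_fun [set: T] (fun w => X w *m Q) by exact: measurable_mulmx.
split => // B mB; rewrite -gX.2//.
pose D := [set Z : 'M[R]_(p, q) | forall i j, B (i, j) (Z i j)].
have mD : measurable D by exact: (measurable_matrix_forall (fun i j => mB (i, j))).
have PE (Y : T -> 'M[R]_(p, q)) : measurable_fun [set: T] Y ->
    P [set w | forall ij, B ij (Y w ij.1 ij.2)] = (\int[P]_w (\1_D (Y w))%:E)%E.
  move=> mY; have mYD : measurable (Y @^-1` D).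
    by have := mY measurableT _ mD; rewrite setTI.
  transitivity (P (Y @^-1` D)).
    congr (P _); apply/seteqP; split => w h; first by move=> i j; exact: (h (i, j)).
    by move=> [i j]; exact: h.
  by rewrite -[X in P X]setIT -integral_indic.
rewrite !PE//; apply: (gaussian_mx_orthogonal v_gt0 (G := EFin \o \1_D) gX QQ).
- by apply/measurable_EFinP; exact: measurable_indic.
- by move=> Z; rewrite lee_fin.
Qed.

(** The nonnegative case for the absolute value transfers integrability in both directions, since
    [c] is positive and finite; the positive and negative parts then give the equality. *)
Lemma gaussian_mx_change_signed p q (X : T -> 'M[R]_(p, q)) (C : 'M[R]_q) :
  gaussian_mx P v X -> C \in unitmx ->
  exists2 c : R, 0 < c & forall phi : 'M[R]_(p, q) -> R,
  measurable_fun [set: 'M[R]_(p, q)] phi ->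
  (P.-integrable setT (fun w => (phi (X w *m C))%:E) <->
   P.-integrable setT (fun w => (phi (X w) * gaussian_weight v C (X w))%:E)) /\
  (P.-integrable setT (fun w => (phi (X w) * gaussian_weight v C (X w))%:E) ->
   \int[P]_w (phi (X w *m C))%:E =
   c%:E * \int[P]_w (phi (X w) * gaussian_weight v C (X w))%:E)%E.
Proof.
move=> gX uC; have mX := gaussian_mx_measurable gX.
have [c c0 chg] := gaussian_mx_change v_gt0 gX uC.
exists c => // phi mphi.
have mXC : measurable_fun [set: T] (fun w => X w *m C) by exact: measurable_mulmx.
have mW := measurable_gaussian_weight v C mX.
have W0 w : 0 <= gaussian_weight v C (X w) by exact: gaussian_weight_ge0.
have mphiX : measurable_fun [set: T] (fun w => phi (X w)) by exact: measurableT_comp.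
have habs : (\int[P]_w `|(phi (X w *m C))%:E| =
    c%:E * \int[P]_w `|(phi (X w) * gaussian_weight v C (X w))%:E|)%E.
  rewrite (chg (fun Z => `|(phi Z)%:E|%E))//.
    apply: (congr1 (mule _)); apply: eq_integral => w _.
    by rewrite EFinM abseM (gee0_abs (x := (gaussian_weight _ _ _)%:E)) ?lee_fin.
  by apply: measurableT_comp => //; exact/measurable_EFinP.
split.
  split => /integrableP[_ i]; apply/integrableP; split.
  - by apply/measurable_EFinP; exact: measurable_funM.
  - move: i; rewrite habs.
    case: (\int[P]_w `|(phi (X w) * _)%:E|)%E => [r _|//|//]; first exact: ltry.
    by rewrite gt0_muley.
  - by apply/measurable_EFinP; exact: measurableT_comp.
  - by rewrite habs lte_mul_pinfty// lee_fin ltW.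
move=> iW.
have mE : measurable_fun [set: 'M[R]_(p, q)] (EFin \o phi) by exact/measurable_EFinP.
pose f w := (phi (X w) * gaussian_weight v C (X w))%:E.
have ep : (\int[P]_w ((EFin \o phi) \o (fun w => X w *m C))^\+ w = c%:E * \int[P]_w f^\+ w)%E.
  rewrite [X in integral _ _ X](funepos_comp (EFin \o phi) (fun w => X w *m C)).
  apply: (etrans (chg _ (measurable_funepos mE) (fun Z => funepos_ge0 _ Z))).
  apply: (congr1 (mule _)); apply: eq_integral => w _.
  rewrite !funeposE /= -!EFin_max -EFinM; congr EFin.
  by rewrite maxr_pMl// mul0r.
have en : (\int[P]_w ((EFin \o phi) \o (fun w => X w *m C))^\- w = c%:E * \int[P]_w f^\- w)%E.
  rewrite [X in integral _ _ X](funeneg_comp (EFin \o phi) (fun w => X w *m C)).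
  apply: (etrans (chg _ (measurable_funeneg mE) (fun Z => funeneg_ge0 _ Z))).
  apply: (congr1 (mule _)); apply: eq_integral => w _.
  rewrite !funenegE /= -!EFin_max -EFinM; congr EFin.
  by rewrite maxr_pMl// mul0r mulNr.
apply: (etrans (integralE P setT ((EFin \o phi) \o (fun w => X w *m C)))).
apply: (etrans _ (esym (congr1 (mule c%:E) (integralE P setT f)))).
apply: (etrans (congr2 (fun a b => a - b)%E ep en)).
have iWn : (\int[P]_w f^\- w)%E \is a fin_num := integrable_neg_fin_num measurableT iW.
have key (a b : \bar R) : b \is a fin_num -> (c%:E * a - c%:E * b = c%:E * (a - b))%E.
  by move=> fb; rewrite muleBr// fin_num_adde_defl// fin_numN.
exact: key iWn.
Qed.

Lemma ls_error_integrable p n k (r : 'cV[R]_n) (X : T -> 'M[R]_(p, n)) j :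
  gaussian_mx P v X -> (k <= n)%N -> (k + 1 < p)%N ->
  (pid_mx k : 'M[R]_(n, k))^T *m r = 0 ->
  P.-integrable setT (fun w => (ls_error k r (X w) j 0)%:E) /\
  P.-integrable setT (fun w => ((ls_error k r (X w) j 0) ^+ 2)%:E).
Proof.
move=> gX kn kp Er; have mX := gaussian_mx_measurable gX.
have mL : measurable_fun [set: T] (fun w => ls_error k r (X w) j 0).
  by apply: measurable_entry; exact: measurable_ls_error.
have i2 : P.-integrable setT (fun w => ((ls_error k r (X w) j 0) ^+ 2)%:E).
  apply/integrableP; split; first by apply/measurable_EFinP; exact: measurable_funX.
  under eq_integral do rewrite gee0_abs ?lee_fin ?sqr_ge0//.
  by rewrite (ls_error_second_moment v_gt0 j gX)// ltry.
split => //.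
have i1 : P.-integrable setT (fun w => (1 + (ls_error k r (X w) j 0) ^+ 2)%:E).
  under eq_fun do rewrite EFinD.
  by apply: integrableD => //; exact: finite_measure_integrable_cst.
apply: (le_integrable measurableT _ _ i1); first exact/measurable_EFinP.
move=> w _; rewrite /= lee_fin; set x := ls_error _ _ _ _ _.
rewrite [leRHS]ger0_norm; last by rewrite addr_ge0// sqr_ge0.
have := sqr_ge0 (`|x| - 1); have := normr_ge0 x.
rewrite -[x ^+ 2]real_normK ?num_real//; nra.
Qed.

(** Splitting [C r] into its regression on the columns of [C E] and a residual [rho] writes the
    error at [X C] as the constant [ls_error k r C] plus a term odd under the reflection. The bound
    on the weight provides the integrability that a cancellation by symmetry requires. *)
Lemma ls_error_unbiased p n k (r : 'cV[R]_n) (X : T -> 'M[R]_(p, n))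
    (C : 'M[R]_n) j :
  gaussian_mx P v X -> (k <= n)%N -> (k + 1 < p)%N ->
  (pid_mx k : 'M[R]_(n, k))^T *m r = 0 -> C \in unitmx ->
  (forall Z : 'M[R]_(p, n), gaussian_weight v C Z <= 1) ->
  P.-integrable setT (fun w => (ls_error k r (X w *m C) j 0)%:E) /\
  (\int[P]_w (ls_error k r (X w *m C) j 0)%:E = (ls_error k r C j 0)%:E)%E.
Proof.
move=> gX kn kp Er uC W1; have mX := gaussian_mx_measurable gX.
have [iL _] := ls_error_integrable j gX kn kp Er.
pose E : 'M[R]_(n, k) := pid_mx k.
have mW := measurable_gaussian_weight v C mX.
have W0 w : 0 <= gaussian_weight v C (X w) by exact: gaussian_weight_ge0.
have mls : measurable_fun [set: 'M[R]_(p, n)] (fun Z => ls_error k r Z j 0).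
  by apply: measurable_entry; apply: measurable_ls_error; exact: measurable_id.
have iLC : P.-integrable setT (fun w => (ls_error k r (X w *m C) j 0)%:E).
  have [c _ chg] := gaussian_mx_change_signed gX uC.
  apply/(chg _ mls).1; apply: (le_integrable measurableT _ _ iL).
    by apply/measurable_EFinP; apply: measurable_funM => //; exact: measurableT_comp mls mX.
  by move=> w _; rewrite /= lee_fin normrM ler_piMr// ger0_norm.
split => //.
pose D := [set Z : 'M[R]_(p, n) | \det ((Z *m E)^T *m (Z *m E)) = 0].
have mD : measurable D.
  have mdet : measurable_fun [set: 'M[R]_(p, n)]
      (fun Z => \det ((Z *m E)^T *m (Z *m E))).
    have mZE : measurable_fun [set: 'M[R]_(p, n)] (fun Z => Z *m E).
      by apply: measurable_mulmx => //; exact: measurable_id.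
    apply: measurable_det; apply: measurable_mulmx => //.
    exact: measurable_trmx.
  by have := mdet measurableT _ (measurable_set1 0); rewrite setTI.
have preim (Y : T -> 'M[R]_(p, n)) : measurable_fun [set: T] Y ->
    P (Y @^-1` D) = (\int[P]_w (\1_D (Y w))%:E)%E.
  move=> mY; have mYD : measurable (Y @^-1` D).
    by have := mY measurableT _ mD; rewrite setTI.
  by rewrite -[X in P X]setIT -integral_indic.
have mXC : measurable_fun [set: T] (fun w => X w *m C) by exact: measurable_mulmx.
have mind : measurable_fun [set: 'M[R]_(p, n)]
    (EFin \o (\1_D : 'M[R]_(p, n) -> R)).
  by apply/measurable_EFinP; exact: measurable_indic.
(* The splitting needs [X C E] to have full rank. The change of variables carries this almost sure
   property from [X] to [X C]. *)
have bad0 : P ((fun w => X w *m C) @^-1` D) = 0%E.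
  have D0 : P (X @^-1` D) = 0%E.
    by apply: gaussian_gram_neq0 (gaussian_mx_pid kn gX) _ => //; lia.
  have [c c0 chg] := gaussian_mx_change v_gt0 gX uC.
  apply: (etrans (preim _ mXC)); apply: (etrans (chg (EFin \o \1_D) mind _)).
    by move=> Z; rewrite lee_fin.
  apply/eqP; rewrite mule_eq0; apply/orP; right; rewrite eq_le; apply/andP; split.
    rewrite -D0 (preim _ mX); apply: ge0_le_integral => //.
    - by move=> w _; rewrite -EFinM lee_fin mulr_ge0.
    - apply: emeasurable_funM; last exact/measurable_EFinP.
      exact: measurableT_comp mind mX.
    - exact: measurableT_comp mind mX.
    - by move=> w _; rewrite -EFinM lee_fin ler_piMr.
  by apply: integral_ge0 => w _; rewrite -EFinM lee_fin mulr_ge0.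
have rCE : \rank (C *m E) = k.
  rewrite (eqmxMfull _ (_ : row_full C)) ?row_full_unit//.
  by rewrite rank_pid_mx.
have CEpinv : (C *m E)^T *m (C *m E) *m pinv (C *m E) = (C *m E)^T.
  by apply: gram_pinv; exact: det_gram_full_rank.
pose rho := C *m r - C *m E *m ls_error k r C.
(* The Householder reflection along [rho]. For [rho = 0] the convention on inverses makes it the
   identity, and [Q *m rho = - rho] still holds. *)
pose Q := 1%:M - (2 / mxnorm2 rho) *: (rho *m rho^T).
have rrho : rho^T *m rho = (mxnorm2 rho)%:M.
  by rewrite [LHS]mx11_scalar -trace_mx11 mxtrace_mulC.
have CErho : (C *m E)^T *m rho = 0.
  rewrite /rho mulmxBr /ls_error -/E (mulmxA (C *m E)^T (C *m E)).
  by rewrite [X in _ - X]mulmxA CEpinv subrr.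
have Qrho : Q *m rho = - rho.
  rewrite mulmxBl mul1mx -scalemxAl -mulmxA rrho mul_mx_scalar scalerA.
  have [r0|r0] := eqVneq (mxnorm2 rho) 0.
    by rewrite (mxnorm2_eq0 r0) scaler0 oppr0 addr0.
  by rewrite divfK// scaler_nat mulr2n opprD addrA subrr sub0r.
have QT : Q^T = Q by rewrite /Q linearB linearZ /= trmx1 trmx_mul trmxK.
have QQ : Q *m Q^T = 1%:M.
  by rewrite QT {2}/Q mulmxBr mulmx1 -scalemxAr mulmxA Qrho mulNmx scalerN
    opprK /Q subrK.
have QCE : Q *m (C *m E) = C *m E.
  rewrite mulmxBl mul1mx -scalemxAl -mulmxA (_ : rho^T *m (C *m E) = 0).
    by rewrite mulmx0 scaler0 subr0.
  by apply: trmx_inj; rewrite trmx_mul trmxK CErho trmx0.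
pose y (Z : 'M[R]_(p, n)) := (pinv (Z *m (C *m E)) *m (Z *m rho)) j 0.
have yQ Z : y (Z *m Q) = - y Z.
  by rewrite /y -!mulmxA QCE Qrho !mulmxN mxE.
have my : measurable_fun [set: 'M[R]_(p, n)] y.
  apply: measurable_entry; apply: measurable_mulmx.
    by apply: measurable_pinv; apply: measurable_mulmx => //; exact: measurable_id.
  by apply: measurable_mulmx => //; exact: measurable_id.
have myX : measurable_fun [set: T] (fun w => y (X w)) by exact: measurableT_comp.
have mlsX : measurable_fun [set: T] (fun w => ls_error k r (X w *m C) j 0).
  exact: measurableT_comp mls mXC.
have ae : ae_eq P setT (fun w => (ls_error k r (X w *m C) j 0)%:E)
    (fun w => (y (X w) + ls_error k r C j 0)%:E).
  exists ((fun w => X w *m C) @^-1` D); split => //.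
    by have := mXC measurableT _ mD; rewrite setTI.
  move=> w nw; rewrite /D/=.
  have [//|dw] := eqVneq (\det ((X w *m C *m E)^T *m (X w *m C *m E))) 0.
  exfalso; apply: nw => _; congr EFin.
  rewrite /ls_error -/E.
  have -> : X w *m C *m r = X w *m C *m E *m ls_error k r C + X w *m rho.
    by rewrite /rho mulmxBr !mulmxA addrC subrK.
  by rewrite mulmxDr mulmxA pinv_mul// mul1mx mxE addrC /y (mulmxA (X w) C E).
have iys : P.-integrable setT (fun w => (y (X w) + ls_error k r C j 0)%:E).
  apply/integrableP; split.
    by apply/measurable_EFinP; exact: measurable_funD.
  move/integrableP : iLC => [_]; rewrite (@ae_eq_integral _ _ _ P setT
    (fun w => `|(y (X w) + ls_error k r C j 0)%:E|%E))//.
  - by apply: measurableT_comp => //; exact/measurable_EFinP.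
  - by apply: measurableT_comp => //; apply/measurable_EFinP; exact: measurable_funD.
  - by case: ae => B [mB B0 sB]; exists B; split => // w nw; apply: sB => h;
      apply: nw => /h ->.
have ic : P.-integrable setT (fun=> (ls_error k r C j 0)%:E).
  exact: finite_measure_integrable_cst.
have iy : P.-integrable setT (fun w => (y (X w))%:E).
  rewrite (_ : (fun w => _) = (fun w => (y (X w) + ls_error k r C j 0)%:E -
      (ls_error k r C j 0)%:E)%E); first exact: integrableB.
  by apply/funext => w; rewrite -EFinB addrK.
have y0 : (\int[P]_w (y (X w))%:E = 0)%E.
  have gXQ := gaussian_mx_mul_orthogonal gX QQ.
  have [_] := gaussian_mx_integrable (G := EFin \o y) gX gXQ
    (iffRL (measurable_EFinP _ _) my) iy.
  have -> : (\int[P]_w (EFin \o y) (X w *m Q) = - \int[P]_w (y (X w))%:E)%E.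
    rewrite -integralN; last exact: integrable_add_def.
    by apply: eq_integral => w _; rewrite /= yQ EFinN.
  have := integrable_fin_num measurableT iy.
  move: (integral _ _ _) => [x|//|//] _ [xx].
  by congr EFin; lra.
transitivity (\int[P]_w (y (X w) + ls_error k r C j 0)%:E)%E.
  apply: ae_eq_integral => //; apply/measurable_EFinP => //.
  exact: measurable_funD.
under eq_integral do rewrite EFinD.
rewrite integralD// y0 add0e integral_cst// -[RHS]mule1.
by apply: (congr1 (mule _)); exact: probability_setT.
Qed.

End unbiasedness.

(** * The Gram matrix as a function of bounded exponential statistics *)

Section gram_statistic.
Context {R : realType}.
Variables (p n : nat).

Definition sum_vec (ij : 'I_n * 'I_n) : 'cV[R]_n :=
  delta_mx ij.1 0 + delta_mx ij.2 0.

Definition exp_gram (Z : 'M[R]_(p, n)) : 'M[R]_n :=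
  \matrix_(i, j) expR (- mxnorm2 (Z *m sum_vec (i, j))).

(** Polarisation: [- ln (U i j)] is [G i i + G j j + 2 G i j], and [- ln (U i i)] is [4 G i i]
    because [sum_vec (i, i)] is twice a unit vector; hence the divisions by 4 and 2. *)
Definition gram_of_exp (U : 'M[R]_n) : 'M[R]_n :=
  \matrix_(i, j) (((ln (U i i) + ln (U j j)) / 4 - ln (U i j)) / 2).

Lemma exp_gramK Z : gram_of_exp (exp_gram Z) = Z^T *m Z.
Proof.
pose G := Z^T *m Z.
have mulE i j : mxnorm2 (Z *m sum_vec (i, j)) = G i i + G j j + G i j *+ 2.
  have GS : G j i = G i j.
    by rewrite !mxE; apply: eq_bigr => l _; rewrite !mxE mulrC.
  rewrite -mxnorm2_tr /mxnorm2 trmxK trmx_mul mulmxA -(mulmxA _ Z^T) -/G.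
  rewrite trace_mx11 /sum_vec/= [trmx (_ + _)]linearD/= !trmx_delta !mulmxDl !mulmxDr.
  have dE a b : (delta_mx 0 a *m G *m delta_mx b 0 : 'M[R]_1) 0 0 = G a b.
    by rewrite -rowE -colE !mxE.
  have addE (B C : 'M[R]_1) : (B + C) 0 0 = B 0 0 + C 0 0 by rewrite mxE.
  by rewrite !addE !dE GS; ring.
have lnE i j : ln (exp_gram Z i j) = - (G i i + G j j + G i j *+ 2).
  by rewrite mxE expRK mulE.
by apply/matrixP => i j; rewrite [LHS]mxE !lnE -/G; field.
Qed.

Lemma exp_gram_ge0_le1 Z i j : 0 <= exp_gram Z i j <= 1.
Proof.
by rewrite mxE expR_ge0 -[leRHS]expR0 ler_expR oppr_le0 mxnorm2_ge0.
Qed.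

(** With [C = invmx H] the weight involves [|Z H|^2 - |Z|^2], linear in [H H^T - 1]. The
    coefficients [2 v k] of the rank-one terms cancel the denominator of the weight and leave the
    exponents [k]. *)
Lemma gaussian_weight_exp_gram v (k : 'I_n * 'I_n -> nat) : 0 < v ->
  exists2 C : 'M[R]_n, C \in unitmx & forall Z : 'M[R]_(p, n),
    gaussian_weight v C Z = \prod_ij exp_gram Z ij.1 ij.2 ^+ k ij.
Proof.
move=> v_gt0.
have w0 ij : 0 <= v *+ 2 * (k ij)%:R by rewrite mulr_ge0 ?mulrn_wge0 ?ltW.
have [H uH HE] := tilt_sqrt (index_enum _) sum_vec w0.
exists (invmx H); first by rewrite unitmx_inv.
move=> Z; rewrite /gaussian_weight invmxK.
have -> : mxnorm2 (Z *m H) = mxnorm2 Z +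
    \sum_ij v *+ 2 * (k ij)%:R * mxnorm2 (Z *m sum_vec ij).
  rewrite {1}/mxnorm2 trmx_mul mulmxA -(mulmxA Z) HE mulmxDr mulmx1 mulmxDl.
  rewrite mxtraceD; congr (_ + _).
  rewrite mulmx_sumr mulmx_suml raddf_sum/=; apply: eq_bigr => ij _.
  rewrite -scalemxAr -scalemxAl mxtraceZ /mxnorm2; congr (_ * \tr _).
  by rewrite trmx_mul !mulmxA.
rewrite addrC addKr mulNr mulr_suml -sumrN expR_sum; apply: eq_bigr => -[i j] _.
rewrite mxE -expRM_natl.
by congr expR; field; rewrite gt_eqF.
Qed.

Definition ls_error_of_gram k (r : 'cV[R]_n) (G : 'M[R]_n) : 'cV[R]_k :=
  let E : 'M[R]_(n, k) := pid_mx k in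
  ((\det (E^T *m G *m E))^-1 *: \adj (E^T *m G *m E)) *m (E^T *m G *m r).

Lemma ls_error_gram k r (Z : 'M[R]_(p, n)) :
  ls_error k r Z = ls_error_of_gram k r (Z^T *m Z).
Proof. by rewrite /ls_error /pinv /ls_error_of_gram trmx_mul !mulmxA. Qed.

Lemma measurable_gram_of_exp d (T : measurableType d) (F : T -> 'M[R]_n) :
  measurable_fun [set: T] F ->
  measurable_fun [set: T] (fun w => gram_of_exp (F w)).
Proof.
move=> mF; have ml i j : measurable_fun [set: T] (fun w => ln (F w i j)).
  by apply: (measurableT_comp (@measurable_ln R)); exact: measurable_entry.
apply/measurable_fun_matrixP => i j; under eq_fun do rewrite mxE.
apply: measurable_funM => //; apply: measurable_funB => //.
by apply: measurable_funM => //; exact: measurable_funD.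
Qed.

Lemma measurable_ls_error_of_gram d (T : measurableType d) k r
    (F : T -> 'M[R]_n) : measurable_fun [set: T] F ->
  measurable_fun [set: T] (fun w => ls_error_of_gram k r (F w)).
Proof.
move=> mF; set E : 'M[R]_(n, k) := pid_mx k.
have mEF : measurable_fun [set: T] (fun w => E^T *m F w).
  exact: measurable_mulmx.
have mEFE : measurable_fun [set: T] (fun w => E^T *m F w *m E).
  exact: measurable_mulmx.
apply: measurable_mulmx; last exact: measurable_mulmx.
apply/measurable_fun_matrixP => i j; under eq_fun do rewrite mxE.
apply: measurable_funM; last by apply: measurable_entry; exact: measurable_adj.
by apply: (measurableT_comp (@measurable_invr R)); exact: measurable_det.
Qed.

Lemma measurable_exp_gram d (T : measurableType d) (F : T -> 'M[R]_(p, n)) :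
  measurable_fun [set: T] F -> measurable_fun [set: T] (fun w => exp_gram (F w)).
Proof.
move=> mF; apply/measurable_fun_matrixP => i j; under eq_fun do rewrite mxE.
apply: (measurableT_comp (@measurable_expR R)); apply: measurableT_comp => //.
by apply: measurable_mxnorm2; exact: measurable_mulmx.
Qed.

End gram_statistic.

(** From [h^2 + 2 (f - h) h <= f^2]. If the second moment of [f] is infinite there is nothing to
    prove; if it is finite the cross product is integrable, which is why orthogonality is assumed
    only in that case. *)
Lemma le_second_moment_orthogonal {R : realType} d (T : measurableType d)
    (P : {measure set T -> \bar R}) (f h : T -> R) :
  measurable_fun [set: T] f -> measurable_fun [set: T] h ->
  P.-integrable setT (fun w => (h w ^+ 2)%:E) ->
  (P.-integrable setT (fun w => ((f w - h w) * h w)%:E) ->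
    \int[P]_w ((f w - h w) * h w)%:E = 0)%E ->
  (\int[P]_w (h w ^+ 2)%:E <= \int[P]_w (f w ^+ 2)%:E)%E.
Proof.
move=> mf mh ih oh.
have f0 : (0 <= \int[P]_w (f w ^+ 2)%:E)%E.
  by apply: integral_ge0 => w _; rewrite lee_fin sqr_ge0.
have mf2 : measurable_fun [set: T] (fun w => (f w ^+ 2)%:E).
  by apply/measurable_EFinP; exact: measurable_funX.
have [fy|fy] := eqVneq (\int[P]_w (f w ^+ 2)%:E)%E +oo%E; first by rewrite fy leey.
have i_f : P.-integrable setT (fun w => (f w ^+ 2)%:E).
  apply/integrableP; split => //.
  under eq_integral do rewrite gee0_abs ?lee_fin ?sqr_ge0//.
  by rewrite ltey.
have ifh : P.-integrable setT (fun w => ((f w - h w) * h w)%:E).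
  have i3 : P.-integrable setT (fun w => (f w ^+ 2 + 2 * h w ^+ 2)%:E).
    under eq_fun do rewrite EFinD EFinM.
    apply: integrableD => //. exact: (integrableZl _ 2 ih).
  apply: le_integrable i3 => //.
    by apply/measurable_EFinP; apply: measurable_funM => //; exact: measurable_funB.
  move=> w _; rewrite /= lee_fin [leRHS]ger0_norm.
    by rewrite ler_norml; apply/andP; split; nra.
  by rewrite addr_ge0 ?sqr_ge0// mulr_ge0// sqr_ge0.
have i2fh : P.-integrable setT (fun w => (2 * ((f w - h w) * h w))%:E).
  by under eq_fun do rewrite EFinM; exact: (integrableZl _ 2 ifh).
have -> : (\int[P]_w (h w ^+ 2)%:E =
    \int[P]_w (h w ^+ 2 + 2 * ((f w - h w) * h w))%:E)%E.
  under [RHS]eq_integral do rewrite EFinD.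
  rewrite integralD//.
  have -> : (\int[P]_w (2 * ((f w - h w) * h w))%:E = 0)%E.
    under eq_integral do rewrite EFinM.
    by rewrite integralZl// oh// mule0.
  by rewrite adde0.
apply: le_integral => //.
  by under eq_fun do rewrite EFinD; exact: integrableD.
by move=> w _; rewrite lee_fin; have := sqr_ge0 (f w - h w); nra.
Qed.

(** * The estimator in orthonormal coordinates *)

Section reduced_estimator.
Context {R : realType}.
Variables (m n k : nat) (g : 'M[R]_(m, k) * 'cV[R]_m -> 'cV[R]_k).
Variables (B : 'M[R]_k) (x : 'cV[R]_k) (r : 'cV[R]_n).
Let E : 'M[R]_(n, k) := pid_mx k.

(* The error of [g], in the coordinates given by [B], for the data matrix
   [E *m B] and the vector [E *m B *m x + r]. *)
Definition reduced_error (Z : 'M[R]_(m, n)) : 'cV[R]_k :=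
  B *m (g (Z *m (E *m B), Z *m (E *m B *m x + r)) - x).

Lemma measurable_reduced_error :
  measurable_fun [set: 'M[R]_(m, k) * 'cV[R]_m] g ->
  measurable_fun [set: 'M[R]_(m, n)] reduced_error.
Proof.
move=> mg; apply: measurable_mulmx => //; apply: measurable_mxD => //.
apply: (measurableT_comp mg); apply: measurable_fun_pair.
  by apply: measurable_mulmx => //; exact: measurable_id.
by apply: measurable_mulmx => //; exact: measurable_id.
Qed.

Hypotheses (kn : (k <= n)%N) (uB : B \in unitmx).

Lemma mxrank_unitmx_pid (C : 'M[R]_n) : C \in unitmx ->
  \rank (C *m (E *m B)) = k.
Proof.
move=> uC; rewrite (eqmxMfull _ (_ : row_full C)) ?row_full_unit//.
by rewrite mxrankMfree ?row_free_unit// rank_pid_mx.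
Qed.

(** Multiplying the data by [C] leaves the part [E B x] of the vector in the column space, and moves
    the solution by the regression coefficients of [C r] on [C E]. Thus the formula for the sketched
    error, evaluated at [C], also describes the true solution for transformed data. *)
Lemma x_LS_reduced (C : 'M[R]_n) : C \in unitmx ->
  B *m (x_LS (C *m (E *m B)) (C *m (E *m B *m x + r)) - x) = ls_error k r C.
Proof.
move=> uC; rewrite (x_LS_unique (x := x + invmx B *m ls_error k r C)).
- by rewrite addrC addKr mulKVmx.
- exact: mxrank_unitmx_pid.
have dCE : \det ((C *m E)^T *m (C *m E)) != 0.
  apply: det_gram_full_rank.
  by rewrite (eqmxMfull _ (_ : row_full C)) ?row_full_unit// rank_pid_mx.
have -> : C *m (E *m B *m x + r) - C *m (E *m B) *m (x + invmx B *m ls_error k r C) =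
    C *m r - C *m E *m ls_error k r C.
  by rewrite !mulmxDr !mulmxA mulmxK// opprD addrACA subrr add0r.
rewrite mulmxA trmx_mul -(mulmxA B^T) /ls_error -/E mulmxBr.
rewrite (mulmxA (C *m E)^T (C *m E)) (mulmxA ((C *m E)^T *m (C *m E))).
by rewrite gram_pinv// subrr mulmx0.
Qed.

(** Sketching the transformed data by [S] is sketching the original data by [S *m C], so
    unbiasedness is invoked at the matrix [C *m (E *m B)] and the vector
    [C *m (E *m B *m x + r)]. *)
Lemma reduced_error_unbiased d (T : measurableType d) (P : probability T R)
    (S : {RV P >-> 'M[R]_(m, n)}) (C : 'M[R]_n) j :
  unbiased_estimator S g -> C \in unitmx ->
  P.-integrable setT (fun w => (reduced_error (S w *m C) j 0)%:E) /\
  (\int[P]_w (reduced_error (S w *m C) j 0)%:E = (ls_error k r C j 0)%:E)%E.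
Proof.
move=> ub uC; pose A := C *m (E *m B); pose y := C *m (E *m B *m x + r).
have uby := ub A y (mxrank_unitmx_pid uC).
have eE w : (reduced_error (S w *m C) j 0)%:E =
    (\sum_l (B j l)%:E * ((g (S w *m A, S w *m y) l 0)%:E - (x l 0)%:E))%E.
  rewrite /reduced_error mxE -sumEFin; apply: eq_bigr => l _.
  by rewrite EFinM !mxE EFinB /A /y !mulmxA.
have ig l : P.-integrable setT (fun w => (g (S w *m A, S w *m y) l 0)%:E).
  by have [] := uby l.
have ix l : P.-integrable setT (fun=> (x l 0)%:E).
  exact: finite_measure_integrable_cst.
have igx l : P.-integrable setT
    (fun w => (g (S w *m A, S w *m y) l 0)%:E - (x l 0)%:E)%E.
  exact: integrableB.
have iB l : P.-integrable setT
    (fun w => (B j l)%:E * ((g (S w *m A, S w *m y) l 0)%:E - (x l 0)%:E))%E.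
  exact: integrableZl.
have fE : (fun w => (reduced_error (S w *m C) j 0)%:E) =
    (fun w => \sum_l (B j l)%:E * ((g (S w *m A, S w *m y) l 0)%:E - (x l 0)%:E))%E.
  exact/funext.
split; first by rewrite fE; exact: integrable_sum.
rewrite [X in integral _ _ X]fE.
apply: (etrans (integral_sum measurableT iB (index_enum _) xpredT)).
rewrite -(x_LS_reduced uC) [in RHS]mxE -sumEFin.
apply: eq_bigr => l _; apply: (etrans (integralZl measurableT (igx l) _)).
rewrite EFinM; apply: (congr1 (mule _)).
apply: (etrans (integralB measurableT (ig l) (ix l))).
rewrite !mxE EFinB.
have [_] := uby l; rewrite unlock => ug; apply: congr2; first exact: ug.
apply: (congr1 oppe); apply: (etrans (integral_cst _ measurableT _)).
by rewrite -[RHS]mule1; apply: (congr1 (mule _)); exact: probability_setT.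
Qed.

End reduced_estimator.

Section second_moment.
Context {R : realType} (v : R) (v_gt0 : 0 < v).
Context d (T : measurableType d) (P : probability T R).

Lemma reduced_error_second_moment m n k (S : {RV P >-> 'M[R]_(m, n)})
    (g : 'M[R]_(m, k) * 'cV[R]_m -> 'cV[R]_k)
    (B : 'M[R]_k) (x : 'cV[R]_k) (r : 'cV[R]_n) j :
  gaussian_mx P v S -> measurable_fun [set: 'M[R]_(m, k) * 'cV[R]_m] g ->
  unbiased_estimator S g -> (k <= n)%N -> (k + 1 < m)%N -> B \in unitmx ->
  (pid_mx k : 'M[R]_(n, k))^T *m r = 0 ->
  ((mxnorm2 r / (m - k - 1)%:R)%:E <=
   \int[P]_w ((reduced_error g B x r (S w) j 0) ^+ 2)%:E)%E.
Proof.
move=> gS mg ub kn km uB Er; have mS := gaussian_mx_measurable gS.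
rewrite -(ls_error_second_moment v_gt0 j gS kn km Er).
have [iL iL2] := ls_error_integrable v_gt0 j gS kn km Er.
have mf : measurable_fun [set: 'M[R]_(m, n)] (fun Z => reduced_error g B x r Z j 0).
  by apply: measurable_entry; exact: measurable_reduced_error.
have ml : measurable_fun [set: 'M[R]_(m, n)] (fun Z => ls_error k r Z j 0).
  by apply: measurable_entry; apply: measurable_ls_error; exact: measurable_id.
have iF : P.-integrable setT (fun w => (reduced_error g B x r (S w) j 0)%:E).
  (* The case [C = 1] gives integrability of the untilted error. *)
  have [+ _] := reduced_error_unbiased x r kn uB j ub (unitmx1 _ _).
  by under eq_fun do rewrite mulmx1.
pose F w := reduced_error g B x r (S w) j 0 - ls_error k r (S w) j 0.
have iFl : P.-integrable setT (EFin \o F).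
  exact: (integrableB measurableT iF iL).
have mU : measurable_fun [set: T] (fun w => exp_gram (S w)) by exact: measurable_exp_gram.
apply: le_second_moment_orthogonal => //.
- exact: measurableT_comp mf mS.
- exact: measurableT_comp ml mS.
have lU w : ls_error k r (S w) j 0 =
    ls_error_of_gram k r (gram_of_exp (exp_gram (S w))) j 0.
  by rewrite exp_gramK ls_error_gram.
(* Only the second factor is expressed through the bounded statistics; the difference of errors
   remains an arbitrary integrable function of [S]. *)
under eq_fun do rewrite {2}lU.
apply: (moment_completeness iFl mU _ _
    (h := fun U => ls_error_of_gram k r (gram_of_exp U) j 0)) => [w i l|e|].
- exact: exp_gram_ge0_le1.
- have [C uC weightE] := gaussian_weight_exp_gram m e v_gt0.
  have W1 (Z : 'M[R]_(m, n)) : gaussian_weight v C Z <= 1.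
    rewrite weightE; apply: Num.Theory.prodr_ile1 => il _; apply/andP.
    have /andP[u0 u1] := exp_gram_ge0_le1 Z il.1 il.2.
    by rewrite exprn_ge0// exprn_ile1.
  have [c c0 chg] := gaussian_mx_change_signed v_gt0 gS uC.
  pose phi (Z : 'M[R]_(m, n)) := reduced_error g B x r Z j 0 - ls_error k r Z j 0.
  have mphi : measurable_fun [set: 'M[R]_(m, n)] phi by exact: measurable_funB.
  have iW : P.-integrable setT (fun w => (phi (S w) * gaussian_weight v C (S w))%:E).
    apply: (le_integrable measurableT _ _ iFl).
      apply/measurable_EFinP; apply: measurable_funM.
        exact: measurableT_comp mphi mS.
      exact: measurable_gaussian_weight.
    move=> w _; rewrite /= lee_fin normrM ler_piMr//.
    by rewrite ger0_norm ?W1// gaussian_weight_ge0.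
  have [_ /(_ iW)] := chg _ mphi.
  have [if_ fE] := reduced_error_unbiased x r kn uB j ub uC.
  have [il lE] := ls_error_unbiased v_gt0 j gS kn km Er uC W1.
  under eq_integral do rewrite EFinB.
  rewrite integralB// fE lE subee// => /esym/eqP.
  rewrite mule_eq0 eqe gt_eqF//= => /eqP <-.
  by apply: eq_integral => w _; rewrite weightE.
- apply: measurable_entry; apply: measurable_ls_error_of_gram.
  by apply: measurable_gram_of_exp; exact: measurable_id.
Qed.

End second_moment.

Theorem theorem4 (R : realType) (n d m : nat)
    (d_ge1 : (1 <= d)%N) (d_lt_n : (d < n)%N) (m_gt : (d + 1 < m)%N)
    (disp : measure_display) (Omega : measurableType disp)
    (P : probability Omega R)
    (S : {RV P >-> 'M[R]_(m, n)})
    (S_iid : iid_gaussian_entries S 0 (1 / m%:R))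
    (g : 'M[R]_(m, d) * 'cV[R]_m -> 'cV[R]_d)
    (g_meas : measurable_fun [set: 'M[R]_(m, d) * 'cV[R]_m] g)
    (g_unbiased : unbiased_estimator S g)
    (A : 'M[R]_(n, d)) (y : 'cV[R]_n) (rank_A : \rank A = d) :
  ((d%:R / (m%:R - d%:R - 1) * sqnorm2 (y_perp A y))%:E <=
   'E_P[fun w => sqnorm2 (A *m (g (S w *m A, S w *m y) - x_LS A y))])%E.
Proof.
have v_gt0 : 0 < 1 / m%:R :> R by rewrite divr_gt0// ltr0n; lia.
have gS := iid_gaussian_mx S_iid; have mS := gaussian_mx_measurable gS.
have dn : (d <= n)%N := ltnW d_lt_n.
have [V [B [VV uB AE]]] := QR_decomposition dn rank_A.
pose E : 'M[R]_(n, d) := pid_mx d.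
have VtV : V^T *m V = 1%:M by exact: mulmx1C.
(* In the coordinates of [V] the vector [y = A x + y_perp] becomes [E B x + r], with [E B x] in the
   span of the first [d] coordinates and [r] in its orthogonal complement. *)
pose x := x_LS A y; pose r := V^T *m y_perp A y.
have Ay : A^T *m y_perp A y = 0.
  rewrite /y_perp x_LS_pinv// mulmxBr (mulmxA A) (mulmxA A^T) (mulmxA A^T).
  by rewrite gram_pinv ?subrr// det_gram_full_rank.
have Er : E^T *m r = 0.
  have uBT : B^T \in unitmx by rewrite unitmx_tr.
  have -> : E^T *m r = invmx B^T *m (A^T *m y_perp A y).
    by rewrite {1}AE !trmx_mul -/E -!mulmxA mulKmx.
  by rewrite Ay mulmx0.
have rn : mxnorm2 r = sqnorm2 (y_perp A y).
  by rewrite sqnorm2E /r mxnorm2_isometry ?trmxK.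
pose f (Z : 'M[R]_(m, n)) := reduced_error g B x r Z.
have errE w : sqnorm2 (A *m (g (S w *m A, S w *m y) - x)) = mxnorm2 (f (S w *m V)).
  rewrite sqnorm2E /f /reduced_error.
  have -> : S w *m V *m (E *m B) = S w *m A by rewrite AE !mulmxA.
  have -> : S w *m V *m (E *m B *m x + r) = S w *m y.
    rewrite -mulmxA; congr (S w *m _).
    by rewrite mulmxDr /r !mulmxA VV mul1mx -AE /y_perp addrC subrK.
  rewrite {1}AE -mulmxA mxnorm2_isometry// trmx_mul mulmxA -(mulmxA _ V^T).
  by rewrite VtV mulmx1 tr_pid_mx pid_mx_id// pid_mx_1.
have mf : measurable_fun [set: 'M[R]_(m, n)] (fun Z => (mxnorm2 (f Z))%:E).
  apply/measurable_EFinP; apply: measurable_mxnorm2.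
  exact: measurable_reduced_error.
rewrite unlock.
apply: (@le_trans _ _ (\int[P]_w (mxnorm2 (f (S w)))%:E)%E); last first.
  rewrite -(gaussian_mx_orthogonal v_gt0 gS VV mf); last first.
    by move=> Z; rewrite lee_fin mxnorm2_ge0.
  by under [leRHS]eq_integral do rewrite errE.
have -> : (\int[P]_w (mxnorm2 (f (S w)))%:E =
    \sum_j \int[P]_w ((f (S w) j 0) ^+ 2)%:E)%E.
  rewrite -ge0_integral_sum//.
  - by apply: eq_integral => w _; rewrite sumEFin -sqnorm2E.
  - move=> j; apply/measurable_EFinP; apply: measurable_funX.
    apply: measurable_entry; apply: measurableT_comp mS.
    exact: measurable_reduced_error.
  - by move=> j w _; rewrite lee_fin sqr_ge0.
have -> : (d%:R / (m%:R - d%:R - 1) * sqnorm2 (y_perp A y))%:E =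
    (\sum_(j < d) (mxnorm2 r / (m - d - 1)%:R)%:E)%E.
  rewrite sumEFin big_const_ord iter_addr_0 rn; congr EFin.
  by rewrite !natrB; [rewrite -mulr_natl; ring|lia|lia].
apply: lee_sum => j _.
by apply: (reduced_error_second_moment v_gt0 x j gS).
Qed.
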